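(* For each $n\ge 2$, let $P_n$ be a bistochastic transition matrix on a finite set $\Omega_n$ with $|\Omega_n|=n$, and let $$\mathbf{h}_n=\frac1n\sum_{x,y\in\Omega_n}P_n(x,y)\log\frac1{P_n(x,y)}$$ be its entropy rate. Assume that, as $n\to+\infty$: (1) $\delta_n:=\min\{P_n(x,y):\ x,y\in\Omega_n,\ P_n(x,y)>0\}=\dfrac{1}{n^{o(1)}}$, i.e. $\dfrac{\log\delta_n}{\log n}\to 0$; (2) $\Delta:=\sup_{n}\max_{x,y\in\Omega_n}P_n(x,y)<1$; (3) $\mathbf{h}_n=o\left(\dfrac{\log n}{\log\log n}\right)$. Let $\pi_n$ be a uniformly random permutation of $\Omega_n$, let $\Pi_n$ be the corresponding permutation matrix, and let $Q_n=P_n\Pi_n$. Then for every $\varepsilon\in(0,1)$, the $\varepsilon$-mixing time $t_{\mathrm{mix}}^{(n)}(\varepsilon)$ of the chain with transition matrix $Q_n$ satisfies $$\frac{\mathbf{h}_n\, t_{\mathrm{mix}}^{(n)}(\varepsilon)}{\log n}\longrightarrow 1\quad\text{in probability as } n\to+\infty .$$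
   Context: A bistochastic matrix is a nonnegative square matrix all of whose rows and columns sum to $1$. The convention $0\log\frac10=0$ is used. For a permutation $\pi$ of $\Omega_n$, the permutation matrix is $\Pi(i,j)=\mathbf 1_{\{j=\pi(i)\}}$. The uniform distribution is stationary for $Q_n=P_n\Pi_n$. The total-variation distance to equilibrium at time $t$ from $x\in\Omega_n$ is $\mathcal D^{(n)}_x(t)=\sum_{y\in\Omega_n}\left(\frac1n-Q_n^t(x,y)\right)_+$, where $a_+=\max(a,0)$; $\mathcal D^{(n)}(t)=\max_{x\in\Omega_n}\mathcal D^{(n)}_x(t)$; and $t_{\mathrm{mix}}^{(n)}(\varepsilon)=\min\{t\ge0:\ \mathcal D^{(n)}(t)\le\varepsilon\}$ with $t$ ranging over integers (and $\min\emptyset=+\infty$). Since $\pi_n$ is random, $t_{\mathrm{mix}}^{(n)}(\varepsilon)$ is a random variable, and probability refers to the choice of $\pi_n$. *)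

(* Defs.v *)
From HB Require Import structures.
From mathcomp Require Import all_boot all_order all_fingroup all_algebra.
From mathcomp Require Import all_classical all_reals all_analysis.

Set Implicit Arguments.
Unset Strict Implicit.
Unset Printing Implicit Defensive.

Import Order.TTheory GRing.Theory Num.Theory.
Import numFieldNormedType.Exports.

Local Open Scope classical_set_scope.
Local Open Scope ring_scope.

(* An n-element state space is labelled by 'I_n throughout. *)

Definition bistochastic (R : realType) (n : nat) (P : 'M[R]_n) : Prop :=
  [/\ forall x y, 0 <= P x y,
      forall x, \sum_y P x y = 1 &
      forall y, \sum_x P x y = 1].

(* Vanishing entries contribute [0] through the factor [P x y]. *)
Definition entropy_rate (R : realType) (n : nat) (P : 'M[R]_n) : R :=
  n%:R^-1 * \sum_x \sum_y P x y * ln (P x y)^-1.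

(* The neutral element 1 is harmless: the entries of a bistochastic matrix are
   at most 1, and some of them are positive as soon as [0 < n]. *)
Definition min_pos_entry (R : realType) (n : nat) (P : 'M[R]_n) : R :=
  \big[Num.min/1]_(xy : 'I_n * 'I_n | 0 < P xy.1 xy.2) P xy.1 xy.2.

(* The neutral element 0 is harmless for nonnegative matrices; likewise in
   [tv_worst], whose terms are nonnegative. *)
Definition max_entry (R : realType) (n : nat) (P : 'M[R]_n) : R :=
  \big[Num.max/0]_(xy : 'I_n * 'I_n) P xy.1 xy.2.

(* [perm_mx s x y] is 1 if [y = s x] and 0 otherwise. *)
Definition permuted_chain (R : realType) (n : nat) (P : 'M[R]_n) (s : 'S_n) :
    'M[R]_n :=
  P *m perm_mx s.

Definition tv_from (R : realType) (n : nat) (Q : 'M[R]_n) (t : nat)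
    (x : 'I_n) : R :=
  \sum_y Num.max (n%:R^-1 - (Q ^+ t) x y) 0.

Definition tv_worst (R : realType) (n : nat) (Q : 'M[R]_n) (t : nat) : R :=
  \big[Num.max/0]_x tv_from Q t x.

(* The infimum is a minimum if some [t] qualifies, and [+oo] otherwise. *)
Definition mixing_time (R : realType) (n : nat) (Q : 'M[R]_n) (eps : R) :
    \bar R :=
  ereal_inf [set (t%:R)%:E | t in [set t : nat | tv_worst Q t <= eps]].

Definition uniform_perm_prob (R : realType) (n : nat) (A : pred 'S_n) : R :=
  #|A|%:R / #|{: 'S_n}|%:R.

(* Each [X n] lives on its own probability space, 'S_n with the uniform law.
   The value [+oo] counts as far from the limit. *)
Definition cvg_in_perm_prob (R : realType) (X : forall n : nat, 'S_n -> \bar R)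
    (l : R) : Prop :=
  forall eta : R, 0 < eta ->
    (fun n : nat =>
       uniform_perm_prob R [pred s : 'S_n | (eta%:E < `|X n s - l%:E|)%E])
      @ \oo --> (0 : R).

(* Main.v *)
Require Import Defs.
From HB Require Import structures.
From mathcomp Require Import all_boot all_order all_fingroup all_algebra.
From mathcomp Require Import all_classical all_reals all_analysis.
From mathcomp Require Import ring lra zify.

Set Implicit Arguments.
Unset Strict Implicit.
Unset Printing Implicit Defensive.

Import Order.TTheory GRing.Theory Num.Theory.
Import numFieldNormedType.Exports.

Local Open Scope classical_set_scope.
Local Open Scope ring_scope.

(* Choices made along a walk reveal the values of the permutation one by one.
   Until a collision occurs, the images are independent and uniform, so the
   logarithm of the weight of a walk of length t is a sum of nearly independent
   terms of mean h; by Chebyshev it concentrates around t h.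

   Lower bound: if t h is less than (1 - eta) log n, most walks have weight above
   n^(eta/2 - 1), hence only o(n) endpoints carry most of the mass.

   Upper bound on average: if t h exceeds (1 + eta) log n, restrict Q^t to walks
   without collision and of weight below n^(-1 - eta/2).  Two such walks meeting
   at the end either coincide, or collide twice, or part and merge exactly once;
   in the last case the sum over the parting and merging times is geometric and
   amounts to at most 1/n.  Hence the second moment of Q^t is about 1/n and the
   distance to equilibrium is small from most starting points.

   Upper bound everywhere: launch log n walkers of length of order log log n from
   a point whose neighbourhood has no collision.  If the distance stays large,
   greedily many walkers can be chosen with fresh last choices, all ending at
   points with a large distance.  Redirecting these last jumps to independent
   uniform points shows that this has probability o(1/n).  Two collisions near a
   point have probability o(1/n) too, so every point has at most one successor
   that is bad, and a bounded number of steps is likely to leave the bad set, because the entries of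
   P are bounded away from 1.  The total extra time is O(log log n), which is
   negligible as h log log n = o(log n). *)

(** * Walks and distance to equilibrium *)

(** Markov's inequality turns the averaged bound into one for most starting points, with a failure
    probability that merely tends to 0, whereas a union bound over all points needs o(1/n). Each
    redirected jump contributes a factor at most [expR (- 2)], so a number of walkers just above log
    n gives [n^-2] per point. For so many walkers to be fresh, the atoms of their last choice must
    be smaller than a power of 1/log n; this fixes their length at order log log n. Redirecting a
    jump also changes the permutation that defines the distances; the change is controlled by
    expected visits to redirected points, so that the product of distances becomes an interacting
    one. A collision is an overlap of rows, not only a revisit: equal choices have equal images, so
    two walks can merge only through distinct vertices with a choice in common, and tracing choices
    backwards finds the overlap. In the second moment, parting and merging each carry a factor
    [1 - q], where [q] is the probability that two choices from the same uniform state agree; these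
    factors compensate the two geometric series in [q]. *)

Section IteratedSums.
Variables (R : realType) (T : finType).
Implicit Types (F G : seq T -> R) (m : nat).

(** Lists of a given length rather than tuples: cutting a walk into pieces is then [psum_cat], and a
    walk can be summed one choice at a time. *)
Fixpoint psum m F : R :=
  if m is m'.+1 then \sum_u psum m' (fun us => F (u :: us)) else F [::].

Lemma eq_psum m F G :
  (forall us, size us = m -> F us = G us) -> psum m F = psum m G.
Proof.
elim: m F G => [|m IH] F G FG /=; first exact: FG.
by apply: eq_bigr => u _; apply: IH => us sus; apply: FG; rewrite /= sus.
Qed.

Lemma ler_psum m F G :
  (forall us, size us = m -> F us <= G us) -> psum m F <= psum m G.
Proof.
elim: m F G => [|m IH] F G FG /=; first exact: FG.
by apply: ler_sum => u _; apply: IH => us sus; apply: FG; rewrite /= sus.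
Qed.

Lemma psum_ge0 m F : (forall us, size us = m -> 0 <= F us) -> 0 <= psum m F.
Proof.
elim: m F => [|m IH] F F0 /=; first exact: F0.
by apply: sumr_ge0 => u _; apply: IH => us sus; apply: F0; rewrite /= sus.
Qed.

Lemma psumZl m (c : R) F : psum m (fun us => c * F us) = c * psum m F.
Proof.
elim: m F => //= m IH F; rewrite mulr_sumr.
by apply: eq_bigr => u _; rewrite IH.
Qed.

Lemma psumZr m (c : R) F : psum m (fun us => F us * c) = psum m F * c.
Proof. by rewrite mulrC -psumZl; apply: eq_psum => us _; rewrite mulrC. Qed.

Lemma psumD m F G : psum m (fun us => F us + G us) = psum m F + psum m G.
Proof.
elim: m F G => //= m IH F G; rewrite -big_split.
by apply: eq_bigr => u _; rewrite IH.
Qed.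

Lemma psum_sum m (I : Type) (r : seq I) (p : pred I) (F : I -> seq T -> R) :
  psum m (fun us => \sum_(i <- r | p i) F i us) = \sum_(i <- r | p i) psum m (F i).
Proof.
elim: m F => //= m IH F; rewrite exchange_big /=.
by apply: eq_bigr => u _; rewrite IH.
Qed.

Lemma psumB m F G : psum m (fun us => F us - G us) = psum m F - psum m G.
Proof.
by rewrite psumD -[- psum m G]mulN1r -psumZl; congr (_ + _);
  apply: eq_psum => us _; rewrite mulN1r.
Qed.

Lemma psum_cat a b F :
  psum (a + b) F = psum a (fun us => psum b (fun vs => F (us ++ vs))).
Proof.
elim: a F => //= a IH F.
by apply: eq_bigr => u _; rewrite IH.
Qed.

Lemma psum_cst m (c : R) : psum m (fun=> c) = #|T|%:R ^+ m * c.
Proof.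
elim: m => [|m IH] /=; first by rewrite mul1r.
rewrite (eq_bigr (fun=> #|T|%:R ^+ m * c)) // sumr_const exprS.
by rewrite -[LHS]mulr_natl mulrA.
Qed.

Lemma psum_pred1 m us0 (F : seq T -> R) : size us0 = m ->
  psum m (fun us => (us == us0)%:R * F us) = F us0.
Proof.
elim: m us0 F => [|m IH] [|u us0] F //=; first by rewrite mul1r.
case=> sus; rewrite (bigD1 u) //= [X in _ + X]big1 ?addr0.
  rewrite -[RHS](IH us0 (fun us => F (u :: us))) //; apply: eq_psum => us _.
  by rewrite eqseq_cons eqxx.
move=> v vu; rewrite -[RHS](mulr0 (#|T|%:R ^+ m)) -psum_cst.
by apply: eq_psum => us _; rewrite eqseq_cons (negPf vu) mul0r.
Qed.

Lemma psum_diag m (F : seq T -> seq T -> R) :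
  psum m (fun a => psum m (fun b => (b == a)%:R * F a b)) =
  psum m (fun a => F a a).
Proof. by apply: eq_psum => a sa; exact: psum_pred1. Qed.

Lemma psum_ler_term m F us0 : size us0 = m ->
  (forall us, size us = m -> 0 <= F us) -> F us0 <= psum m F.
Proof.
move=> s0 F0; rewrite -[F us0](psum_pred1 F s0); apply: ler_psum => us sus.
by case: eqP => _; rewrite ?mul1r ?mul0r // F0.
Qed.

End IteratedSums.

Lemma psum_exchange (R : realType) (T U : finType) m k
    (F : seq T -> seq U -> R) :
  psum m (fun a => psum k (F a)) = psum k (fun b => psum m (F^~ b)).
Proof.
elim: m F => //= m IH F; rewrite psum_sum.
by apply: eq_bigr => u _; rewrite IH.
Qed.

Section Walks.
Variables (R : realType) (n : nat) (P : 'M[R]_n).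
Hypothesis P_bis : bistochastic P.
Implicit Types (s : 'S_n) (x y z u v : 'I_n) (us a b : seq 'I_n).

Lemma P_ge0 x u : 0 <= P x u. Proof. by case: P_bis. Qed.
Lemma row_sum x : \sum_u P x u = 1. Proof. by case: P_bis. Qed.
Lemma col_sum u : \sum_x P x u = 1. Proof. by case: P_bis. Qed.
Lemma P_le1 x u : P x u <= 1.
Proof.
rewrite -(row_sum x) (bigD1 u) //= lerDl sumr_ge0 // => v _.
exact: P_ge0.
Qed.

(* A run of the chain from [x] is coded by the list [us] of states chosen by
   the random steps; the visited states are [x] and the images of [us]. *)
Fixpoint wt s x us : R :=
  if us is u :: us' then P x u * wt s (s u) us' else 1.

Definition endpoint s x us := last x (map s us).

Lemma wt_cat s x a b : wt s x (a ++ b) = wt s x a * wt s (endpoint s x a) b.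
Proof. by elim: a x => [|u a IH] x /=; rewrite ?mul1r // IH mulrA. Qed.

Lemma endpoint_cat s x a b :
  endpoint s x (a ++ b) = endpoint s (endpoint s x a) b.
Proof. by rewrite /endpoint map_cat last_cat. Qed.

Lemma wt_ge0 s x us : 0 <= wt s x us.
Proof. by elim: us x => //= u us IH x; rewrite mulr_ge0 // P_ge0. Qed.

Lemma psum_wt s m x : psum m (wt s x) = 1.
Proof.
elim: m x => //= m IH x; rewrite -[RHS](row_sum x).
by apply: eq_bigr => u _; rewrite psumZl IH mulr1.
Qed.

Definition qpow s t x y : R := (permuted_chain P s ^+ t) x y.

Lemma qpow0 s x y : qpow s 0 x y = (x == y)%:R.
Proof. by rewrite /qpow expr0 mxE. Qed.

Lemma chainE s x y : permuted_chain P s x y = \sum_u P x u * (s u == y)%:R.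
Proof. by rewrite mxE; apply: eq_bigr => u _; rewrite !mxE. Qed.

Lemma qpowS s t x y : qpow s t.+1 x y = \sum_u P x u * qpow s t (s u) y.
Proof.
rewrite /qpow exprS mxE.
under eq_bigr => j _ do rewrite chainE mulr_suml.
rewrite exchange_big /=; apply: eq_bigr => u _.
rewrite (bigD1 (s u)) //= eqxx mulr1 big1 ?addr0 // => j ju.
by rewrite eq_sym (negPf ju) mulr0 mul0r.
Qed.

Lemma qpow_ge0 s t x y : 0 <= qpow s t x y.
Proof.
elim: t x => [|t IH] x; first by rewrite qpow0 ler0n.
by rewrite qpowS sumr_ge0 // => u _; rewrite mulr_ge0 // P_ge0.
Qed.

Lemma qpow_row s t x : \sum_y qpow s t x y = 1.
Proof.
elim: t x => [|t IH] x.
  rewrite (bigD1 x) //= qpow0 eqxx big1 ?addr0 // => y yx.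
  by rewrite qpow0 eq_sym (negPf yx).
under eq_bigr do rewrite qpowS.
rewrite exchange_big -[RHS](row_sum x) /=; apply: eq_bigr => u _.
by rewrite -mulr_sumr IH mulr1.
Qed.

Lemma qpow_col s t y : \sum_x qpow s t x y = 1.
Proof.
elim: t => [|t IH].
  rewrite (bigD1 y) //= qpow0 eqxx big1 ?addr0 // => x yx.
  by rewrite qpow0 (negPf yx).
under eq_bigr do rewrite qpowS.
rewrite exchange_big /= -[RHS]IH [RHS](reindex_inj (@perm_inj _ s)) /=.
by apply: eq_bigr => u _; rewrite -mulr_suml col_sum mul1r.
Qed.

Lemma qpow_psum s t x y :
  qpow s t x y = psum t (fun us => wt s x us * (endpoint s x us == y)%:R).
Proof.
elim: t x => [|t IH] x /=; first by rewrite qpow0 mul1r.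
rewrite qpowS; apply: eq_bigr => u _; rewrite IH -psumZl.
by apply: eq_psum => us _; rewrite mulrA.
Qed.

Lemma sum_endpoint s t x (f : 'I_n -> R) :
  psum t (fun us => wt s x us * f (endpoint s x us)) =
  \sum_y qpow s t x y * f y.
Proof.
under [RHS]eq_bigr do rewrite qpow_psum -psumZr.
rewrite -psum_sum; apply: eq_psum => us _.
rewrite (bigD1 (endpoint s x us)) //= eqxx mulr1 big1 ?addr0 // => y yx.
by rewrite eq_sym (negPf yx) mulr0 mul0r.
Qed.

Lemma qpowD s i j x y :
  qpow s (i + j) x y = \sum_z qpow s i x z * qpow s j z y.
Proof. by rewrite /qpow exprD mxE. Qed.

Definition pos_part (r : R) := Num.max r 0.

Lemma pos_part_ge0 r : 0 <= pos_part r.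
Proof. by rewrite /pos_part le_max lexx orbT. Qed.

Lemma le_pos_part r : r <= pos_part r.
Proof. by rewrite /pos_part le_max lexx. Qed.

Lemma pos_part_le r c : r <= c -> 0 <= c -> pos_part r <= c.
Proof. by move=> rc c0; rewrite /pos_part ge_max rc c0. Qed.

Lemma pos_part_subadd r c : pos_part (r + c) <= pos_part r + pos_part c.
Proof.
by apply: pos_part_le; [rewrite lerD ?le_pos_part|rewrite addr_ge0 ?pos_part_ge0].
Qed.

Lemma pos_partM k r : 0 <= k -> pos_part (k * r) = k * pos_part r.
Proof. by move=> k0; rewrite /pos_part maxr_pMr // mulr0. Qed.

Lemma pos_part_sum (I : Type) (r : seq I) (p : pred I) (F : I -> R) :
  pos_part (\sum_(i <- r | p i) F i) <= \sum_(i <- r | p i) pos_part (F i).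
Proof.
elim/big_rec2 : _ => [|i x y _ xy]; first by rewrite /pos_part maxxx.
by apply: le_trans (pos_part_subadd _ _) _; rewrite lerD2l.
Qed.

Definition dist s t x : R := tv_from (permuted_chain P s) t x.

Lemma distE s t x : dist s t x = \sum_y pos_part (n%:R^-1 - qpow s t x y).
Proof. by []. Qed.

Lemma dist_ge0 s t x : 0 <= dist s t x.
Proof. by rewrite distE sumr_ge0 // => y _; exact: pos_part_ge0. Qed.

Lemma sum_inv_n x : \sum_(y : 'I_n) n%:R^-1 = 1 :> R.
Proof.
rewrite sumr_const card_ord -[LHS]mulr_natr mulVf // pnatr_eq0 -lt0n.
exact: leq_ltn_trans (ltn_ord x).
Qed.

Lemma dist_le1 s t x : dist s t x <= 1.
Proof.
rewrite distE -[leRHS](sum_inv_n x) ler_sum // => y _.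
apply: pos_part_le; last by rewrite invr_ge0 ler0n.
by rewrite lerBlDr lerDl qpow_ge0.
Qed.

(** Convexity: with row sums 1, the deficit [1/n - Q^(i+j)(x, y)] is the average of
    [1/n - Q^j(z, y)] over the position [z] at time [i]. *)
Lemma dist_add s i j x : dist s (i + j) x <= \sum_z qpow s i x z * dist s j z.
Proof.
rewrite distE; under [leRHS]eq_bigr do rewrite distE mulr_sumr.
rewrite [leRHS]exchange_big ler_sum // => y _.
rewrite qpowD -[X in X - _]mul1r -[X in X * _ - _](qpow_row s i x) mulr_suml -sumrB.
apply: le_trans (pos_part_sum _ _ _) _; rewrite ler_sum // => z _.
by rewrite -mulrBr pos_partM ?qpow_ge0 // mul1r.
Qed.

Lemma dist_step s t x : dist s t.+1 x <= \sum_u P x u * dist s t (s u).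
Proof.
rewrite -add1n; apply: le_trans (dist_add _ _ _ _) _.
under eq_bigr do rewrite qpowS mulr_suml.
rewrite exchange_big ler_sum //= => u _.
rewrite (bigD1 (s u)) //= qpow0 eqxx mulr1 big1 ?addr0 // => z zu.
by rewrite qpow0 eq_sym (negPf zu) mulr0 mul0r.
Qed.

(** Column sums enter here: the uniform law is stationary, so [1/n] at [y] spreads over the
    predecessors of [y], and a later step only averages deficits. *)
Lemma dist_nonincr s t j x : dist s (t + j) x <= dist s t x.
Proof.
elim: j => [|j IH]; first by rewrite addn0.
rewrite addnS; apply: le_trans IH; rewrite -addn1.
rewrite distE; set t' := (t + j)%N.
have -> : dist s t' x = \sum_z pos_part (n%:R^-1 - qpow s t' x z) * 1.
  by rewrite distE; apply: eq_bigr => z _; rewrite mulr1.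
under [leRHS]eq_bigr => z _ do rewrite -[X in _ * X](qpow_row s 1 z) mulr_sumr.
rewrite exchange_big ler_sum //= => y _.
rewrite qpowD -[X in X - _]mulr1 -[X in _ * X - _](qpow_col s 1 y) mulr_sumr -sumrB.
apply: le_trans (pos_part_sum _ _ _) _; rewrite ler_sum // => z _.
rewrite -mulrBl [X in pos_part X]mulrC pos_partM ?qpow_ge0 //.
by rewrite [leRHS]mulrC.
Qed.

End Walks.

(** * Revealing the permutation along a walk *)

Section Revealing.
Variables (R : realType) (n : nat).
Implicit Types (s : 'S_n) (h : seq ('I_n * 'I_n)) (u v X Y : 'I_n).

(* A history [h] lists pairs [(u, X)] recording the discovery [s u = X], the
   latest first. *)
Definition agrees s h := all (fun e => s e.1 == e.2) h.

(** Expectation restricted to the permutations that extend [h], without normalisation; the division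
    by [n!] is postponed to the probability bounds. *)
Definition sum_agree h (G : 'S_n -> R) : R := \sum_s (agrees s h)%:R * G s.

Definition count_agree h : R := sum_agree h (fun=> 1).

Lemma eq_sum_agree h G1 G2 : (forall s, agrees s h -> G1 s = G2 s) ->
  sum_agree h G1 = sum_agree h G2.
Proof.
move=> G12; apply: eq_bigr => s _.
by case: (boolP (agrees s h)) => sh; rewrite ?mul0r // G12.
Qed.

Lemma sum_agreeZl h (c : R) G :
  sum_agree h (fun s => c * G s) = c * sum_agree h G.
Proof. by rewrite /sum_agree mulr_sumr; apply: eq_bigr => s _; ring. Qed.

Lemma sum_agree_sum h (I : Type) (r : seq I) (p : pred I) (G : I -> 'S_n -> R) :
  sum_agree h (fun s => \sum_(i <- r | p i) G i s) =
  \sum_(i <- r | p i) sum_agree h (G i).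
Proof.
rewrite /sum_agree exchange_big /=; apply: eq_bigr => s _.
by rewrite mulr_sumr.
Qed.

Lemma sum_agree_nil G : sum_agree [::] G = \sum_s G s.
Proof. by apply: eq_bigr => s _; rewrite mul1r. Qed.

Lemma count_agree_nil : count_agree [::] = (n`!)%:R.
Proof.
rewrite /count_agree sum_agree_nil sumr_const.
by rewrite -(card_Sn n).
Qed.

Lemma count_agree_ge0 h : 0 <= count_agree h.
Proof. by apply: sumr_ge0 => s _; rewrite mulr1 ler0n. Qed.

Lemma sum_agree_query h u (G : 'S_n -> 'I_n -> R) :
  sum_agree h (fun s => G s (s u)) =
  \sum_X sum_agree ((u, X) :: h) (fun s => G s X).
Proof.
rewrite /sum_agree exchange_big /=; apply: eq_bigr => s _.
rewrite (bigD1 (s u)) //= eqxx /= big1 ?addr0 // => X Xu.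
by rewrite eq_sym (negPf Xu) mul0r.
Qed.

Lemma count_agree_query h u :
  \sum_X count_agree ((u, X) :: h) = count_agree h.
Proof. by rewrite /count_agree -(sum_agree_query h u (fun _ _ => 1)). Qed.

(** Composition with the transposition of [X] and [X'] exchanges the two sets of permutations, since
    it fixes the values already listed in [h]. *)
Lemma count_agree_swap h u X X' : X \notin unzip2 h -> X' \notin unzip2 h ->
  count_agree ((u, X) :: h) = count_agree ((u, X') :: h).
Proof.
move=> Xh X'h; rewrite /count_agree /sum_agree.
rewrite (reindex_inj (mulIg (tperm X' X))) /=; apply: eq_bigr => s _.
congr (_%:R * _); congr (nat_of_bool _); congr (_ && _).
  by rewrite permM -[X in _ == X](tpermL X' X) (inj_eq perm_inj).
apply: eq_in_all => -[v Y] vYh /=.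
have Yh : Y \in unzip2 h by apply/mapP; exists (v, Y).
rewrite permM -[X in _ == X](@tpermD _ X' X Y) ?(inj_eq perm_inj) //.
  by apply: contraNneq X'h => ->.
by apply: contraNneq Xh => ->.
Qed.

Lemma count_agree_fresh h u X : u \notin unzip1 h ->
  count_agree ((u, X) :: h) * (n - size h)%:R <= count_agree h.
Proof.
move=> uh; case: (boolP (X \in unzip2 h)) => Xh.
  rewrite [count_agree (_ :: _)]big1 ?mul0r ?count_agree_ge0 // => s _.
  rewrite mulr1; case: (boolP (agrees _ _)) => //= /andP[/eqP suX sh].
  case/mapP: Xh => -[v Y] vYh /= XY; case/negP: uh.
  have /eqP/= svY := allP sh _ vYh.
  have -> : u = v by apply: (@perm_inj _ s); rewrite suX svY.
  by apply/mapP; exists (v, Y).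
rewrite -[leRHS](count_agree_query h u).
rewrite (bigID (fun Y => Y \in unzip2 h)) /= -[leLHS]add0r lerD //.
  by apply: sumr_ge0 => Y _; exact: count_agree_ge0.
rewrite (eq_bigr (fun=> count_agree ((u, X) :: h))); last first.
  by move=> Y Yh; exact: count_agree_swap.
rewrite sumr_const -[leRHS]mulr_natr ler_wpM2l ?count_agree_ge0 // ler_nat.
have := cardC (mem (unzip2 h)); rewrite card_ord => cardE.
rewrite leq_subLR -[leqLHS]cardE leq_add2r.
by rewrite (leq_trans (card_size _)) // size_map.
Qed.

Fixpoint collisions (danger : seq ('I_n * 'I_n) -> {set 'I_n}) h : nat :=
  if h is (u, X) :: h' then
    ((u \notin unzip1 h') && (X \in danger h')) + collisions danger h'
  else 0.

Section CollisionBound.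
Variables (danger : seq ('I_n * 'I_n) -> {set 'I_n}) (L r : nat) (al : R).
Hypothesis al_ge0 : 0 <= al.
Hypothesis L_le_n : (L <= n)%N.
Hypothesis danger_small :
  forall h, (size h < L)%N -> #|danger h|%:R <= al * (n - size h)%:R.

(** Bound for the conditional probability of reaching [r] collisions with [k] queries left.
    Truncated subtraction makes it 1 once [r] is reached, and [0 ^+ 0 = 1] gives the exact value
    when no query is left. *)
Let bnd k h : R := (k%:R * al) ^+ (r - collisions danger h).

(** A new query collides with conditional probability at most [al], and [al (k al)^e + (k al)^(e+1)
    = (k+1) al (k al)^e] is at most [((k+1) al)^(e+1)]. This is the union bound over the times of
    collision, without binomial coefficients. *)
Lemma collision_step k h u (G : 'S_n -> 'I_n -> R) : (size h < L)%N ->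
  (forall X, sum_agree ((u, X) :: h) (G^~ X) <=
     count_agree ((u, X) :: h) * bnd k ((u, X) :: h)) ->
  sum_agree h (fun s => G s (s u)) <= count_agree h * bnd k.+1 h.
Proof.
move=> hL GX; rewrite sum_agree_query; apply: le_trans (ler_sum _ _) _.
  by move=> X _; exact: GX.
have kal : k%:R * al <= k.+1%:R * al by rewrite ler_wpM2r // ler_nat.
have kal0 : 0 <= k%:R * al by rewrite mulr_ge0.
case: (boolP (u \in unzip1 h)) => uh.
  rewrite -(count_agree_query h u) mulr_suml ler_sum // => X _.
  rewrite ler_wpM2l ?count_agree_ge0 // /bnd /= uh /= lerXn2r //.
  by rewrite nnegrE (le_trans kal0).
rewrite /bnd /= uh /=; case re : (r - collisions danger h)%N => [|e].
  rewrite -(count_agree_query h u) mulr_suml ler_sum // => X _.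
  by rewrite addnC subnDA re sub0n.
have expE X : (r - ((X \in danger h) + collisions danger h))%N =
    if X \in danger h then e else e.+1.
  by rewrite addnC subnDA re; case: ifP => _; rewrite ?subn1 ?subn0.
under eq_bigr do rewrite expE.
rewrite (bigID (mem (danger h))) /=.
rewrite (eq_bigr (fun X => count_agree ((u, X) :: h) * (k%:R * al) ^+ e)); last first.
  by move=> X ->.
rewrite [X in _ + X](eq_bigr (fun X =>
  count_agree ((u, X) :: h) * (k%:R * al) ^+ e.+1)); last first.
  by move=> X /negPf->.
rewrite -!mulr_suml; set p := (k%:R * al) ^+ e.
have p0 : 0 <= p by rewrite exprn_ge0.
have nh : 0 < (n - size h)%:R :> R.
  by rewrite ltr0n subn_gt0 (leq_trans hL).
have D1 : \sum_(X in danger h) count_agree ((u, X) :: h) <= al * count_agree h.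
  rewrite -(ler_pM2r nh) mulr_suml.
  apply: le_trans (ler_sum _ (fun X _ => count_agree_fresh X uh)) _.
  rewrite sumr_const -[leLHS]mulr_natr [leRHS]mulrAC mulrC.
  by rewrite ler_wpM2r ?count_agree_ge0 // danger_small.
have D2 : \sum_(X | X \notin danger h) count_agree ((u, X) :: h) <= count_agree h.
  rewrite -[leRHS](count_agree_query h u).
  rewrite [leRHS](bigID (mem (danger h))) /= lerDr.
  by apply: sumr_ge0 => X _; exact: count_agree_ge0.
apply: (@le_trans _ _ (al * count_agree h * p + count_agree h * (k%:R * al * p))).
  by rewrite exprS lerD // ler_wpM2r // mulr_ge0.
have -> : al * count_agree h * p + count_agree h * (k%:R * al * p) =
    count_agree h * (k.+1%:R * al * p) by rewrite -natr1; ring.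
rewrite ler_wpM2l ?count_agree_ge0 // exprS ler_wpM2l ?(le_trans kal0) //.
by rewrite lerXn2r // nnegrE ?(le_trans kal0).
Qed.

Variable P : 'M[R]_n.
Hypothesis P_bis : bistochastic P.

Definition graph s us := [seq (u, s u) | u <- us].

(** [K] is whatever is explored after the walk, given the history it inherits; several walks are
    handled by nesting such continuations. *)
Lemma collision_walk k m x h (K : 'S_n -> 'I_n -> seq ('I_n * 'I_n) -> R) :
  (size h + m <= L)%N ->
  (forall x' h', size h' = (size h + m)%N ->
     sum_agree h' (fun s => K s x' h') <= count_agree h' * bnd k h') ->
  sum_agree h (fun s => psum m (fun us =>
     wt P s x us * K s (endpoint s x us) (catrev (graph s us) h)))
    <= count_agree h * bnd (k + m) h.
Proof.
elim: m x h => [|m IH] x h hL HK /=.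
  rewrite addn0 (eq_sum_agree (G2 := fun s => K s x h)) ?HK ?addn0 // => s _.
  by rewrite mul1r.
rewrite (eq_sum_agree (G2 := fun s => \sum_u P x u * psum m (fun us =>
   wt P s (s u) us * K s (endpoint s (s u) us)
     (catrev (graph s us) ((u, s u) :: h))))); last first.
  move=> s _; apply: eq_bigr => u _; rewrite -psumZl.
  by apply: eq_psum => us _; rewrite mulrA.
rewrite sum_agree_sum -[leRHS]mul1r -(row_sum P_bis x) mulr_suml ler_sum // => u _.
rewrite sum_agreeZl ler_wpM2l ?P_ge0 // addnS.
apply: (collision_step (G := fun s X => psum m (fun us =>
   wt P s X us * K s (endpoint s X us) (catrev (graph s us) ((u, X) :: h))))).
  by rewrite (leq_trans _ hL) // addnS ltnS leq_addr.
move=> X; apply: IH; first by rewrite /= addSnnS.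
by move=> x' h' sh'; apply: HK; rewrite sh' /= addSnnS.
Qed.

Lemma collision_base h : 
  sum_agree h (fun=> (r <= collisions danger h)%:R) <= count_agree h * bnd 0 h.
Proof.
rewrite /bnd mul0r -[X in sum_agree _ X]/(fun s => _ : R).
rewrite (eq_sum_agree (G2 := fun s => (r <= collisions danger h)%:R * 1)); last first.
  by move=> s _; rewrite mulr1.
by rewrite sum_agreeZl mulrC expr0n subn_eq0.
Qed.

End CollisionBound.

Lemma count_agree_zip L us Xs : (L < n)%N -> (size us <= L)%N ->
  size us = size Xs -> uniq us ->
  count_agree (zip us Xs) <= (n`!)%:R * (n - L)%:R ^- size us.
Proof.
move=> Ln; elim: us Xs => [|u us IH] [|X Xs] //= sL.
  by rewrite count_agree_nil expr0 invr1 mulr1.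
case=> sX /andP[uus Uus]; have := IH _ (ltnW sL) sX Uus.
have nL : 0 < (n - L)%:R :> R by rewrite ltr0n subn_gt0.
rewrite exprS invfM => {}IH; rewrite mulrCA mulrC ler_pdivlMr //.
apply: le_trans IH; apply: le_trans (_ : _ <= count_agree ((u, X) :: zip us Xs) *
  (n - size (zip us Xs))%:R) _; last first.
  by apply: count_agree_fresh; rewrite unzip1_zip // sX.
rewrite ler_wpM2l ?count_agree_ge0 // ler_nat leq_sub2l // size_zip -sX minnn.
exact: ltnW.
Qed.

(** Each outcome of the images at distinct points has probability at most [(n - L)^-size us]. A
    nonnegative statistic is thus dominated by its mean under independent uniform images, up to a
    factor [(n / (n - L))^size us], which is near 1 when [L^2] is small against [n]. *)
Lemma sum_perm_le_iid L us (F : seq 'I_n -> R) : (L < n)%N -> (size us <= L)%N ->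
  uniq us -> (forall Xs, 0 <= F Xs) ->
  \sum_s F (map (s : 'S_n) us) <= (n`!)%:R * (n - L)%:R ^- size us *
    psum (size us) (fun Xs => (uniq Xs)%:R * F Xs).
Proof.
move=> Ln sL Uus F0; rewrite -psumZl.
have -> : \sum_s F (map (s : 'S_n) us) = psum (size us) (fun Xs =>
    \sum_s (Xs == map (s : 'S_n) us)%:R * F Xs).
  rewrite psum_sum; apply: eq_bigr => s _; rewrite psum_pred1 // size_map //.
apply: ler_psum => Xs sX; rewrite -mulr_suml mulrA ler_wpM2r //.
case: (boolP (uniq Xs)) => UX; last first.
  rewrite mulr0 big1 // => s _; case: eqP => // E.
  by move: UX; rewrite E map_inj_uniq ?Uus //; exact: perm_inj.
rewrite mulr1; apply: le_trans (count_agree_zip Ln sL (esym sX) Uus).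
rewrite /count_agree /sum_agree; apply: ler_sum => s _; rewrite mulr1 ler_nat.
case: eqP => // -> /=; rewrite (_ : agrees _ _ = true) //.
by rewrite /agrees; elim: (us) => //= u us' ->; rewrite eqxx.
Qed.

End Revealing.

(** * Collisions *)

Section Trees.
Variables (R : realType) (n : nat) (P : 'M[R]_n).
Hypothesis P_bis : bistochastic P.
Implicit Types (s : 'S_n) (x y z u v W X Y : 'I_n) (us a b V : seq 'I_n).

Definition sim x y := [exists u, (0 < P x u) && (0 < P y u)].

Lemma simI x y u : 0 < P x u -> 0 < P y u -> sim x y.
Proof. by move=> xu yu; apply/existsP; exists u; rewrite xu. Qed.

Lemma sim_sym x y : sim x y = sim y x.
Proof. by apply: eq_existsb => u; rewrite andbC. Qed.

Lemma sim_refl x : sim x x.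
Proof.
suff /existsP[u xu] : [exists u, 0 < P x u] by exact: (@simI _ _ u).
apply: contraT; rewrite negb_exists => /forallP H.
have /eqP := row_sum P_bis x; rewrite big1 ?(eq_sym 0) ?oner_eq0 // => u _.
by apply: le_anti; rewrite P_ge0 // andbT leNgt H.
Qed.

(* [Y] is dangerous if its row overlaps one already seen: two branches of the
   exploration may then meet through a common choice. *)
Definition danger x (h : seq ('I_n * 'I_n)) : {set 'I_n} :=
  [set Y | has (sim Y) (x :: unzip2 h)]%SET.

Lemma card_set_natr (p : pred 'I_n) :
  #|[set Y | p Y]%SET|%:R = \sum_Y (p Y)%:R :> R.
Proof.
rewrite -sum1_card natr_sum big_mkcond; apply: eq_bigr => Y _.
by rewrite inE; case: (p Y).
Qed.

(** When positive entries are at least [d], a row or a column has at most [d^-1] of them, so a given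
    row overlaps at most [d^-2] rows. *)
Lemma card_danger (d : R) x h : 0 < d ->
  (forall y u, 0 < P y u -> d <= P y u) ->
  #|danger x h|%:R <= (size h).+1%:R / d ^+ 2.
Proof.
move=> d0 Pd.
have bound (F : 'I_n -> R) : \sum_u F u = 1 -> (forall u, 0 <= F u) ->
    (forall u, 0 < F u -> d <= F u) -> \sum_u (0 < F u)%R%:R <= d^-1.
  move=> F1 F0 Fd; rewrite -[leRHS]mul1r ler_pdivlMr // -[leRHS]F1 mulr_suml.
  apply: ler_sum => u _; case: ltP => [Fu|_]; first by rewrite mul1r Fd.
  by rewrite mul0r.
have rowS y : \sum_u (0 < P y u)%R%:R <= d^-1.
  by apply: bound => [|u|u]; [exact: row_sum|exact: P_ge0|exact: Pd].
have colS u : \sum_y (0 < P y u)%R%:R <= d^-1.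
  by apply: bound => [|y|y]; [exact: col_sum|exact: P_ge0|exact: Pd].
have simS y : \sum_Y (sim Y y)%:R <= (d ^+ 2)^-1.
  apply: (@le_trans _ _ (\sum_u (0 < P y u)%R%:R * \sum_Y (0 < P Y u)%R%:R)).
    under [leRHS]eq_bigr do rewrite mulr_sumr.
    rewrite exchange_big ler_sum // => Y _.
    have S0 : 0 <= \sum_i (0 < P y i)%R%:R * (0 < P Y i)%R%:R :> R.
      by apply: sumr_ge0 => i _; rewrite mulr_ge0.
    case: (boolP (sim Y y)) => // /existsP[u /andP[Yu yu]].
    rewrite (bigD1 u) //= Yu yu mulr1 lerDl.
    by apply: sumr_ge0 => i _; rewrite mulr_ge0.
  apply: (@le_trans _ _ (\sum_u (0 < P y u)%R%:R * d^-1)).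
    by apply: ler_sum => u _; rewrite ler_wpM2l.
  by rewrite -mulr_suml expr2 invfM ler_wpM2r // invr_ge0 ltW.
have hasS (l : seq 'I_n) :
    \sum_Y (has (sim Y) l)%:R <= (size l)%:R * (d ^+ 2)^-1 :> R.
  elim: l => [|y l IH] /=; first by rewrite big1 ?mul0r.
  apply: (@le_trans _ _ (\sum_Y ((sim Y y)%:R + (has (sim Y) l)%:R))).
    by apply: ler_sum => Y _; rewrite -natrD ler_nat; case: sim; case: has.
  by rewrite big_split -natr1 mulrDl mul1r addrC lerD.
rewrite card_set_natr; apply: le_trans (hasS _) _.
by rewrite /= size_map.
Qed.

(** What remains of cleanliness after one collision: every overlap of rows involves [W]. Since a row
    overlaps itself, [x] can be revisited only as [W]. *)
Definition separated x V W :=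
  {in V, forall Y, Y != W -> ~~ sim Y x} /\
  {in V &, forall Y Y', Y != W -> Y' != W -> sim Y Y' -> Y = Y'}.

Definition clean x V := (x \notin V) &&
  all (fun Y => all (fun Y' => sim Y Y' ==> (Y == Y')) (x :: V)) (x :: V).

Lemma cleanP x V : reflect (x \notin V /\
    {in x :: V &, forall Y Y', sim Y Y' -> Y = Y'}) (clean x V).
Proof.
apply: (iffP andP) => -[xV H]; split => //.
  move=> Y Y' YV Y'V YY'; apply/eqP.
  by have /allP/(_ _ Y'V) := allP H _ YV; rewrite YY'.
apply/allP => Y YV; apply/allP => Y' Y'V; apply/implyP => YY'.
by apply/eqP; apply: H.
Qed.

Lemma clean_sub x V V' : {subset V' <= V} -> clean x V -> clean x V'.
Proof.
move=> VV' /cleanP[xV H]; apply/cleanP; split.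
  by apply: contraNN xV; exact: VV'.
have sub Y : Y \in x :: V' -> Y \in x :: V.
  by rewrite !inE => /orP[->//|/VV'->]; rewrite orbT.
by move=> Y Y' YV Y'V; apply: H; exact: sub.
Qed.

(** A new vertex outside the danger set has a row disjoint from all previous ones; a repeated query
    brings back a known vertex. *)
Lemma no_collision x s h : agrees s h -> collisions (danger x) h = 0%N ->
  clean x (unzip2 h).
Proof.
elim: h => [|[u X] h IH] /=.
  move=> _ _; apply/cleanP; split => // Y Y'.
  by rewrite !inE => /eqP-> /eqP->.
case/andP => suX sh /eqP; rewrite addn_eq0 eqb0 => /andP[uX /eqP/(IH sh) cl].
have [uh|uh] := boolP (u \in unzip1 h).
  apply: clean_sub cl => Y; rewrite inE => /orP[/eqP->|//].
  have [[v Z] vZ /= uv] := mapP uh.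
  have /eqP/= svZ := allP sh _ vZ.
  by apply/mapP; exists (v, Z) => //=; rewrite -svZ -uv; apply/esym/eqP.
move: uX; rewrite uh /= inE -all_predC => /allP far.
have /cleanP[xh cl'] := cl.
apply/cleanP; split.
  rewrite inE (negPf xh) orbF; apply/eqP => xX.
  by have := far x (mem_head _ _); rewrite /= xX sim_refl.
have farX Y : Y \in x :: unzip2 h -> ~~ sim X Y by move=> /far.
have mem Y : Y \in [:: x, X & unzip2 h] -> Y = X \/ Y \in x :: unzip2 h.
  rewrite !inE => /or3P[->|/eqP->|->]; [right|left|right] => //.
  by rewrite orbT.
move=> Y Y' /mem[->|YV] /mem[->|Y'V] // YY'; last exact: cl'.
  by have := farX _ Y'V; rewrite YY'.
by have := farX _ YV; rewrite sim_sym YY'.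
Qed.

(** [W] is the image revealed at the collision: what came before is clean, and what comes after
    avoids the danger set. *)
Lemma one_collision x s h : agrees s h -> (collisions (danger x) h <= 1)%N ->
  exists W, separated x (unzip2 h) W.
Proof.
elim: h => [|[u X] h IH] /=; first by exists x; split.
case/andP => suX sh c1.
have [uh|uh] := boolP (u \in unzip1 h).
  move: c1; rewrite uh /= => /(IH sh)[W [W1 W2]]; exists W.
  have sub Y : Y \in X :: unzip2 h -> Y \in unzip2 h.
    rewrite inE => /orP[/eqP->|//].
    have [[v Z] vZ /= uv] := mapP uh.
    have /eqP/= svZ := allP sh _ vZ.
    by apply/mapP; exists (v, Z) => //=; rewrite -svZ -uv; apply/esym/eqP.
  by split=> [Y /sub|Y Y' /sub YV /sub]; [exact: W1|exact: W2].
have mem Y : Y \in X :: unzip2 h -> Y = X \/ Y \in unzip2 h.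
  by rewrite !inE => /orP[/eqP->|->]; [left|right].
move: c1; rewrite uh /=; case: (boolP (X \in danger x h)) => [_|Xd] c1.
  exists X; have /(no_collision sh)/cleanP[xh cl] : collisions (danger x) h = 0%N.
    by move: c1; rewrite addSn ltnS leqn0 => /eqP.
  split=> [Y /mem[->|YV]|Y Y' /mem[->|YV] /mem[->|Y'V]];
    rewrite ?eqxx // => YX.
    by apply: contraNN xh => /cl <-; rewrite // inE ?YV ?eqxx ?orbT.
  by move=> _ YY'; apply: cl; rewrite // inE ?YV ?Y'V orbT.
have [|W [W1 W2]] := IH sh; first exact: leq_trans c1.
have farX Y : Y \in x :: unzip2 h -> ~~ sim X Y.
  by move: Xd; rewrite inE -all_predC => /allP; exact.
exists W; split=> [Y /mem[->|YV] YW|Y Y' /mem[->|YV] /mem[->|Y'V] YW Y'W YY'] //.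
- by apply: farX; rewrite mem_head.
- exact: W1.
- by have := farX Y'; rewrite YY' inE Y'V orbT => /(_ isT).
- by have := farX Y; rewrite sim_sym YY' inE YV orbT => /(_ isT).
- exact: W2.
Qed.

(* The list [l] is in reverse chronological order. *)
Fixpoint backtracks s x (l : seq 'I_n) : bool :=
  if l is v :: l' then
    has (fun W => 0 < P W v) (x :: map s l') && backtracks s x l'
  else true.

Lemma backtracks_walk s x z a l : (z \in x :: map s l) -> backtracks s x l ->
  0 < wt P s z a -> backtracks s x (catrev a l).
Proof.
elim: a z l => //= u a IH z l zl bl wa.
have [Pzu wa'] : 0 < P z u /\ 0 < wt P s (s u) a.
  move: wa; rewrite lt0r mulf_eq0 negb_or => /andP[/andP[p w] _].
  by rewrite !lt0r p w P_ge0 ?wt_ge0.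
apply: (IH (s u)) => //; first by rewrite !inE eqxx orbT.
by apply/andP; split => //; apply/hasP; exists z.
Qed.

(** Take the earliest occurrence of [v]: its parent [W] lies in the tree explored strictly before,
    where the choice [v] has not been made yet. *)
Lemma backtracksP s x l v : backtracks s x l -> v \in l ->
  exists W l', [/\ W \in x :: map s l', 0 < P W v, backtracks s x l', v \notin l' &
    {subset l' <= l} /\ (size l' < size l)%N].
Proof.
elim: l => // w l IH /andP[/hasP[W Wl PWw] bl] vl.
have [vl'|vl'] := boolP (v \in l).
  have [W' [l' [H1 H2 H3 H4 [H5 H6]]]] := IH bl vl'.
  exists W', l'; split => //; split; last exact: ltnW.
  by move=> y /H5; rewrite inE orbC => ->.
move: vl; rewrite inE (negPf vl') orbF => /eqP vw.
exists W, l; rewrite {1}vw; split => //; split => // y yl.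
by rewrite inE yl orbT.
Qed.

Section TwoChildren.
Variables (s : 'S_n) (x u u' W : 'I_n).
Hypotheses (Pu : 0 < P x u) (Pu' : 0 < P x u') (uu' : u != u').
Variable V : seq 'I_n.
Hypothesis sepV : separated x V W.

Let no_parent v Y : 0 < P x v -> Y \in V -> Y != W -> ~~ (0 < P Y v).
Proof.
by move=> xv YV YW; apply: contra (sepV.1 _ YV YW) => Yv; exact: (@simI _ _ v).
Qed.

(** Separation excludes overlaps between distinct vertices. If the root were revisited, [v] would be
    chosen inside the tree from a vertex whose row meets that of [x]. *)
Lemma tree_clean v l : 0 < P x v -> backtracks s (s v) l ->
  {subset s v :: map s l <= V} -> W \notin s v :: map s l ->
  clean (s v) (map s l).
Proof.
move=> xv bl sub Wl.
have neW Y : Y \in s v :: map s l -> Y != W by apply: contraTneq => ->.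
apply/cleanP; split; last first.
  by move=> Y Y' YV Y'V; apply: sepV.2; [exact: sub|exact: sub|exact: neW|exact: neW].
apply/negP => /mapP[w wl svw].
have vl : v \in l by rewrite (perm_inj svw).
have [Y [l' [Yl PY _ _ [l'l _]]]] := backtracksP bl vl.
have Yl2 : Y \in s v :: map s l.
  move: Yl; rewrite !inE => /orP[->//|/mapP[y /l'l yl ->]].
  by rewrite map_f ?orbT.
by have := no_parent xv (sub _ Yl2) (neW _ Yl2); rewrite PY.
Qed.

(** Descent: a common vertex comes from a choice made in both trees, whose earliest parents share it
    and hence coincide. They form a common vertex of strictly smaller trees. The roots are excluded
    because their preimages are choices available from [x]. *)
Lemma trees_disjoint l l' : backtracks s (s u) l -> backtracks s (s u') l' ->
  {subset s u :: map s l <= V} -> {subset s u' :: map s l' <= V} ->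
  W \notin s u :: map s l -> W \notin s u' :: map s l' ->
  forall Y, Y \in s u :: map s l -> Y \in s u' :: map s l' -> False.
Proof.
have [m] := ubnP (size l + size l'); elim: m l l' => // m IH l l' sll'.
move=> bl bl' sub sub' Wl Wl' Y.
have neW X : X \in s u :: map s l -> X != W by apply: contraTneq => ->.
have neW' X : X \in s u' :: map s l' -> X != W by apply: contraTneq => ->.
have up (k k' : seq 'I_n) X v : {subset k' <= k} -> X \in v :: map s k' ->
    X \in v :: map s k.
  move=> k'k; rewrite !inE => /orP[->//|/mapP[y /k'k yk ->]].
  by rewrite map_f ?orbT.
rewrite inE => /orP[/eqP->|/mapP[v vl ->]];
  rewrite inE => /orP[|/mapP[v' v'l' ]].
- by rewrite (inj_eq perm_inj) (negPf uu').
- move=> /perm_inj uv'; have [Z [k [Zk PZ _ _ [kl' _]]]] := backtracksP bl' v'l'.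
  have Zl' := up _ _ _ _ kl' Zk.
  by have := no_parent Pu (sub' _ Zl') (neW' _ Zl'); rewrite uv' PZ.
- rewrite (inj_eq perm_inj) => /eqP vu'.
  have [Z [k [Zk PZ _ _ [kl _]]]] := backtracksP bl vl.
  have Zl := up _ _ _ _ kl Zk.
  by have := no_parent Pu' (sub _ Zl) (neW _ Zl); rewrite -vu' PZ.
move=> /perm_inj vv'; rewrite -vv' in v'l'.
have [Z [k [Zk PZ bk _ [kl sk]]]] := backtracksP bl vl.
have [Z' [k' [Zk' PZ' bk' _ [kl' sk']]]] := backtracksP bl' v'l'.
have Zl := up _ _ _ _ kl Zk; have Zl' := up _ _ _ _ kl' Zk'.
have ZZ' : Z = Z'.
  apply: sepV.2; [exact: sub|exact: sub'|exact: neW|exact: neW'|].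
  exact: (@simI _ _ v).
apply: (IH k k' _ bk bk' _ _ _ _ Z) => //; last by rewrite ZZ'.
- by rewrite ltnS in sll'; exact: leq_trans (leq_add sk (ltnW sk')) sll'.
- by move=> X /up; move/(_ _ kl); exact: sub.
- by move=> X /up; move/(_ _ kl'); exact: sub'.
- by apply: contra Wl; exact: up.
- by apply: contra Wl'; exact: up.
Qed.

(* With at most one collision, all bad events pass through the single vertex
   [W], which cannot spoil the trees below two distinct children. *)
Lemma one_child_clean l l' : backtracks s (s u) l -> backtracks s (s u') l' ->
  {subset s u :: map s l <= V} -> {subset s u' :: map s l' <= V} ->
  clean (s u) (map s l) || clean (s u') (map s l').
Proof.
move=> bl bl' sub sub'.
have [Wl|] := boolP (W \in s u :: map s l); last first.
  by move=> Wl; rewrite tree_clean.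
have [Wl'|] := boolP (W \in s u' :: map s l'); last first.
  by move=> Wl'; rewrite [X in _ || X]tree_clean ?orbT.
have up (k k' : seq 'I_n) X v : {subset k' <= k} -> X \in v :: map s k' ->
    X \in v :: map s k.
  move=> k'k; rewrite !inE => /orP[->//|/mapP[y /k'k yk ->]].
  by rewrite map_f ?orbT.
exfalso.
have noroot v w k : 0 < P x v -> backtracks s (s w) k ->
    {subset s w :: map s k <= V} -> W = s v -> v \in k -> v != w -> False.
  move=> xv bk sk Wv vk vw.
  have [Z [j [Zj PZ bj vj [jk _]]]] := backtracksP bk vk.
  have [ZW|ZW] := eqVneq Z W; last first.
    have Zk := up _ _ _ _ jk Zj.
    by have := no_parent xv (sk _ Zk) ZW; rewrite PZ.
  move: Zj; rewrite ZW Wv inE (inj_eq perm_inj) (negPf vw) /=.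
  by rewrite (mem_map perm_inj) (negPf vj).
move: Wl Wl'; rewrite inE => /orP[/eqP Wu|/mapP[v vl Wv]];
  rewrite inE => /orP[/eqP Wu'|/mapP[v' v'l' Wv']].
- by move: uu'; rewrite -(inj_eq (@perm_inj _ s)) -Wu -Wu' eqxx.
- have uv' : u = v' by apply: (@perm_inj _ s); rewrite -Wu.
  by apply: (noroot u u' l') => //; rewrite uv'.
- have u'v : u' = v by apply: (@perm_inj _ s); rewrite -Wu'.
  by apply: (noroot u' u l) => //; rewrite ?u'v // eq_sym -u'v.
have vv' : v = v' by apply: (@perm_inj _ s); rewrite -Wv.
rewrite -vv' in v'l'.
have [vu|vu] := eqVneq v u.
  by apply: (noroot u u' l') => //; rewrite -vu.
have [vu'|vu'] := eqVneq v u'.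
  by apply: (noroot u' u l) => //; rewrite -?vu' // vu.
(* The trees explored before the choice [v], whose image is [W], avoid [W]; yet the parents of [v]
   in them coincide, against disjointness. *)
have [Z [j [Zj PZ bj vj [jl _]]]] := backtracksP bl vl.
have [Z' [j' [Zj' PZ' bj' vj' [jl' _]]]] := backtracksP bl' v'l'.
have Wj : W \notin s u :: map s j.
  by rewrite Wv inE (inj_eq perm_inj) (negPf vu) /= (mem_map perm_inj).
have Wj' : W \notin s u' :: map s j'.
  by rewrite Wv inE (inj_eq perm_inj) (negPf vu') /= (mem_map perm_inj).
have sj : {subset s u :: map s j <= V} by move=> Y /(up _ _ _ _ jl); exact: sub.
have sj' : {subset s u' :: map s j' <= V}.
  by move=> Y /(up _ _ _ _ jl'); exact: sub'.
have ZZ' : Z = Z'.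
  apply: sepV.2; [exact: sj|exact: sj'| | |exact: (@simI _ _ v)].
    by apply: contraNneq Wj => <-.
  by apply: contraNneq Wj' => <-.
by apply: (trees_disjoint bj bj' sj sj' Wj Wj' Zj); rewrite ZZ'.
Qed.

End TwoChildren.

End Trees.

(** * Clean walks *)

Section Paths.
Variables (R : realType) (n : nat) (P : 'M[R]_n).
Hypothesis P_bis : bistochastic P.
Variables (s : 'S_n) (z : 'I_n).
Implicit Types (x y u v : 'I_n) (a b : seq 'I_n).

Lemma wt_cat_gt0 x a b : 0 < wt P s x (a ++ b) ->
  0 < wt P s x a /\ 0 < wt P s (endpoint s x a) b.
Proof.
rewrite wt_cat lt0r mulf_eq0 negb_or => /andP[/andP[wa wb] _].
by rewrite !lt0r wa wb !wt_ge0.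
Qed.

Definition vert a j := endpoint s z (take j a).

Lemma wt_nth a j : 0 < wt P s z a -> (j < size a)%N ->
  0 < P (vert a j) (nth z a j).
Proof.
move=> wa ja; move: wa; rewrite -{1}(cat_take_drop j a) (drop_nth z ja).
case/wt_cat_gt0 => _ /=; rewrite lt0r mulf_eq0 negb_or => /andP[/andP[p _] _].
by rewrite lt0r p P_ge0.
Qed.

Lemma vertS a j : (j < size a)%N -> vert a j.+1 = s (nth z a j).
Proof. by move=> ja; rewrite /vert (take_nth z ja) /endpoint map_rcons last_rcons. Qed.

Lemma vert_mem a j : vert a j \in z :: map s a.
Proof.
rewrite /vert /endpoint map_take; have := mem_last z (take j (map s a)).
by rewrite !inE => /orP[->//|/mem_take->]; rewrite orbT.
Qed.

(** A repeated vertex comes from a repeated choice, made at vertices with overlapping rows, which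
    are then equal. Going back in time, this ends at the start [z], which a clean walk never
    revisits. *)
Lemma clean_vert_inj a i j : 0 < wt P s z a -> clean P z (map s a) ->
  (i < j <= size a)%N -> vert a i != vert a j.
Proof.
move=> wa /cleanP[za cl]; elim: i j => [|i IH] [|j] // /andP[ij ja].
  rewrite vertS //; apply: contraNneq za; rewrite /vert take0 => E.
  by rewrite (E : z = _) map_f // mem_nth.
have ia : (i < size a)%N by apply: ltn_trans ja.
rewrite !vertS // (inj_eq perm_inj); apply: contra_neqN (IH j _) => [/eqP E|].
  apply: cl; rewrite ?vert_mem //; apply: (@simI _ _ _ _ _ (nth z a i)).
    exact: wt_nth.
  by rewrite E; exact: wt_nth.
by rewrite -ltnS ij ltnW.
Qed.

Lemma clean_uniq a : 0 < wt P s z a -> clean P z (map s a) -> uniq a.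
Proof.
move=> wa cl; apply/(uniqP z) => i j; rewrite !inE => ia ja E.
apply/eqP; apply: contraT => ij.
wlog {ij} ij : i j ia ja E / (i < j)%N.
  by move=> H; case: ltngtP ij => // ij _; [exact: (H i j)|exact: (H j i)].
have := @clean_vert_inj a i.+1 j.+1 wa cl; rewrite ltnS ij ja => /(_ isT).
by rewrite !vertS // E eqxx.
Qed.

Lemma clean_last_fresh a u : 0 < wt P s z a -> clean P z (map s a) ->
  0 < P (endpoint s z a) u -> u \notin a.
Proof.
move=> wa cl Pu; apply/negP => /(nthP z)[i ia iu].
have ne : vert a i != vert a (size a) by apply: clean_vert_inj; rewrite // ia leqnn.
have /cleanP[_ cl'] := cl; case/eqP: ne.
apply: cl'; rewrite ?vert_mem //; apply: (@simI _ _ _ _ _ u).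
  by rewrite -iu; exact: wt_nth.
by rewrite /vert take_size.
Qed.

(** Read backwards: equal endpoints come from equal last choices, and the vertices where these were
    made have overlapping rows, hence coincide. *)
Lemma clean_endpoint_inj a b : size a = size b ->
  0 < wt P s z a -> 0 < wt P s z b -> clean P z (map s a ++ map s b) ->
  endpoint s z a = endpoint s z b -> a = b.
Proof.
elim/last_ind: a b => [|a u IH] b; first by case: b.
elim/last_ind: b => [|b v _]; first by rewrite size_rcons.
rewrite !size_rcons => -[sab] wa wb cl.
have := wa; have := wb; rewrite -!cats1 => /wt_cat_gt0[wb1 wb2] /wt_cat_gt0[wa1 wa2].
rewrite /endpoint !map_cat !last_cat /= => /perm_inj uv; rewrite uv.
rewrite -uv in wb2; rewrite (IH b) //.
  apply: clean_sub cl => y; rewrite !map_rcons !mem_cat !mem_rcons !inE.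
  by case/orP => ->; rewrite ?orbT.
have /cleanP[_ cl'] := cl.
have mem c d : endpoint s z c \in z :: map s (rcons c d).
  have := mem_last z (map s c).
  by rewrite map_rcons !inE mem_rcons inE => /orP[|] ->; rewrite ?orbT.
apply: cl'.
- by have := mem a u; rewrite !inE mem_cat => /orP[|] ->; rewrite ?orbT.
- by have := mem b v; rewrite !inE mem_cat => /orP[|] ->; rewrite ?orbT.
by move: wa2 wb2; rewrite /= !mulr1 => w1 w2; exact: (simI w1 w2).
Qed.

(* Two clean walks that part and meet again with a single collision stay
   disjoint in between and merge only once, at the same time. *)
Lemma merge_uniq (c A B E : seq 'I_n) W :
  size A = size B -> E != [::] ->
  head z A != head z B -> last z A != last z B ->
  0 < wt P s z (c ++ A ++ E) -> 0 < wt P s z (c ++ B ++ E) ->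
  clean P z (map s (c ++ A ++ E)) -> clean P z (map s (c ++ B ++ E)) ->
  separated P z (map s (c ++ A ++ E) ++ map s (c ++ B ++ E)) W ->
  uniq (c ++ A ++ B ++ E).
Proof.
move=> sAB E0 hAB lAB; set a := c ++ A ++ E; set b := c ++ B ++ E.
move=> wa wb cla clb [sep1 sep2]; set i := size (c ++ A).
have ib : i = size (c ++ B) by rewrite /i !size_cat sAB.
have A0 : A != [::].
  apply: contra_neq lAB => A0; move/eqP: sAB; rewrite A0 eq_sym.
  by move=> /nilP ->.
have B0 : B != [::] by rewrite -size_eq0 -sAB size_eq0.
have ia : (i < size a)%N.
  by rewrite /i /a !size_cat addnA -[ltnLHS]addn0 ltn_add2l lt0n size_eq0.
have ib' : (i < size b)%N.
  by rewrite ib /b !size_cat addnA -[ltnLHS]addn0 ltn_add2l lt0n size_eq0.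
have va : vert a i = s (last z A).
  rewrite /vert /a catA take_size_cat // /endpoint map_cat last_cat.
  by case: (A) A0 => //= y A' _; rewrite last_map.
have vb : vert b i = s (last z B).
  rewrite /vert /b ib catA take_size_cat // /endpoint map_cat last_cat.
  by case: (B) B0 => //= y B' _; rewrite last_map.
have vab : vert a i != vert b i by rewrite va vb (inj_eq perm_inj).
have nthE : nth z a i = nth z b i.
  by rewrite /a /b !catA nth_cat ltnn subnn {1}ib nth_cat ltnn subnn.
have sim_ab : sim P (vert a i) (vert b i).
  apply: (@simI _ _ _ _ _ (nth z a i)); first exact: wt_nth.
  by rewrite nthE; exact: wt_nth.
have i0 : (0 < i)%N.
  by rewrite /i size_cat addn_gt0 [X in _ || X]lt0n size_eq0 A0 orbT.
have memS d j : (0 < j <= size d)%N -> vert d j \in map s d.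
  by case: j => // j /andP[_ jd]; rewrite vertS // map_f // mem_nth.
(* Just before merging, the walks stand at distinct vertices that share their next choice; this
   overlap has to involve [W]. *)
have W_ab : vert a i = W \/ vert b i = W.
  have [|aW] := eqVneq (vert a i) W; first by left.
  have [|bW] := eqVneq (vert b i) W; first by right.
  case/eqP: vab; apply: sep2 => //; rewrite mem_cat memS ?i0 //= 1?ltnW //.
  by rewrite orbT.
have /cleanP[_ cla'] := cla; have /cleanP[_ clb'] := clb.
have neWa j : (j < i)%N -> vert a j != W.
  move=> ji; case: W_ab => <-.
    by apply: clean_vert_inj => //; rewrite ji ltnW.
  apply/eqP => ab.
  have : vert a j != vert a i by apply: clean_vert_inj; rewrite // ji ltnW.
  by move/eqP; apply; apply: cla'; rewrite ?vert_mem // ab sim_sym.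
have neWb j : (j < i)%N -> vert b j != W.
  move=> ji; case: W_ab => <-; last first.
    by apply: clean_vert_inj => //; rewrite ji ltnW.
  apply/eqP => ab.
  have : vert b j != vert b i by apply: clean_vert_inj; rewrite // ji ltnW.
  by move/eqP; apply; apply: clb'; rewrite ?vert_mem // ab.
(* A choice common to both walks before they merge is traced back to [z]: it occurs at the same time
   in both, and the walks agree up to then. As [A] and [B] differ at their heads, they have no
   choice in common. *)
have synch l j : (l < i)%N -> (j < i)%N -> nth z a l = nth z b j ->
    l = j /\ forall k, (k <= l)%N -> nth z a k = nth z b k.
  elim: l j => [|l IH] j li ji E1.
    case: j => [|j] in ji E1 *; first by split => // -[].
    have bj : vert b j.+1 \in map s b by rewrite memS //= ltnW // (ltn_trans ji).
    have /negP[] : ~~ sim P (vert b j.+1) z.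
      by apply: sep1; rewrite ?neWb // mem_cat bj orbT.
    apply: (@simI _ _ _ _ _ (nth z b j.+1)).
      by apply: wt_nth => //; exact: ltn_trans ji _.
    by rewrite -E1; have := wt_nth wa (ltn_trans li ia); rewrite /vert take0.
  have al : vert a l.+1 \in map s a by rewrite memS //= ltnW // (ltn_trans li).
  case: j => [|j] in ji E1 *.
    have /negP[] : ~~ sim P (vert a l.+1) z.
      by apply: sep1; rewrite ?neWa // mem_cat al.
    apply: (@simI _ _ _ _ _ (nth z a l.+1)).
      by apply: wt_nth => //; exact: ltn_trans li _.
    by rewrite E1; have := wt_nth wb (ltn_trans ji ib'); rewrite /vert take0.
  have bj : vert b j.+1 \in map s b by rewrite memS //= ltnW // (ltn_trans ji).
  have : vert a l.+1 = vert b j.+1.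
    apply: sep2; rewrite ?neWa ?neWb // ?mem_cat ?al ?bj ?orbT //.
    apply: (@simI _ _ _ _ _ (nth z a l.+1)).
      by apply: wt_nth => //; exact: ltn_trans li _.
    by rewrite E1; apply: wt_nth => //; exact: ltn_trans ji _.
  rewrite !vertS; [|exact: ltn_trans (ltnW ji) _|exact: ltn_trans (ltnW li) _].
  move=> /perm_inj E2; have [lj H] := IH j (ltnW li) (ltnW ji) E2.
  rewrite -lj in E1 *; split => // k.
  by rewrite leq_eqVlt => /orP[/eqP->|]; [|exact: H].
have AB : ~~ has (mem A) B.
  apply/hasPn => v /(nthP z)[j jB jv]; apply/negP => /(nthP z)[l lA lv].
  have Ea k : (k < size A)%N -> nth z a (size c + k) = nth z A k.
    by move=> kA; rewrite /a nth_cat ltnNge leq_addr /= addKn nth_cat kA.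
  have Eb k : (k < size B)%N -> nth z b (size c + k) = nth z B k.
    by move=> kB; rewrite /b nth_cat ltnNge leq_addr /= addKn nth_cat kB.
  have li : (size c + l < i)%N by rewrite /i size_cat ltn_add2l.
  have ji : (size c + j < i)%N by rewrite ib size_cat ltn_add2l.
  have [|_] := synch _ _ li ji; first by rewrite Ea // Eb // lv jv.
  move/(_ (size c + 0)%N); rewrite leq_add2l leq0n => /(_ isT).
  rewrite Ea ?Eb ?nth0; [by move/eqP; rewrite (negPf hAB)| |].
    by rewrite lt0n size_eq0.
  by rewrite lt0n size_eq0.
have Ua := clean_uniq wa cla; have Ub := clean_uniq wb clb.
move: Ua Ub; rewrite /a /b !cat_uniq !has_cat !negb_or.
case/and5P => -> /andP[cA cE] -> EA -> /and5P[_ /andP[cB _] -> EB _] /=.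
by rewrite cA cB cE EA EB AB.
Qed.

End Paths.

(** * Resampling the permutation *)

Section Perturbation.
Variables (R : realType) (n : nat) (P : 'M[R]_n).
Hypothesis P_bis : bistochastic P.
Implicit Types (s : 'S_n) (x y z u v : 'I_n) (K us zs : seq 'I_n).

(** Expected number of visits to [y] at times 1 to [t]. Its sum over the starting points is only
    [t], because column sums are 1. *)
Definition reach s t z y : R := \sum_(i < t) qpow P s i.+1 z y.

Lemma reach_ge0 s t z y : 0 <= reach s t z y.
Proof. by apply: sumr_ge0 => i _; exact: qpow_ge0. Qed.

Lemma reach_col s t y : \sum_z reach s t z y = t%:R.
Proof.
rewrite exchange_big /= (eq_bigr (fun=> 1)); last first.
  by move=> i _; exact: qpow_col.
by rewrite sumr_const card_ord.
Qed.

Lemma reachS s t z u :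
  reach s t.+1 z (s u) = P z u + \sum_v P z v * reach s t (s v) (s u).
Proof.
rewrite /reach big_ord_recl; congr (_ + _).
  rewrite qpowS (bigD1 u) //= qpow0 eqxx mulr1 big1 ?addr0 // => v vu.
  by rewrite qpow0 (inj_eq perm_inj) (negPf vu) mulr0.
under [RHS]eq_bigr do rewrite mulr_sumr.
by rewrite exchange_big /=; apply: eq_bigr => i _; rewrite qpowS.
Qed.

Definition agree_off s s' K := forall u, u \notin K -> s u = s' u.

(** The coupling behind it: both chains make the same choices until one lies in [K]. Since [s u] is
    entered through the choice [u] only, visits to the points [s u] count the choices in [K]. *)
Lemma qpow_perturb s s' K t z : agree_off s s' K ->
  \sum_y pos_part (qpow P s t z y - qpow P s' t z y) <=
  \sum_(u <- K) reach s t z (s u).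
Proof.
move=> ss'; elim: t z => [|t IH] z.
  rewrite big1 => [|y _]; last by rewrite !qpow0 subrr /pos_part maxxx.
  by apply: sumr_ge0 => u _; exact: reach_ge0.
apply: (@le_trans _ _ (\sum_u P z u *
    \sum_y pos_part (qpow P s t (s u) y - qpow P s' t (s' u) y))).
  under [leRHS]eq_bigr do rewrite mulr_sumr.
  rewrite exchange_big ler_sum // => y _; rewrite !qpowS -sumrB.
  apply: le_trans (pos_part_sum _ _ _) _; apply: ler_sum => u _.
  by rewrite -mulrBr pos_partM ?P_ge0.
under [leRHS]eq_bigr => u _ do rewrite reachS.
rewrite big_split /= exchange_big /=.
under [X in _ <= _ + X]eq_bigr do rewrite -mulr_sumr.
have PK : \sum_u (u \in K)%:R * P z u <= \sum_(u <- K) P z u.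
  elim: (K) => [|v K' IHK].
    by rewrite big_nil big1 // => u _; rewrite mul0r.
  rewrite big_cons; apply: le_trans (lerD (lexx _) IHK).
  rewrite [in leRHS](bigD1 v) //= [in leLHS](bigD1 v) //= inE eqxx mul1r lerD //.
  rewrite ler_wpDl ?mulr_ge0 ?P_ge0 // ler_sum // => u uv.
  by rewrite inE (negPf uv).
apply: le_trans (lerD PK (lexx _)); rewrite -big_split /= ler_sum // => u _.
rewrite [X in X + _]mulrC -mulrDr ler_wpM2l ?P_ge0 //.
case: (boolP (u \in K)) => uK; last by rewrite add0r -ss' // IH.
rewrite ler_wpDr ?sumr_ge0 // => [v _|]; first exact: reach_ge0.
rewrite -(qpow_row P_bis s t (s u)) ler_sum // => y _.
by apply: pos_part_le; rewrite ?qpow_ge0 // lerBlDr lerDl qpow_ge0.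
Qed.

Lemma dist_perturb s s' K t z : agree_off s s' K ->
  dist P s' t z <= dist P s t z + \sum_(u <- K) reach s t z (s u).
Proof.
move=> ss'; apply: le_trans (lerD (lexx _) (qpow_perturb _ _ ss')).
rewrite !distE -big_split ler_sum //= => y _.
apply: le_trans (pos_part_subadd _ _); rewrite le_eqVlt; apply/orP; left.
by apply/eqP; congr pos_part; ring.
Qed.

Lemma sum_dist_perturb s s' K t : agree_off s s' K ->
  \sum_z dist P s' t z <= \sum_z dist P s t z + (size K)%:R * t%:R.
Proof.
move=> ss'; apply: le_trans (ler_sum _ (fun z _ => dist_perturb t z ss')) _.
rewrite big_split lerD2l exchange_big /=.
rewrite (eq_bigr (fun=> t%:R)) => [|u _]; last exact: reach_col.
by rewrite big_const_seq count_predT iter_addr_0 mulr_natl.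
Qed.

Lemma sum_reach_perturb s s' K t : agree_off s s' K ->
  \sum_z reach s t z z <= \sum_z reach s' t z z + (size K)%:R * t%:R ^+ 2.
Proof.
move=> ss'; rewrite -lerBlDl -sumrB /reach.
under eq_bigr do rewrite -sumrB.
rewrite exchange_big /=.
apply: (@le_trans _ _ (\sum_(i < t) (size K)%:R * t%:R)); last first.
  by rewrite sumr_const card_ord -[leLHS]mulr_natr expr2 mulrA.
apply: ler_sum => i _.
apply: (@le_trans _ _ (\sum_z \sum_(u <- K) reach s i.+1 z (s u))).
  apply: ler_sum => z _; apply: le_trans (qpow_perturb _ _ ss').
  rewrite (bigD1 z) //= ler_wpDr ?le_pos_part //.
  by apply: sumr_ge0 => y _; exact: pos_part_ge0.
rewrite exchange_big /= (eq_bigr (fun=> i.+1%:R)) => [|u _]; last exact: reach_col.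
rewrite big_const_seq count_predT iter_addr_0 -[leLHS]mulr_natl ler_wpM2l //.
by rewrite ler_nat.
Qed.

(* When [s u] is uniform and unknown, [redirect s u z] has nearly the law of [s]
   given [s u = z]. *)
Definition redirect s u z : 'S_n := (s * tperm (s u) z)%g.

Fixpoint redirects s us zs : 'S_n :=
  match us, zs with
  | u :: us', z :: zs' => redirect (redirects s us' zs') u z
  | _, _ => s
  end.

Lemma redirect_id s u z v : v != u -> s v != z -> redirect s u z v = s v.
Proof.
by move=> vu vz; rewrite permM tpermD // 1?eq_sym // (inj_eq perm_inj).
Qed.

Lemma redirects_id s us zs v : v \notin us -> s v \notin zs ->
  redirects s us zs v = s v.
Proof.
elim: us zs => [|u us IH] [|z zs] //=.
rewrite !inE !negb_or => /andP[vu vus] /andP[vz vzs].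
by rewrite redirect_id // IH.
Qed.

Lemma agree_off_redirects s us zs :
  agree_off s (redirects s us zs) (us ++ map (s^-1)%g zs).
Proof.
move=> v; rewrite mem_cat negb_or => /andP[vus vzs]; rewrite redirects_id //.
by apply: contra vzs => svz; apply/mapP; exists (s v); rewrite ?permK.
Qed.

(** A permutation [s'] with [s' u = z] is the redirection of [n] permutations, namely
    [s' * tperm w z] for each value [w]. The condition that [z] avoids the images of [S] becomes the
    same condition on [w] under [s'], and at least [m] values [w] satisfy it. *)
Lemma redirect_sum m u z (S : seq 'I_n) (F : 'S_n -> R) :
  (forall s, 0 <= F s) -> (m + size S <= n)%N ->
  m%:R * \sum_(s : 'S_n) (s u == z)%:R * F s <=
  \sum_(s : 'S_n) (z \notin map s S)%:R * F (redirect s u z).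
Proof.
move=> F0 mS.
have -> : \sum_(s : 'S_n) (z \notin map s S)%:R * F (redirect s u z) =
    \sum_(s : 'S_n) (s u == z)%:R * F s * \sum_w (w \notin map s S)%:R.
  under [RHS]eq_bigr do rewrite mulr_sumr.
  rewrite [RHS]exchange_big /=.
  under [RHS]eq_bigr => w _ do rewrite (reindex_inj (mulIg (tperm w z))) /=.
  rewrite [RHS]exchange_big /=; apply: eq_bigr => s _.
  rewrite (bigD1 (s u)) //= big1 ?addr0 => [|w ws].
    rewrite permM tpermL eqxx mul1r mulrC; congr (_ * _%:R); congr nat_of_bool.
    congr negb; apply/mapP/mapP => -[v vS E]; exists v => //.
      by rewrite permM -E tpermR.
    by apply: (@perm_inj _ (tperm (s u) z)); rewrite tpermR {1}E permM.
  rewrite permM -[X in _ == X](tpermL w z) (inj_eq perm_inj) eq_sym.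
  by rewrite (negPf ws) !mul0r.
rewrite mulr_sumr ler_sum // => s _.
rewrite mulrC ler_wpM2l ?mulr_ge0 // -[leRHS]natr_sum ler_nat.
rewrite (eq_bigr (fun w => if w \notin map s S then 1%N else 0%N)); last first.
  by move=> w _; case: (_ \notin _).
rewrite -big_mkcond sum1_card; have := cardC (mem (map s S)).
rewrite card_ord => cE; rewrite -(leq_add2r (size S)); apply: leq_trans mS _.
by rewrite -[leqLHS]cE addnC leq_add2l (leq_trans (card_size _)) // size_map.
Qed.

(** The weight [W] sees the permutation only on [S]. A target that avoids the images of [S] and of
    the remaining points of [us] leaves [W] and these images unchanged, so the images can be
    resampled one by one. *)
Lemma redirects_sum m us (S : seq 'I_n) (W : 'S_n -> R)
    (H : 'S_n -> seq 'I_n -> R) :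
  (m + size us + size S <= n)%N -> uniq (us ++ undup S) ->
  (forall s, 0 <= W s) -> (forall s zs, 0 <= H s zs) ->
  (forall s s', {in S, s =1 s'} -> W s = W s') ->
  m%:R ^+ size us * \sum_s W s * H s (map s us) <=
  \sum_s W s * psum (size us) (fun zs => H (redirects s us zs) zs).
Proof.
move=> + + W0 + WS; elim: us H => [|u us IH] H mn Uus H0 /=.
  by rewrite mul1r.
have [uus [uS Uus']] : u \notin us /\ u \notin S /\ uniq (us ++ undup S).
  by move: Uus; rewrite /= mem_cat mem_undup negb_or -andbA => /and3P[].
pose H' s l := \sum_z H (redirect s u z) (z :: l).
have := IH H'; rewrite -addSnnS addSn in mn.
move=> /(_ (ltnW mn) Uus' (fun s l => sumr_ge0 _ (fun z _ => H0 _ _))) {}IH.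
apply: le_trans (le_trans _ IH) _; last first.
  rewrite le_eqVlt; apply/orP; left; apply/eqP; apply: eq_bigr => s _.
  by congr (_ * _); rewrite -psum_sum; apply: eq_psum.
rewrite exprSr -mulrA ler_wpM2l ?exprn_ge0 //.
have -> : \sum_s W s * H s (s u :: map s us) =
    \sum_z \sum_(s : 'S_n) (s u == z)%:R * (W s * H s (z :: map s us)).
  rewrite exchange_big /=; apply: eq_bigr => s _.
  rewrite (bigD1 (s u)) //= eqxx mul1r big1 ?addr0 // => z zs.
  by rewrite eq_sym (negPf zs) mul0r.
rewrite mulr_sumr.
have -> : \sum_s W s * H' s (map s us) =
    \sum_z \sum_s W s * H (redirect s u z) (z :: map s us).
  by rewrite exchange_big; apply: eq_bigr => s _; rewrite mulr_sumr.
apply: ler_sum => z _.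
apply: le_trans (redirect_sum (S := us ++ S) _ _ _ _) _.
- by move=> s; rewrite mulr_ge0.
- by rewrite size_cat addnA; apply: leq_trans mn; rewrite leqnSn.
apply: ler_sum => s _; case: (boolP (z \in _)) => zS /=.
  by rewrite mul0r mulr_ge0.
have same : {in us ++ S, redirect s u z =1 s}.
  move=> v vS; apply: redirect_id.
    by apply: contraTneq vS => ->; rewrite mem_cat (negPf uus).
  by apply: contraNneq zS => <-; rewrite map_f.
rewrite mul1r (WS _ s) => [|v vS]; last by rewrite same // mem_cat vS orbT.
rewrite (_ : map _ us = map s us) //; apply/eq_in_map => v vus.
by rewrite same // mem_cat vus.
Qed.

End Perturbation.

(* Each factor looks at the points on both sides of its own position.  As
   [y + w <= (th + y) (th + w) / th], the product splits into one that can be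
   summed from the left and one that can be summed from the right. *)
Section InteractingProduct.
Variables (R : realType) (T : finType) (psi : T -> R) (r : T -> T -> R).
Variables (th : R) (K : nat).
Hypotheses (psi_ge0 : forall z, 0 <= psi z) (r_ge0 : forall z y, 0 <= r z y).
Hypotheses (th_gt0 : 0 < th) (th_le1 : th <= 1).

Let g z (l : seq T) := Num.min 1 (psi z + \sum_(y <- l) r z y).

Hypothesis g_avg : forall l, (size l <= K)%N ->
  \sum_z g z l <= #|T|%:R * th ^+ 2.

Fixpoint interaction (acc l : seq T) : R :=
  if l is z :: l' then
    Num.min 1 (psi z + \sum_(y <- acc) r z y + \sum_(y <- l') r z y) *
      interaction (z :: acc) l'
  else 1.

Let fwd := fix fwd (l : seq T) : R :=
  if l is z :: l' then (th + g z l') * fwd l' else 1.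
Let bwd := fix bwd (acc l : seq T) : R :=
  if l is z :: l' then (th + g z acc) * bwd (z :: acc) l' else 1.

Let sum_ge0 z (l : seq T) : 0 <= \sum_(y <- l) r z y.
Proof. by apply: sumr_ge0. Qed.

Let g_ge0 z l : 0 <= g z l.
Proof. by rewrite le_min ler01 addr_ge0. Qed.

Let g_le1 z l : g z l <= 1. Proof. by rewrite ge_min lexx. Qed.

Let interaction_le acc l :
  interaction acc l <= th ^- size l * (fwd l * bwd acc l).
Proof.
elim: l acc => [|z l IH] acc /=; first by rewrite expr0 invr1 !mul1r.
have int0 : 0 <= interaction (z :: acc) l.
  elim: (l) (z :: acc) => //= y l' IH' acc'.
  by rewrite mulr_ge0 // le_min ler01 !addr_ge0.
apply: le_trans (_ : _ <= th^-1 * ((th + g z l) * (th + g z acc)) *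
   (th ^- size l * (fwd l * bwd (z :: acc) l))) _; last first.
  by rewrite exprS invfM le_eqVlt; apply/orP; left; apply/eqP; ring.
apply: ler_pM => //; first by rewrite le_min ler01 !addr_ge0.
apply: le_trans (_ : _ <= g z l + g z acc) _.
  rewrite /g; have := psi_ge0 z; have := sum_ge0 z l; have := sum_ge0 z acc.
  set A := \sum_(y <- acc) _; set B := \sum_(y <- l) _; move=> A0 B0 p0.
  rewrite ge_min; apply/orP; rewrite !minElt.
  by do 2 case: ltP => ?; first [by left; lra | by right; lra].
rewrite mulrC ler_pdivlMr //.
have -> : (th + g z l) * (th + g z acc) = (g z l + g z acc) * th +
  (th ^+ 2 + g z l * g z acc) by ring.
by rewrite lerDl addr_ge0 ?exprn_ge0 ?mulr_ge0 // ltW.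
Qed.

Let step_avg l : (size l <= K)%N ->
  \sum_z (th + g z l) ^+ 2 <= 4 * #|T|%:R * th ^+ 2.
Proof.
move=> lK; apply: le_trans (_ : _ <= \sum_z (th ^+ 2 + 3 * g z l)) _.
  apply: ler_sum => z _; move: (g z l) (g_ge0 z l) (g_le1 z l) => x x0 x1.
  have : 0 <= x * (1 - x) by rewrite mulr_ge0 // subr_ge0.
  have : 0 <= x * (1 - th) by rewrite mulr_ge0 // subr_ge0.
  by rewrite sqrrD !mulrBr !mulr1 -expr2 mulrC => ? ?; lra.
rewrite big_split /= sumr_const -mulr_sumr -(mulr_natl (th ^+ 2)).
rewrite -[X in X%:R * _ + _]/#|T|; have := g_avg lK; lra.
Qed.

Let C : R := 4 * #|T|%:R * th ^+ 2.
Let C_ge0 : 0 <= C. Proof. by rewrite !mulr_ge0 ?exprn_ge0 // ltW. Qed.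

Let sum_fwd k : (k <= K)%N -> psum k (fun l => fwd l ^+ 2) <= C ^+ k.
Proof.
elim: k => [|k IH] kK /=; first by rewrite expr1n.
rewrite -psum_sum.
apply: le_trans (_ : _ <= psum k (fun l => C * fwd l ^+ 2)) _; last first.
  by rewrite psumZl exprS ler_wpM2l // IH // ltnW.
apply: ler_psum => l sl; under eq_bigr do rewrite exprMn.
by rewrite -mulr_suml ler_wpM2r ?sqr_ge0 // step_avg // sl ltnW.
Qed.

Let sum_bwd k acc : (size acc + k <= K)%N ->
  psum k (fun l => bwd acc l ^+ 2) <= C ^+ k.
Proof.
elim: k acc => [|k IH] acc kK /=; first by rewrite expr1n.
apply: le_trans (_ : _ <= \sum_z (th + g z acc) ^+ 2 * C ^+ k) _; last first.
  rewrite -mulr_suml exprS ler_wpM2r ?exprn_ge0 // step_avg //.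
  by rewrite (leq_trans _ kK) // leq_addr.
apply: ler_sum => z _; under eq_psum do rewrite exprMn.
by rewrite psumZl ler_wpM2l ?sqr_ge0 // IH // addSnnS.
Qed.

(** The product of [fwd] and [bwd] is at most half the sum of their squares, and each square is
    summed one point at a time from its own end. Every position yields [C = 4 #|T| th^2] against the
    prefactor [th^-1]. *)
Lemma sum_interaction k : (k <= K)%N ->
  psum k (interaction [::]) <= (4 * #|T|%:R * th) ^+ k.
Proof.
move=> kK.
apply: le_trans (_ : _ <= psum k (fun l => th ^- k *
    (2^-1 * fwd l ^+ 2 + 2^-1 * bwd [::] l ^+ 2))) _.
  apply: ler_psum => l sl; apply: le_trans (interaction_le _ _) _.
  rewrite sl ler_wpM2l ?invr_ge0 ?exprn_ge0 ?(ltW th_gt0) //.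
  have := sqr_ge0 (fwd l - bwd [::] l); nra.
rewrite psumZl psumD !psumZl.
have -> : (4 * #|T|%:R * th) ^+ k = th ^- k * C ^+ k.
  rewrite -exprVn -exprMn /C; congr (_ ^+ k).
  by rewrite expr2 [RHS]mulrC !mulrA mulfK // gt_eqF.
rewrite ler_wpM2l ?invr_ge0 ?exprn_ge0 ?(ltW th_gt0) //.
have := sum_fwd kK; have := @sum_bwd k [::] kK; lra.
Qed.

End InteractingProduct.

(** * Many walkers from one point *)

Section Walkers.
Variables (R : realType) (n : nat) (P : 'M[R]_n) (m : nat).
Hypothesis P_bis : bistochastic P.

(* A walker [(p, u)] makes the choices [p], then [u]; its final jump to the
   image of [u] is kept apart, as it is the one that gets resampled. *)
Let walker := (seq 'I_n * 'I_n)%type.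
Implicit Types (s : 'S_n) (x y z u v : 'I_n) (q : walker) (l acc : seq walker).

Definition walker_wt s z q := wt P s z q.1 * P (endpoint s z q.1) q.2.

Definition wsum (F : walker -> R) := psum m (fun p => \sum_u F (p, u)).

Lemma ler_wsum F G : (forall q, size q.1 = m -> F q <= G q) ->
  wsum F <= wsum G.
Proof. by move=> FG; apply: ler_psum => p sp; apply: ler_sum => u _; apply: FG. Qed.

Lemma eq_wsum F G : (forall q, size q.1 = m -> F q = G q) -> wsum F = wsum G.
Proof. by move=> FG; apply: eq_psum => p sp; apply: eq_bigr => u _; apply: FG. Qed.

Lemma wsum_ge0 F : (forall q, size q.1 = m -> 0 <= F q) -> 0 <= wsum F.
Proof. by move=> F0; apply: psum_ge0 => p sp; apply: sumr_ge0 => u _; apply: F0. Qed.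

Lemma wsumZl (c : R) F : wsum (fun q => c * F q) = c * wsum F.
Proof. by rewrite /wsum -psumZl; apply: eq_psum => p _; rewrite mulr_sumr. Qed.

Lemma wsumD F G : wsum (fun q => F q + G q) = wsum F + wsum G.
Proof. by rewrite /wsum -psumD; apply: eq_psum => p _; rewrite big_split. Qed.

Lemma wsum_sum (I : Type) (r : seq I) (F : I -> walker -> R) :
  wsum (fun q => \sum_(i <- r) F i q) = \sum_(i <- r) wsum (F i).
Proof.
by rewrite /wsum -psum_sum; apply: eq_psum => p _; rewrite exchange_big.
Qed.

Lemma walker_wt_ge0 s z q : 0 <= walker_wt s z q.
Proof. by rewrite mulr_ge0 // ?wt_ge0 ?P_ge0. Qed.

Lemma wsum_walker_wt s z : wsum (walker_wt s z) = 1.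
Proof.
rewrite -[RHS](psum_wt P_bis s m z); apply: eq_psum => p _.
by rewrite -mulr_sumr row_sum // mulr1.
Qed.

Fixpoint ksum k (F : seq walker -> R) acc : R :=
  if k is k'.+1 then wsum (fun q => ksum k' F (q :: acc)) else F acc.

Let sized l := all (fun q => size q.1 == m) l.

Lemma ler_ksum k F G acc : sized acc ->
  (forall l, sized l -> size l = (k + size acc)%N -> F l <= G l) ->
  ksum k F acc <= ksum k G acc.
Proof.
elim: k acc => [|k IH] acc sacc FG /=; first exact: FG.
apply: ler_wsum => q sq; apply: IH => [|l sl ssl]; first by rewrite /= sq eqxx.
by apply: FG; rewrite // ssl /= addnS.
Qed.

Lemma ksum_sum (I : Type) (r : seq I) k (F : I -> seq walker -> R) acc :
  ksum k (fun l => \sum_(i <- r) F i l) acc = \sum_(i <- r) ksum k (F i) acc.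
Proof.
elim: k acc => //= k IH acc; rewrite -wsum_sum.
by apply: eq_wsum => q _; rewrite IH.
Qed.

Lemma ksumZr k (c : R) F acc :
  ksum k (fun l => F l * c) acc = ksum k F acc * c.
Proof.
elim: k acc => //= k IH acc; rewrite mulrC -wsumZl.
by apply: eq_wsum => q _; rewrite IH mulrC.
Qed.

Lemma ksum_walker_wt k s z acc :
  ksum k (fun l => \prod_(q <- l) walker_wt s z q) acc =
  \prod_(q <- acc) walker_wt s z q.
Proof.
elim: k acc => //= k IH acc.
rewrite -[RHS]mulr1 -[X in _ = _ * X](wsum_walker_wt s z) -wsumZl.
by apply: eq_wsum => q _; rewrite IH big_cons mulrC.
Qed.

Definition apart q q' := [&& q.2 \notin q'.1, q.2 != q'.2 & q'.2 \notin q.1].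

(** This makes the weights of all walkers independent of the images of the last choices, so that
    these images can be resampled. *)
Fixpoint fresh l : bool :=
  if l is q :: l' then [&& q.2 \notin q.1, all (apart q) l' & fresh l'] else true.

Lemma fresh_uniq l : fresh l ->
  uniq (map snd l ++ undup (flatten (map fst l))).
Proof.
move=> fl; rewrite cat_uniq undup_uniq andbT; apply/andP; split.
  elim: l fl => //= q l IH /and3P[_ ql /IH->]; rewrite andbT.
  by apply/mapP => -[q' /(allP ql)/and3P[_ + _] E]; rewrite E eqxx.
apply/hasPn => v; rewrite mem_undup; elim: l fl => //= q l IH /and3P[qq ql fl].
rewrite mem_cat inE negb_or => /orP[vq|vl].
  apply/andP; split; first by apply: contraNneq qq => <-.
  apply/mapP => -[q' /(allP ql)/and3P[_ _] + E]; rewrite -E vq //.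
rewrite IH // andbT; apply/eqP => E.
have /flattenP[p /mapP[q' q'l ->] vq'] := vl.
by have /and3P[+ _ _] := allP ql _ q'l; rewrite -E vq'.
Qed.

(* Probability that two independent walkers of length [m] see a collision. *)
Definition chi s z : R := psum m (fun a => psum m (fun b =>
  wt P s z a * wt P s z b * (~~ clean P z (map s a ++ map s b))%:R)).

Section Quenched.
Variables (s : 'S_n) (z : 'I_n) (D kap : R).
Hypotheses (P_le : forall x u, P x u <= D) (D_ge0 : 0 <= D).
Hypothesis chi_le : chi s z <= kap.

Local Notation w := (walker_wt s z).

Lemma wt_le_expr x a : wt P s x a <= D ^+ size a.
Proof.
elim: a x => //= u a IH x; rewrite exprS ler_pM ?P_ge0 ?wt_ge0 //.
Qed.

Lemma wt_gt0_or x a : wt P s x a = 0 \/ 0 < wt P s x a.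
Proof.
have := wt_ge0 P_bis s x a; rewrite le_eqVlt => /orP[/eqP<-|]; by [left|right].
Qed.

Lemma own_return : wsum (fun q => w q * (q.2 \in q.1)%:R) <= kap.
Proof.
apply: le_trans chi_le; apply: ler_psum => p sp.
apply: (@le_trans _ _ (wt P s z p * (~~ clean P z (map s p))%:R)).
  have [w0|wp] := wt_gt0_or z p.
    by rewrite w0 mul0r big1 // => u _; rewrite /walker_wt /= w0 !mul0r.
  have [cl|ncl] /= := boolP (clean P z (map s p)).
    rewrite mulr0 big1 // => u _; case: (boolP (u \in p)) => /=; rewrite ?mulr0 // mulr1.
    move=> up; apply: contraTeq up => E; apply: (clean_last_fresh P_bis wp cl).
    rewrite lt0r P_ge0 // andbT; apply: contra_neq E => E.
    by rewrite /walker_wt /= E mulr0.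
  rewrite mulr1 -[leRHS]mulr1 -[X in _ <= _ * X](row_sum P_bis (endpoint s z p)) mulr_sumr.
  apply: ler_sum => u _; rewrite /walker_wt /=; case: (u \in p); rewrite ?mulr1 //.
  by rewrite mulr0 mulr_ge0 ?wt_ge0 ?P_ge0.
rewrite -[leLHS]mulr1 -[X in _ * X <= _](psum_wt P_bis s m z) -psumZl; apply: ler_psum => b sb.
rewrite mulrAC ler_wpM2l ?mulr_ge0 ?wt_ge0 // ler_nat.
have [//|] := boolP (clean P z (map s p)).
apply: contraNltn; case: (boolP (clean P z (_ ++ _))) => // cl _.
by apply: clean_sub cl => y; rewrite mem_cat => ->.
Qed.

Definition atom v := wsum (fun q => w q * (q.2 == v)%:R).

Lemma atomE v : atom v = psum m (fun a => w (a, v)).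
Proof.
apply: eq_psum => a _; rewrite (bigD1 v) //= eqxx mulr1 big1 ?addr0 // => u uv.
by rewrite (negPf uv) mulr0.
Qed.

Lemma atom_ge0 v : 0 <= atom v.
Proof. by apply: wsum_ge0 => q _; rewrite mulr_ge0 // walker_wt_ge0. Qed.

(** Two independent walkers with the same last choice [v] either see a collision, at a cost [kap],
    or have followed the same path by [clean_endpoint_inj]; a single path with its last choice has
    weight at most [D ^+ m.+1]. *)
Lemma atom_sqr_le v : atom v ^+ 2 <= kap + D ^+ m.+1.
Proof.
have -> : atom v ^+ 2 =
    psum m (fun a => psum m (fun b => w (a, v) * w (b, v))).
  by rewrite atomE expr2 -psumZr; apply: eq_psum => a _; rewrite -psumZl.
apply: (@le_trans _ _ (psum m (fun a => psum m (fun b =>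
   wt P s z a * wt P s z b * (~~ clean P z (map s a ++ map s b))%:R +
   (b == a)%:R * (w (a, v) * w (b, v)))))).
  apply: ler_psum => a sa; apply: ler_psum => b sb.
  have wab : w (a, v) * w (b, v) <= wt P s z a * wt P s z b.
    by apply: ler_pM; rewrite ?walker_wt_ge0 // ler_piMr ?wt_ge0 ?P_le1.
  have [cl|ncl] := boolP (clean P z _); rewrite /= ?mulr0 ?add0r ?mulr1; last first.
    by rewrite ler_wpDr // mulr_ge0 // mulr_ge0 ?walker_wt_ge0.
  have [->|ab] := eqVneq b a; first by rewrite mul1r.
  rewrite mul0r le_eqVlt; apply/orP; left.
  apply: contraNT ab; rewrite !mulf_eq0 !negb_or => /andP[/andP[wa Pa] /andP[wb Pb]].
  have wa' : 0 < wt P s z a by rewrite lt0r wa wt_ge0.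
  have wb' : 0 < wt P s z b by rewrite lt0r wb wt_ge0.
  have mem c : endpoint s z c \in z :: map s c by exact: mem_last.
  rewrite eq_sym; apply/eqP/(clean_endpoint_inj P_bis _ wa' wb' cl); first by rewrite sa.
  have /cleanP[_ cl'] := cl; apply: cl'.
  - by have := mem a; rewrite !inE mem_cat => /orP[|] ->; rewrite ?orbT.
  - by have := mem b; rewrite !inE mem_cat => /orP[|] ->; rewrite ?orbT.
  by apply: (@simI _ _ _ _ _ v); rewrite lt0r P_ge0 // ?Pa ?Pb.
rewrite (eq_psum (G := fun a => psum m (fun b =>
   wt P s z a * wt P s z b * (~~ clean P z (map s a ++ map s b))%:R) +
   psum m (fun b => (b == a)%:R * (w (a, v) * w (b, v))))); last first.
  by move=> a _; rewrite psumD.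
rewrite psumD psum_diag lerD //.
apply: (@le_trans _ _ (psum m (fun a => D ^+ m.+1 * w (a, v)))).
  apply: ler_psum => a sa; rewrite ler_wpM2r ?walker_wt_ge0 //.
  rewrite exprSr -sa; apply: ler_pM; rewrite ?wt_ge0 ?P_ge0 //.
  exact: wt_le_expr.
rewrite psumZl -atomE ler_piMr ?exprn_ge0 // -[leRHS](wsum_walker_wt s z).
apply: ler_wsum => q _; rewrite ler_piMr ?walker_wt_ge0 //.
by case: (_ == _).
Qed.

Variables (ka kb : R) (k : nat).
Hypotheses (kb_gt0 : 0 < kb) (ka_ge0 : 0 <= ka).
Hypothesis atom_le : kap + D ^+ m.+1 <= ka ^+ 2.

Lemma atom_le_ka v : atom v <= ka.
Proof.
have := le_trans (atom_sqr_le v) atom_le.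
by rewrite ler_pXn2r // nnegrE atom_ge0.
Qed.

Let hits v q := (v \in q.1) || (q.2 == v).
Let pass v := wsum (fun q => w q * (hits v q)%:R).
(** Later walkers would use a heavy point too often for it to stay fresh as a last choice. As a
    walker makes [m.+1] choices, at most [m.+1 / kb] points are heavy. *)
Let heavy v := kb < pass v.

Let pass_sum : \sum_v pass v <= m.+1%:R.
Proof.
have <- : m.+1%:R * wsum w = m.+1%:R by rewrite wsum_walker_wt mulr1.
rewrite -wsum_sum -wsumZl.
apply: ler_wsum => q sq; rewrite -mulr_sumr mulrC ler_wpM2r ?walker_wt_ge0 //.
apply: (@le_trans _ _ (\sum_v ((v \in q.1)%:R + (q.2 == v)%:R))).
  by apply: ler_sum => v _; rewrite -natrD ler_nat /hits; case: (_ \in _); case: eqP.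
rewrite big_split /= [X in _ + X](bigD1 q.2) //= eqxx [X in _ + (_ + X)]big1; last first.
  by move=> v /negPf; rewrite eq_sym => ->.
rewrite addr0 -natr1 lerD2r -natr_sum ler_nat.
rewrite (eq_bigr (fun v => if v \in q.1 then 1%N else 0%N)).
  by rewrite -big_mkcond sum1_card -sq card_size.
by move=> v _; case: (_ \in _).
Qed.

Let heavy_mass : wsum (fun q => w q * (heavy q.2)%:R) <= ka * m.+1%:R / kb.
Proof.
have -> : wsum (fun q => w q * (heavy q.2)%:R) =
    \sum_v (heavy v)%:R * atom v.
  under [RHS]eq_bigr do rewrite -wsumZl.
  rewrite -wsum_sum; apply: eq_wsum => q _; rewrite (bigD1 q.2) //= eqxx.
  rewrite big1 ?addr0 => [|v /negPf vq]; first by rewrite mulr1 mulrC.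
  by rewrite eq_sym vq !mulr0.
rewrite -mulrA mulrC; apply: (@le_trans _ _ (\sum_v pass v / kb * ka)).
  apply: ler_sum => v _.
  have p0 : 0 <= pass v by apply: wsum_ge0 => q _; rewrite mulr_ge0 ?walker_wt_ge0.
  rewrite ler_pM ?atom_ge0 ?atom_le_ka //.
  rewrite /heavy; case: ltP => [kp|_] /=; last by rewrite divr_ge0 // ltW.
  by rewrite ler_pdivlMr // mul1r ltW.
by rewrite -mulr_suml ler_wpM2r // -mulr_suml ler_wpM2r // invr_ge0 ltW.
Qed.

Let light acc := all (fun q => ~~ heavy q.2 && (size q.1 == m)) acc.

(** Mass of the unusable walkers: those that choose their last choice earlier ([kap]), those with a
    heavy last choice, and, for each of at most [k] previous walkers, those whose last choice is one
    of its [m.+1] choices ([ka] each) or that use its last choice ([kb]). *)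
Definition loss : R := kap + ka * m.+1%:R / kb + k%:R * (m.+1%:R * ka + kb).

Let ok acc q := [&& q.2 \notin q.1, ~~ heavy q.2 & all (apart q) acc].

Let ok_mass acc : light acc -> (size acc <= k)%N ->
  wsum (fun q => w q * (~~ ok acc q)%:R) <= loss.
Proof.
move=> la sk; apply: (@le_trans _ _ (wsum (fun q => w q * (q.2 \in q.1)%:R +
   (w q * (heavy q.2)%:R + \sum_(q' <- acc) w q * (~~ apart q q')%:R)))).
  apply: ler_wsum => q _; rewrite -mulr_sumr -!mulrDr ler_wpM2l ?walker_wt_ge0 //.
  rewrite /ok; case: (q.2 \in q.1) => /=; first by rewrite lerDl addr_ge0 // sumr_ge0.
  case: (heavy q.2) => /=; first by rewrite add0r lerDl sumr_ge0.
  rewrite !add0r; elim: (acc) => [|q' acc' IH]; first by rewrite big_nil.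
  rewrite big_cons /=; case: (apart q q') => /=; first by rewrite add0r.
  by rewrite lerDl sumr_ge0.
rewrite wsumD wsumD wsum_sum addrA lerD //; first exact: lerD own_return heavy_mass.
apply: (@le_trans _ _ (\sum_(q' <- acc) (m.+1%:R * ka + kb))); last first.
  rewrite big_const_seq count_predT iter_addr_0 -[leLHS]mulr_natl ler_wpM2r //.
    by rewrite addr_ge0 ?mulr_ge0 // ltW.
  by rewrite ler_nat.
rewrite big_seq [leRHS]big_seq; apply: ler_sum => q' /(allP la)/andP[hq' /eqP sq'].
apply: (@le_trans _ _ (wsum (fun q =>
   (\sum_(v <- q'.2 :: q'.1) w q * (q.2 == v)%:R) + w q * (hits q'.2 q)%:R))).
  apply: ler_wsum => q _; rewrite -mulr_sumr -mulrDr ler_wpM2l ?walker_wt_ge0 //.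
  have mem_sum (l : seq 'I_n) : (q.2 \in l)%:R <= \sum_(v <- l) (q.2 == v)%:R :> R.
    elim: l => [|v l IH]; first by rewrite big_nil.
    rewrite big_cons inE; case: eqP => /= _; last by rewrite add0r.
    by rewrite lerDl sumr_ge0.
  apply: le_trans (lerD (mem_sum _) (lexx _)); rewrite -natrD ler_nat /apart inE /hits.
  by case: (_ == _); case: (_ \in _); case: (_ \in _).
rewrite wsumD lerD //; last by rewrite leNgt.
rewrite wsum_sum; apply: (@le_trans _ _ (\sum_(v <- q'.2 :: q'.1) ka)).
  by apply: ler_sum => v _; exact: atom_le_ka.
by rewrite big_const_seq count_predT iter_addr_0 -[leLHS]mulr_natl /= sq'.
Qed.

(* The walkers are chosen one after the other; a walker that is not fresh with
   respect to the previous ones costs at most [loss]. *)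
Lemma greedy (phi : 'I_n -> R) (c : R) : 0 <= c ->
  (forall y, 0 <= phi y <= 1) ->
  c + loss <= wsum (fun q => w q * phi (s q.2)) ->
  c ^+ k <= ksum k (fun l =>
    (fresh l)%:R * \prod_(q <- l) (w q * phi (s q.2))) [::].
Proof.
move=> c0 phi01 cG.
pose F l := \prod_(q <- l) (w q * phi (s q.2)).
have F0 l : 0 <= F l.
  apply: prodr_ge0 => q _; rewrite mulr_ge0 ?walker_wt_ge0 //.
  by have /andP[] := phi01 (s q.2).
suff H j acc : (size acc + j <= k)%N -> light acc -> fresh acc ->
    c ^+ j * F acc <= ksum j (fun l => (fresh l)%:R * F l) acc.
  by have := H k [::] (leqnn _) isT isT; rewrite /F big_nil mulr1.
elim: j acc => [|j IH] acc sj la fa /=; first by rewrite fa.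
have ge0 i l : 0 <= ksum i (fun l => (fresh l)%:R * F l) l.
  elim: i l => [|i IHi] l /=; first by rewrite mulr_ge0.
  by apply: wsum_ge0 => q _; exact: IHi.
apply: (@le_trans _ _ (wsum (fun q =>
   c ^+ j * F acc * (w q * phi (s q.2) * (ok acc q)%:R)))); last first.
  apply: ler_wsum => q sq; case: (boolP (ok acc q)) => okq; last first.
    by rewrite !mulr0.
  have /and3P[qq hq aq] := okq.
  have := IH (q :: acc); rewrite /= hq sq eqxx la qq aq fa => H.
  rewrite mulr1; apply: le_trans (H _ isT isT); last by rewrite addSnnS.
  by rewrite /F big_cons le_eqVlt; apply/orP; left; apply/eqP; ring.
rewrite wsumZl exprS mulrAC mulrC -mulrA ler_wpM2l ?exprn_ge0 // mulrC.
rewrite ler_wpM2l // -(lerD2r loss); apply: le_trans cG _.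
rewrite -lerBlDl -[X in _ - X]mul1r -mulNr -wsumZl -wsumD.
apply: le_trans (ok_mass la _); last by rewrite (leq_trans _ sj) // leq_addr.
apply: ler_wsum => q _; have /andP[p0 p1] := phi01 (s q.2).
have w0 := walker_wt_ge0 s z q.
case: (ok acc q) => /=; rewrite !(mulr0, mulr1) ?mulN1r ?subrr ?addr0 //.
by rewrite ler_piMr.
Qed.

End Quenched.

Lemma dist_wsum s t z : dist P s (m.+1 + t) z <=
  wsum (fun q => walker_wt s z q * dist P s t (s q.2)).
Proof.
apply: le_trans (dist_add P_bis _ _ _ _) _.
rewrite -(sum_endpoint P s m.+1 z (dist P s t)) -addn1 psum_cat.
apply: ler_psum => p _ /=; apply: ler_sum => u _.
by rewrite wt_cat endpoint_cat /= mulr1.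
Qed.

Section Annealed.
Variables (t k M : nat) (th rho1 rho2 : R).
Hypotheses (th_gt0 : 0 < th) (th_le1 : th <= 1).
Hypothesis Mkm : (M + k + k * m <= n)%N.
Hypothesis th_big :
  n%:R * (rho1 + rho2) + 6 * k%:R * t%:R ^+ 2 <= n%:R * th ^+ 2.

(** Unlike the distance at a given point, these averages are stable when a few images are
    redirected; Markov's inequality makes them small for most permutations. *)
Definition balanced s :=
  (\sum_z dist P s t z <= n%:R * rho1) && (\sum_z reach P s t z z <= n%:R * rho2).

Let t_le_sqr : t%:R <= t%:R ^+ 2 :> R.
Proof. by rewrite -natrX ler_nat; case: (t) => // t'; rewrite leq_pmulr. Qed.

(** If some redirection is balanced, then so is [s] up to an error, as the two differ at no more
    than [2 * k] points. The distances after any redirection are then bounded through [s] alone, by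
    its distances and its expected visits to redirected points. *)
Lemma redirected_product s us : size us = k ->
  psum k (fun zs => (balanced (redirects s us zs))%:R *
    \prod_(z <- zs) dist P (redirects s us zs) t z) <= (4 * n%:R * th) ^+ k.
Proof.
move=> sus; have [[zs0 [szs0 bal]]|nobal] :=
    pselect (exists zs, size zs = k /\ balanced (redirects s us zs)); last first.
  apply: (@le_trans _ _ (psum k (fun _ : seq 'I_n => 0))).
    apply: ler_psum => zs szs; case: (boolP (balanced _)) => b; rewrite ?mul0r //.
    by case: nobal; exists zs.
  by rewrite psum_cst mulr0 exprn_ge0 // !mulr_ge0 // ltW.
(* Visits from [z] to itself belong to [psi], because [z] is one of the redirected targets; visits
   to the other targets form the interaction. *)
pose psi z := dist P s t z + reach P s t z z + \sum_(u <- us) reach P s t z (s u).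
have psi0 z : 0 <= psi z.
  by rewrite !addr_ge0 ?dist_ge0 ?reach_ge0 // sumr_ge0 // => u _; exact: reach_ge0.
have sumr_reach (l : seq 'I_n) (f : 'I_n -> 'I_n) :
    \sum_z \sum_(y <- l) reach P s t z (f y) = (size l)%:R * t%:R.
  rewrite exchange_big /= (eq_bigr (fun=> t%:R)) => [|y _]; last exact: reach_col.
  by rewrite big_const_seq count_predT iter_addr_0 mulr_natl.
(* The 6: carrying balance from the redirection back to [s] costs [2 k t] for the distances and
   [2 k t^2] for the returns, and [us] and [l] add at most [k t] each. *)
have avg (l : seq 'I_n) : (size l <= k)%N ->
    \sum_z Num.min 1 (psi z + \sum_(y <- l) reach P s t z y) <=
    #|'I_n|%:R * th ^+ 2.
  move=> lk; rewrite card_ord; apply: le_trans th_big.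
  apply: (@le_trans _ _ (\sum_z (psi z + \sum_(y <- l) reach P s t z y))).
    by apply: ler_sum => z _; rewrite ge_min lexx orbT.
  rewrite !big_split /= (sumr_reach l id) sumr_reach sus.
  have off := @agree_off_redirects _ s us zs0.
  have sK : size (us ++ map (s^-1)%g zs0) = (2 * k)%N.
    by rewrite size_cat size_map sus szs0 mul2n addnn.
  have /andP[bal1 bal2] := bal.
  have offs : agree_off (redirects s us zs0) s (us ++ map (s^-1)%g zs0).
    by move=> u /off.
  have := sum_dist_perturb P_bis t offs; have := sum_reach_perturb P_bis t off.
  rewrite sK natrM => H1 H2.
  have kt : k%:R * t%:R <= k%:R * t%:R ^+ 2 :> R by rewrite ler_wpM2l.
  have lt : (size l)%:R * t%:R <= k%:R * t%:R ^+ 2 :> R.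
    by apply: le_trans kt; rewrite ler_wpM2r // ler_nat.
  lra.
apply: le_trans (_ : _ <= psum k (interaction psi (reach P s t) [::])) _; last first.
  have := sum_interaction psi0 (reach_ge0 P_bis s t) th_gt0 th_le1 avg (leqnn k).
  by rewrite card_ord.
have int0 (acc l : seq 'I_n) : 0 <= interaction psi (reach P s t) acc l.
  have sr0 (l' : seq 'I_n) y : 0 <= \sum_(y' <- l') reach P s t y y'.
    by apply: sumr_ge0 => u _; exact: reach_ge0.
  elim: l acc => //= y l IH acc; rewrite mulr_ge0 // le_min ler01 /=.
  by rewrite addr_ge0 // addr_ge0.
apply: ler_psum => zs szs; case: (balanced _); rewrite ?mul0r // mul1r.
set s' := redirects s us zs.
have dle z : dist P s' t z <= dist P s t z + \sum_(u <- us) reach P s t z (s u) +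
    \sum_(y <- zs) reach P s t z y.
  apply: le_trans (dist_perturb P_bis t z (@agree_off_redirects _ s us zs)) _.
  rewrite big_cat /= addrA lerD2l big_map le_eqVlt; apply/orP; left; apply/eqP.
  by apply: eq_bigr => y _; rewrite permKV.
suff H (acc l : seq 'I_n) : (forall z, dist P s' t z <= dist P s t z +
     \sum_(u <- us) reach P s t z (s u) +
     (\sum_(y <- acc) reach P s t z y + \sum_(y <- l) reach P s t z y)) ->
    \prod_(z <- l) dist P s' t z <= interaction psi (reach P s t) acc l.
  by apply: H => z; rewrite big_nil add0r.
elim: l acc => [|y l IH] acc Hd; first by rewrite big_nil.
rewrite big_cons /= ler_pM ?dist_ge0 //.
- by apply: prodr_ge0 => z _; exact: dist_ge0.
- rewrite le_min dist_le1 //=; apply: le_trans (Hd y) _.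
  by rewrite big_cons /psi; lra.
- apply: IH => z; apply: le_trans (Hd z) _.
  by rewrite !big_cons; lra.
Qed.

(* Fresh last jumps may be redirected to arbitrary points [zs] without changing
   the walkers; on average the product of the distances from [zs] is small. *)
Lemma fresh_walkers z :
  M%:R ^+ k * \sum_s (balanced s)%:R * ksum k (fun l =>
    (fresh l)%:R * \prod_(q <- l) (walker_wt s z q * dist P s t (s q.2))) [::] <=
  (n`!)%:R * (4 * n%:R * th) ^+ k.
Proof.
pose W s l := \prod_(q <- l) walker_wt s z q.
have W0 s l : 0 <= W s l by apply: prodr_ge0 => q _; exact: walker_wt_ge0.
under eq_bigr do rewrite mulrC -ksumZr.
rewrite -ksum_sum mulrC -ksumZr.
apply: (@le_trans _ _ (ksum k (fun l =>
   \sum_s W s l * (4 * n%:R * th) ^+ k) [::])); last first.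
  rewrite ksum_sum; under eq_bigr do rewrite ksumZr ksum_walker_wt big_nil mul1r.
  by rewrite sumr_const [leRHS]mulr_natl -(card_Sn n).
have C0 : 0 <= (4 * n%:R * th) ^+ k by rewrite exprn_ge0 // !mulr_ge0 // ltW.
apply: ler_ksum => // l sl; rewrite addn0 => szl.
have [fl|_] := boolP (fresh l); last first.
  rewrite big1 ?mul0r; first by apply: sumr_ge0 => s _; rewrite mulr_ge0.
  by move=> s _; rewrite !mul0r.
pose us := map snd l; pose S := flatten (map fst l).
have sus : size us = k by rewrite size_map.
pose H s zs := (balanced s)%:R * \prod_(y <- zs) dist P s t y.
have sS : size S = (k * m)%N.
  rewrite /S -szl; elim: (l) sl => //= q l' IH /andP[/eqP sq /IH sl'].
  by rewrite size_cat sl' sq mulSn.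
have WS s s' : {in S, s =1 s'} -> W s l = W s' l.
  rewrite /W /S; elim: (l) => [|q l' IH] /= ss'; first by rewrite !big_nil.
  rewrite !big_cons IH; last by move=> v vl; rewrite ss' // mem_cat vl orbT.
  congr (_ * _); rewrite /walker_wt.
  have qs : {in q.1, s =1 s'} by move=> v vq; rewrite ss' // mem_cat vq.
  have -> : endpoint s z q.1 = endpoint s' z q.1.
    by rewrite /endpoint; congr last; apply/eq_in_map.
  congr (_ * _); elim: (q.1) (z) qs => //= v p IHp x qs.
  rewrite qs ?mem_head // IHp // => v' v'p; apply: qs.
  by rewrite inE v'p orbT.
have H0 s zs : 0 <= H s zs.
  by rewrite mulr_ge0 // prodr_ge0 // => y _; exact: dist_ge0.
have Mn : (M + size us + size S <= n)%N by rewrite sus sS.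
have := redirects_sum Mn (fresh_uniq fl) (fun s => W0 s l) H0 WS.
rewrite sus => HH; rewrite mulrC.
apply: le_trans (le_trans HH _); last first.
  apply: ler_sum => s _; rewrite ler_wpM2l //; exact: redirected_product.
rewrite ler_wpM2l ?exprn_ge0 // le_eqVlt; apply/orP; left; apply/eqP.
apply: eq_bigr => s _; rewrite /H /W mul1r big_split /= /us !big_map.
by rewrite mulrC mulrA [_ * (balanced s)%:R]mulrC mulrA.
Qed.

End Annealed.

End Walkers.

(** * Annealed collision estimates *)

Section FewWalkers.
Variables (R : realType) (n : nat) (P : 'M[R]_n).
Hypothesis P_bis : bistochastic P.
Variables (L : nat) (al : R).
Hypotheses (L_le_n : (L <= n)%N) (al_ge0 : 0 <= al).
Hypothesis danger_small : forall x h, (size h < L)%N ->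
  #|danger P x h|%:R <= al * (n - size h)%:R.
Implicit Types (s : 'S_n) (x y z u v : 'I_n) (a b : seq 'I_n).
Implicit Types (h : seq ('I_n * 'I_n)).

Local Notation coll x := (collisions (danger P x)).

Lemma agrees_catrev s a h : agrees s h -> agrees s (catrev (graph s a) h).
Proof. by elim: a h => //= u a IH h sh; apply: IH; rewrite /= eqxx. Qed.

Lemma unzip2_catrev s a h : unzip2 (catrev (graph s a) h) = catrev (map s a) (unzip2 h).
Proof. by elim: a h => //= u a IH h; rewrite IH. Qed.

Lemma mem_catrev (T : eqType) (a b : seq T) : catrev a b =i a ++ b.
Proof. by move=> y; rewrite catrevE !mem_cat mem_rev. Qed.

Lemma not_clean_mass t z : (t <= L)%N ->
  \sum_s psum t (fun a => wt P s z a * (~~ clean P z (map s a))%:R) <=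
  (n`!)%:R * (t%:R * al).
Proof.
move=> tL; apply: (@le_trans _ _ (sum_agree [::] (fun s => psum t (fun a =>
   wt P s z a * (0 < coll z (catrev (graph s a) [::]))%N%:R)))).
  rewrite sum_agree_nil; apply: ler_sum => s _; apply: ler_psum => a sa.
  rewrite ler_wpM2l ?wt_ge0 // ler_nat; case: (posnP (coll _ _)) => [c0|_].
    have := no_collision P_bis (@agrees_catrev s a [::] isT) c0.
    rewrite unzip2_catrev /= => cl; rewrite (clean_sub _ cl) // => y.
    by rewrite mem_catrev cats0.
  by case: clean.
have base : forall (x' : 'I_n) h', size h' = (size (Nil ('I_n * 'I_n)) + t)%N ->
    sum_agree h' (fun=> (0 < coll z h')%N%:R) <=
    count_agree R h' * (0%:R * al) ^+ (1 - coll z h').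
  by move=> x' h' _; exact: collision_base.
have := collision_walk al_ge0 L_le_n (danger_small z) P_bis z
  (m := t) (h := [::]) (K := fun _ _ h => (0 < coll z h)%N%:R) tL base.
by rewrite count_agree_nil /= subn0 expr1 add0n.
Qed.

(** A return to [z] after at least one step makes the walk unclean; each of the [t] times is paid
    separately. *)
Lemma reach_self_mass t z : (t <= L)%N ->
  \sum_s reach P s t z z <= (n`!)%:R * (t%:R ^+ 2 * al).
Proof.
move=> tL; rewrite exchange_big /=.
apply: (@le_trans _ _ (\sum_(i < t) (n`!)%:R * (t%:R * al))); last first.
  by rewrite sumr_const card_ord -[leLHS]mulr_natl mulrCA expr2 !mulrA.
apply: ler_sum => i _; have iL : (i.+1 <= L)%N := leq_trans (ltn_ord i) tL.
apply: le_trans (_ : _ <= (n`!)%:R * (i.+1%:R * al)) _; last first.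
  by rewrite ler_wpM2l // ler_wpM2r // ler_nat.
apply: le_trans (not_clean_mass z iL); apply: ler_sum => s _.
rewrite qpow_psum; apply: ler_psum => a sa; rewrite ler_wpM2l ?wt_ge0 // ler_nat.
case: eqP => //= az; rewrite (_ : clean _ _ _ = false) //; apply/negP.
case/cleanP => /negP[]; rewrite -{1}az /endpoint.
by case: a sa {az} => //= u a _; exact: mem_last.
Qed.

Lemma two_collisions_mass t z : (t + t <= L)%N ->
  \sum_s psum t (fun a => psum t (fun b => wt P s z a * wt P s z b *
    (1 < coll z (catrev (graph s b) (catrev (graph s a) [::])))%N%:R)) <=
  (n`!)%:R * ((t + t)%:R * al) ^+ 2.
Proof.
move=> tL; pose K s h := psum t (fun b => wt P s z b *
   (1 < coll z (catrev (graph s b) h))%N%:R).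
rewrite (eq_bigr (fun s => psum t (fun a => wt P s z a *
   K s (catrev (graph s a) [::])))); last first.
  move=> s _; apply: eq_psum => a _; rewrite -psumZl.
  by apply: eq_psum => b _; rewrite mulrA.
rewrite -sum_agree_nil.
have tL' : (size (Nil ('I_n * 'I_n)) + t <= L)%N.
  by apply: leq_trans tL; rewrite leq_addr.
have base : forall (x' : 'I_n) h', size h' = (size (Nil ('I_n * 'I_n)) + t)%N ->
    sum_agree h' (fun s => K s h') <=
    count_agree R h' * (t%:R * al) ^+ (2 - coll z h').
  move=> x' h' sh'; rewrite -[X in X%:R * al]add0n.
  apply: (collision_walk al_ge0 L_le_n (danger_small z) P_bis z
    (K := fun _ _ h => (1 < coll z h)%N%:R)); first by rewrite sh'.
  by move=> x'' h'' _; exact: collision_base.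
have := collision_walk al_ge0 L_le_n (danger_small z) P_bis z
  (m := t) (h := [::]) (K := fun s _ h => K s h) tL' base.
by rewrite count_agree_nil.
Qed.

(** Two walkers from each child, explored as one tree below [x]. By [one_child_clean], a collision
    below both children requires two collisions in that tree. *)
Lemma two_children_mass m x u u' : (4 * m + 2 <= L)%N ->
  0 < P x u -> 0 < P x u' -> u != u' ->
  \sum_s chi P m s (s u) * chi P m s (s u') <=
  (n`!)%:R * ((4 * m + 2)%:R * al) ^+ 2.
Proof.
move=> mL Pu Pu' uu'.
(* The order of exploration is [u], [a], [b], [u'], [c], [d], which makes [4 * m + 2] queries. Each
   [K] is what remains from one stage on, so the definitions run backwards. *)
pose ind h : R := (1 < coll x h)%N%:R.
pose K4 X s h := psum m (fun d => wt P s X d * ind (catrev (graph s d) h)).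
pose K3 X s h := psum m (fun c => wt P s X c * K4 X s (catrev (graph s c) h)).
pose K2 s h := K3 (s u') s ((u', s u') :: h).
pose K1 X s h := psum m (fun b => wt P s X b * K2 s (catrev (graph s b) h)).
pose K0 X s h := psum m (fun a => wt P s X a * K1 X s (catrev (graph s a) h)).
have le1 s : chi P m s (s u) * chi P m s (s u') <= K0 (s u) s [:: (u, s u)].
  rewrite /chi -psumZr; apply: ler_psum => a sa.
  rewrite -psumZr -psumZl; apply: ler_psum => b sb.
  rewrite -!psumZl /K2; apply: ler_psum => c sc.
  rewrite -!psumZl; apply: ler_psum => d sd.
  have w0 y e : wt P s y e = 0 \/ 0 < wt P s y e.
    have := wt_ge0 P_bis s y e; rewrite le_eqVlt => /orP[/eqP<-|]; by [left|right].
  have [->|wa] := w0 (s u) a; first by rewrite !mul0r.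
  have [->|wb] := w0 (s u) b; first by rewrite !(mul0r, mulr0).
  have [->|wc] := w0 (s u') c; first by rewrite !(mul0r, mulr0).
  have [->|wd] := w0 (s u') d; first by rewrite !(mul0r, mulr0).
  rewrite /ind; set h5 := catrev (graph s d) _.
  have h5s : agrees s h5.
    by do 2 apply: agrees_catrev; rewrite /= eqxx; do 2 apply: agrees_catrev;
      rewrite /= eqxx.
  suff bad : ((~~ clean P (s u) (map s a ++ map s b) : nat) *
       (~~ clean P (s u') (map s c ++ map s d)) <= (1 < coll x h5))%N.
    rewrite [leLHS](_ : _ = wt P s (s u) a * (wt P s (s u) b * (wt P s (s u') c *
       (wt P s (s u') d * ((~~ clean P (s u) (map s a ++ map s b) : nat) *
       (~~ clean P (s u') (map s c ++ map s d)))%N%:R)))); last first.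
      by rewrite natrM; ring.
    by do 4 rewrite ler_wpM2l ?wt_ge0 //; rewrite ler_nat.
  case: (ltnP 1 (coll x h5)) => [_|c1]; first by do 2 case: clean.
  have [W sep] := one_collision P_bis h5s c1.
  have bt v e f : 0 < wt P s (s v) e -> 0 < wt P s (s v) f ->
      backtracks P s (s v) (catrev f (catrev e [::])).
    move=> we wf.
    have b1 : backtracks P s (s v) (catrev e [::]).
      by apply: (backtracks_walk P_bis (z := s v)) => //=; rewrite mem_head.
    by apply: (backtracks_walk P_bis (z := s v)) => //=; rewrite mem_head.
  have memV y : y \in unzip2 h5 = (y \in map s d) || ((y \in map s c) ||
      ((y == s u') || ((y \in map s b) || ((y \in map s a) || (y == s u))))).
    by rewrite /h5 !unzip2_catrev /= !(mem_catrev, mem_cat, inE, unzip2_catrev).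
  have memL y e f : y \in map s (catrev f (catrev e [::])) =
      (y \in map s e ++ map s f).
    apply/mapP/idP => [[v]|].
      rewrite !mem_catrev !mem_cat !mem_catrev cats0 => ve ->.
      by case/orP: ve => /(map_f s) ->; rewrite ?orbT.
    by rewrite mem_cat => /orP[] /mapP[v ve ->]; exists v => //;
      rewrite !mem_catrev !mem_cat !mem_catrev cats0 ve ?orbT.
  have sub1 : {subset s u :: map s (catrev b (catrev a [::])) <= unzip2 h5}.
    by move=> y; rewrite inE memL memV mem_cat => /or3P[] ->; rewrite ?orbT.
  have sub2 : {subset s u' :: map s (catrev d (catrev c [::])) <= unzip2 h5}.
    by move=> y; rewrite inE memL memV mem_cat => /or3P[] ->; rewrite ?orbT.
  have := one_child_clean Pu Pu' uu' sep (bt u a b wa wb) (bt u' c d wc wd) sub1 sub2.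
  case/orP => cl.
    by rewrite (clean_sub _ cl) // => y; rewrite memL.
  have -> : clean P (s u') (map s c ++ map s d).
    by apply: clean_sub cl => y; rewrite memL.
  by rewrite muln0.
apply: le_trans (ler_sum _ (fun s _ => le1 s)) _; rewrite -sum_agree_nil.
have -> : (4 * m + 2)%N = (m + m + m + m).+2 by lia.
have mL' : ((m + m + m + m).+2 <= L)%N by lia.
rewrite -count_agree_nil.
have step := @collision_step R n (danger P x) L 2 al al_ge0 L_le_n (danger_small x).
have walk := @collision_walk R n (danger P x) L 2 al al_ge0 L_le_n (danger_small x) P P_bis.
apply: (step _ _ _ (fun s X => K0 X s [:: (u, X)])) => //=; first lia.
move=> X; rewrite -[X in sum_agree _ X <= _]/(fun s => K0 X s [:: (u, X)]).
have E (i : nat) : (m + m + m + m).+1 = ((m + m + m).+1 + m)%N by lia.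
rewrite (E 0%N); apply: (walk _ _ _ _ (fun s _ h => K1 X s h)) => /=; first lia.
move=> _ h1 sh1; have -> : (m + m + m).+1 = ((m + m).+1 + m)%N by lia.
apply: (walk _ _ _ _ (fun s _ h => K2 s h)); first by rewrite sh1; lia.
move=> _ h2 sh2; apply: (step _ _ _ (fun s X' => K3 X' s ((u', X') :: h2))).
  by rewrite sh2 sh1; lia.
move=> X'; apply: (walk _ _ _ _ (fun s _ h => K4 X' s h)).
  by rewrite /= sh2 sh1; lia.
move=> _ h3 sh3; rewrite -[X in X%:R * al]add0n.
apply: (walk _ _ _ _ (fun s _ h => ind h)); first by rewrite sh3 /= sh2 sh1; lia.
by move=> _ h4 _; exact: collision_base.
Qed.

End FewWalkers.

(** * Averages over independent images *)

Section Averages.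
Variables (R : realType) (n : nat) (P : 'M[R]_n).
Hypothesis P_bis : bistochastic P.
Implicit Types (s : 'S_n) (x y z u v X : 'I_n) (us a b c A B E Xs : seq 'I_n).

(** The images are a free list here, to be averaged as independent uniform variables. The default of
    [head] is never read when [us] and [Xs] have the same length. *)
Fixpoint wtl x us Xs : R :=
  if us is u :: us' then P x u * wtl (head x Xs) us' (behead Xs) else 1.

Lemma wt_wtl s x us : wt P s x us = wtl x us (map s us).
Proof. by elim: us x => //= u us IH x; rewrite IH. Qed.

Lemma wtl_ge0 x us Xs : 0 <= wtl x us Xs.
Proof. by elim: us x Xs => //= u us IH x Xs; rewrite mulr_ge0 ?P_ge0. Qed.

Lemma sum_row_const (c : R) : \sum_x \sum_u P x u * c = n%:R * c.
Proof.
under eq_bigr => x _ do rewrite -mulr_suml row_sum // mul1r.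
by rewrite sumr_const card_ord -[LHS]mulr_natl.
Qed.

Section Deviation.
Variables (e : 'I_n -> 'I_n -> R) (v : R).
Hypothesis e_mean : \sum_x \sum_u P x u * e x u = 0.
Hypothesis e_var : \sum_x \sum_u P x u * e x u ^+ 2 = n%:R * v.

Fixpoint cost s x us : R :=
  if us is u :: us' then e x u + cost s (s u) us' else 0.

Fixpoint costl x us Xs : R :=
  if us is u :: us' then e x u + costl (head x Xs) us' (behead Xs) else 0.

Lemma cost_costl s x us : cost s x us = costl x us (map s us).
Proof. by elim: us x => //= u us IH x; rewrite IH. Qed.

(** From a uniform start every state is uniform and independent of the past, and [e] is centred, so
    cross terms vanish and variances add. The shift [c] carries the accumulated cost through the
    induction. *)
Lemma iid_variance t (c : R) :
  \sum_x psum t (fun us => psum t (fun Xs =>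
     wtl x us Xs * (c + costl x us Xs) ^+ 2)) =
  n%:R ^+ t * (n%:R * (c ^+ 2 + t%:R * v)).
Proof.
elim: t c => [|t IH] c /=.
  under eq_bigr => x _ do rewrite mul1r addr0.
  by rewrite sumr_const card_ord -[LHS]mulr_natl mul0r addr0 mul1r.
have E x u : psum t (fun us => \sum_X psum t (fun Xs =>
    P x u * wtl X us Xs * (c + (e x u + costl X us Xs)) ^+ 2)) =
    P x u * (n%:R ^+ t * (n%:R * ((c + e x u) ^+ 2 + t%:R * v))).
  rewrite -IH mulr_sumr psum_sum; apply: eq_bigr => X _.
  rewrite -psumZl; apply: eq_psum => us _.
  by rewrite -psumZl; apply: eq_psum => Xs _; rewrite addrA mulrA.
under eq_bigr => x _ do under eq_bigr => u _ do rewrite E.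
rewrite (eq_bigr (fun x => \sum_u (P x u * (n%:R ^+ t * n%:R * (c ^+ 2 + t%:R * v)) +
   (n%:R ^+ t * n%:R * 2 * c * (P x u * e x u) +
    n%:R ^+ t * n%:R * (P x u * e x u ^+ 2))))); last first.
  move=> x _; apply: eq_bigr => u _.
  by move: (n%:R ^+ t) (t%:R * v) (e x u) => k w e'; ring.
under eq_bigr do rewrite !big_split /= -!mulr_sumr.
rewrite !big_split /= -!mulr_sumr sum_row_const e_mean e_var mulr0 add0r.
by rewrite (exprS n%:R) -natr1; move: (n%:R ^+ t) => k; ring.
Qed.

Lemma walk_variance L t : (L < n)%N -> (t <= L)%N ->
  \sum_z \sum_s psum t (fun a =>
    wt P s z a * (uniq a)%:R * cost s z a ^+ 2) <=
  (n`!)%:R * n%:R * ((n%:R / (n - L)%:R) ^+ t * (t%:R * v)).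
Proof.
move=> Ln tL; have nL : 0 < (n - L)%:R :> R by rewrite ltr0n subn_gt0.
pose F z a Xs := wtl z a Xs * (0 + costl z a Xs) ^+ 2.
have F0 z a Xs : 0 <= F z a Xs by rewrite mulr_ge0 ?wtl_ge0 ?sqr_ge0.
apply: (@le_trans _ _ (\sum_z psum t (fun a =>
   (n`!)%:R * (n - L)%:R ^- t * psum t (F z a)))).
  apply: ler_sum => z _; rewrite -psum_sum; apply: ler_psum => a sa.
  have [Ua|_] := boolP (uniq a); last first.
    rewrite big1 => [|s _]; last by rewrite mulr0 mul0r.
    by rewrite !mulr_ge0 ?invr_ge0 ?exprn_ge0 // psum_ge0.
  apply: le_trans (_ : _ <= \sum_s F z a (map (s : 'S_n) a)) _.
    by apply: ler_sum => s _; rewrite /F add0r -wt_wtl -cost_costl mulr1.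
  have := sum_perm_le_iid Ln (_ : (size a <= L)%N) Ua (F0 z a).
  rewrite sa => /(_ tL) H; apply: le_trans H _.
  rewrite ler_wpM2l ?mulr_ge0 ?invr_ge0 ?exprn_ge0 //.
  by apply: ler_psum => Xs _; case: uniq; rewrite ?mul1r ?mul0r.
under eq_bigr do rewrite psumZl.
rewrite -mulr_sumr iid_variance expr0n /= add0r expr_div_n.
by rewrite le_eqVlt; apply/orP; left; apply/eqP; move: (n%:R ^+ t) => k; ring.
Qed.

End Deviation.

(** Probability that two independent choices from a common uniform state agree. *)
Definition collision_prob : R := n%:R^-1 * \sum_x \sum_u P x u ^+ 2.

Local Notation q := collision_prob.

Lemma n_collision_prob : n%:R * q = \sum_x \sum_u P x u ^+ 2.
Proof.
rewrite mulrA; have [n0|n0] := eqVneq (n%:R : R) 0; last by rewrite divff // mul1r.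
rewrite n0 !mul0r; move/eqP: n0; rewrite pnatr_eq0 => /eqP n0.
by rewrite big1 // => x; have := ltn_ord x; rewrite {2}n0.
Qed.

Lemma collision_prob_ge0 : 0 <= q.
Proof.
rewrite mulr_ge0 ?invr_ge0 //; apply: sumr_ge0 => x _; apply: sumr_ge0 => u _.
exact: sqr_ge0.
Qed.

Lemma collision_prob_le1 : q <= 1.
Proof.
have [n0|n0] := posnP n.
  rewrite /collision_prob big1 ?mulr0 // => x.
  by have := ltn_ord x; rewrite {2}n0.
rewrite -(ler_pM2l (_ : 0 < n%:R)) ?ltr0n // n_collision_prob mulr1.
apply: (@le_trans _ _ (\sum_x \sum_u P x u * 1)); last first.
  by rewrite sum_row_const mulr1.
apply: ler_sum => x _; apply: ler_sum => u _.
by rewrite expr2 ler_wpM2l ?P_ge0 ?P_le1.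
Qed.

(* In the four lemmas below the images are independent and uniform, up to
   the normalisation by powers of [n]. *)
Lemma squares_sum r (g : 'I_n -> R) :
  \sum_x psum r (fun c => psum r (fun Xs => wtl x c Xs ^+ 2 * g (last x Xs))) =
  (n%:R * q) ^+ r * \sum_x g x.
Proof.
elim: r => [|r IH] /=; first by rewrite mul1r; apply: eq_bigr => x _; rewrite expr1n mul1r.
have E x u : psum r (fun c => \sum_X psum r (fun Xs =>
    (P x u * wtl X c Xs) ^+ 2 * g (last X Xs))) =
    P x u ^+ 2 * ((n%:R * q) ^+ r * \sum_y g y).
  rewrite -IH mulr_sumr psum_sum; apply: eq_bigr => X _.
  rewrite -psumZl; apply: eq_psum => c _.
  by rewrite -psumZl; apply: eq_psum => Xs _; rewrite exprMn mulrA.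
under eq_bigr => x _ do under eq_bigr => u _ do rewrite E.
under eq_bigr do rewrite -mulr_suml.
by rewrite -mulr_suml -n_collision_prob exprS mulrA.
Qed.

Lemma free_sum r (g : 'I_n -> R) :
  \sum_x psum r (fun c => psum r (fun Xs => wtl x c Xs * g (last x Xs))) =
  n%:R ^+ r * \sum_x g x.
Proof.
elim: r => [|r IH] /=; first by rewrite mul1r; apply: eq_bigr => x _; rewrite mul1r.
have E x u : psum r (fun c => \sum_X psum r (fun Xs =>
    P x u * wtl X c Xs * g (last X Xs))) =
    P x u * (n%:R ^+ r * \sum_y g y).
  rewrite -IH mulr_sumr psum_sum; apply: eq_bigr => X _.
  rewrite -psumZl; apply: eq_psum => c _.
  by rewrite -psumZl; apply: eq_psum => Xs _; rewrite mulrA.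
under eq_bigr => x _ do under eq_bigr => u _ do rewrite E.
by rewrite sum_row_const exprS mulrA.
Qed.

Definition overlap x y : R := \sum_u P x u * P y u.

Lemma common_sum r x y :
  psum r.+1 (fun E => psum r.+1 (fun Xs => wtl x E Xs * wtl y E Xs)) =
  overlap x y * ((n%:R * q) ^+ r * n%:R).
Proof.
have E1 u : psum r (fun c => \sum_X psum r (fun Xs =>
    P x u * wtl X c Xs * (P y u * wtl X c Xs))) =
    P x u * P y u * ((n%:R * q) ^+ r * n%:R).
  have := squares_sum r (fun=> 1); rewrite sumr_const card_ord => <-.
  rewrite mulr_sumr psum_sum; apply: eq_bigr => X _.
  rewrite -psumZl; apply: eq_psum => c _.
  by rewrite -psumZl; apply: eq_psum => Xs _; ring.
by rewrite /= (eq_bigr _ (fun u _ => E1 u)) -mulr_suml.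
Qed.

Lemma one_branch_sum d z x (w g : 'I_n -> R) :
  psum d.+1 (fun A => psum d.+1 (fun XA =>
    w (head z A) * g (last z XA) * wtl x A XA)) =
  (\sum_u w u * P x u) * (n%:R ^+ d * \sum_X g X).
Proof.
rewrite /= mulr_suml; apply: eq_bigr => u _.
rewrite -free_sum mulr_sumr psum_sum; apply: eq_bigr => X _.
rewrite -psumZl; apply: eq_psum => A _.
by rewrite -psumZl; apply: eq_psum => XA _; ring.
Qed.

(** Only the first step matters: two choices from [x] differ with probability
    [1 - \sum_u P x u ^+ 2], and from then on the images of both branches are uniform. *)
Lemma branch_sum d z x (f : 'I_n -> 'I_n -> R) :
  psum d.+1 (fun A => psum d.+1 (fun B => psum d.+1 (fun XA => psum d.+1 (fun XB =>
    (head z A != head z B)%:R * (wtl x A XA * wtl x B XB *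
      f (last z XA) (last z XB)))))) =
  (1 - \sum_u P x u ^+ 2) * (n%:R ^+ d * (n%:R ^+ d * \sum_X \sum_Y f X Y)).
Proof.
pose W u := \sum_u' (u != u')%:R * P x u'.
pose G X := n%:R ^+ d * \sum_Y f X Y.
have -> : (1 - \sum_u P x u ^+ 2) * (n%:R ^+ d * (n%:R ^+ d * \sum_X \sum_Y f X Y)) =
    (\sum_u W u * P x u) * (n%:R ^+ d * \sum_X G X).
  rewrite [in RHS]/G -mulr_sumr; congr (_ * _).
  rewrite -(row_sum P_bis x) -sumrB; apply: eq_bigr => u _.
  have -> : W u = 1 - P x u.
    apply: (addrI (P x u)); rewrite [RHS]addrC subrK.
    rewrite -[RHS](row_sum P_bis x) [RHS](bigD1 u) //=; congr (_ + _).
    rewrite /W (bigD1 u) //= eqxx mul0r add0r; apply: eq_bigr => u' u'u.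
    by rewrite eq_sym u'u mul1r.
  by rewrite mulrBl mul1r expr2.
rewrite -(one_branch_sum d z x W G); apply: eq_psum => A _.
rewrite psum_exchange; apply: eq_psum => XA _.
transitivity (psum d.+1 (fun B => psum d.+1 (fun XB =>
    (head z A != head z B)%:R * (wtl x A XA * f (last z XA) (last z XB)) *
    wtl x B XB))).
  by apply: eq_psum => B _; apply: eq_psum => XB _; ring.
rewrite (one_branch_sum d z x (fun u' => (head z A != u')%:R)
  (fun Y => wtl x A XA * f (last z XA) Y)).
by rewrite /W /G -mulr_sumr; ring.
Qed.

Lemma sum_perm_le_iid4 L c A B E (F : seq 'I_n -> seq 'I_n -> seq 'I_n ->
    seq 'I_n -> R) :
  (L < n)%N -> (size (c ++ A ++ B ++ E) <= L)%N -> uniq (c ++ A ++ B ++ E) ->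
  (forall Xc XA XB XE, 0 <= F Xc XA XB XE) ->
  \sum_(s : 'S_n) F (map s c) (map s A) (map s B) (map s E) <=
  (n`!)%:R * (n - L)%:R ^- size (c ++ A ++ B ++ E) *
  psum (size c) (fun Xc => psum (size A) (fun XA => psum (size B) (fun XB =>
    psum (size E) (fun XE =>
      (uniq (Xc ++ XA ++ XB ++ XE))%:R * F Xc XA XB XE)))).
Proof.
move=> Ln sL U F0.
pose G Xs := F (take (size c) Xs) (take (size A) (drop (size c) Xs))
  (take (size B) (drop (size A) (drop (size c) Xs)))
  (drop (size B) (drop (size A) (drop (size c) Xs))).
have GE a b d e : size a = size c -> size b = size A -> size d = size B ->
    G (a ++ b ++ d ++ e) = F a b d e.
  move=> sa sb sd.
  by rewrite /G !(take_size_cat, drop_size_cat) // -?sa -?sb -?sd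
    !(take_size_cat, drop_size_cat).
have := sum_perm_le_iid Ln sL U (fun Xs => F0 _ _ _ _ : 0 <= G Xs).
under eq_bigr do rewrite !map_cat GE ?size_map //.
rewrite !size_cat !psum_cat => H; apply: le_trans H _.
rewrite ler_wpM2l ?mulr_ge0 ?invr_ge0 ?exprn_ge0 //.
apply: ler_psum => a sa; rewrite psum_cat; apply: ler_psum => b sb.
rewrite psum_cat; apply: ler_psum => d sd; apply: ler_psum => e se.
by rewrite GE.
Qed.

Lemma psum_exchange2 i j k (F : seq 'I_n -> seq 'I_n -> seq 'I_n -> R) :
  psum i (fun a => psum j (fun b => psum k (fun c => F a b c))) =
  psum j (fun b => psum k (fun c => psum i (fun a => F a b c))).
Proof.
rewrite psum_exchange; apply: eq_psum => b _; exact: psum_exchange.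
Qed.

Lemma psum_exchange3 i j k l (F : seq 'I_n -> seq 'I_n -> seq 'I_n -> seq 'I_n -> R) :
  psum i (fun a => psum j (fun b => psum k (fun c => psum l (fun d => F a b c d)))) =
  psum l (fun d => psum i (fun a => psum j (fun b => psum k (fun c => F a b c d)))).
Proof.
transitivity (psum i (fun a => psum l (fun d => psum j (fun b => psum k (fun c => F a b c d))))).
  by apply: eq_psum => a _; rewrite [RHS]psum_exchange2.
exact: psum_exchange.
Qed.

Definition merge_wt s z c A B E := wt P s z (c ++ A ++ E) * wt P s z (c ++ B ++ E).

(** The common prefix gives [q ^+ al] and the parting [1 - q]. After uniform branches, the first
    common choice gives the overlap of two distinct states, on average a second [1 - q], and the
    rest of the suffix gives [q ^+ r]. *)
Lemma merge_sum L al d r z0 : (L < n)%N -> (al + d.+1 + d.+1 + r.+1 <= L)%N ->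
  \sum_z \sum_s psum al (fun c => psum d.+1 (fun A => psum d.+1 (fun B =>
    psum r.+1 (fun E =>
     ((head z0 A != head z0 B) && uniq (c ++ A ++ B ++ E))%:R *
     merge_wt s z c A B E)))) <=
  (n`!)%:R * (n%:R / (n - L)%:R) ^+ (al + d.+1 + d.+1 + r.+1) *
    ((q ^+ al * (1 - q)) * (q ^+ r * (1 - q))).
Proof.
move=> Ln sL; have nL : 0 < (n - L)%:R :> R by rewrite ltr0n subn_gt0.
have n0 : n%:R != 0 :> R by rewrite pnatr_eq0 -lt0n (leq_ltn_trans _ Ln).
set N := (al + _ + _ + _)%N in sL *.
(* Requiring distinct ends of the branches costs nothing, since distinct choices have distinct
   images. It removes the diagonal from the overlaps, which produces the second factor [1 - q]. *)
pose f X Y := (X != Y)%:R * overlap X Y.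
pose F z c A B E Xc XA XB XE := wtl z c Xc ^+ 2 *
  ((head z0 A != head z0 B)%:R * (wtl (last z Xc) A XA * wtl (last z Xc) B XB *
  ((last z0 XA != last z0 XB)%:R *
   (wtl (last z0 XA) E XE * wtl (last z0 XB) E XE)))).
have F0 z c A B E Xc XA XB XE : 0 <= F z c A B E Xc XA XB XE.
  by rewrite /F !mulr_ge0 ?wtl_ge0 ?sqr_ge0.
pose K : R := (n`!)%:R * (n - L)%:R ^- N.
have K0 : 0 <= K by rewrite mulr_ge0 // invr_ge0 exprn_ge0.
apply: (@le_trans _ _ (\sum_z psum al (fun c => psum d.+1 (fun A => psum d.+1 (fun B =>
    psum r.+1 (fun E => K *
   psum al (fun Xc => psum d.+1 (fun XA => psum d.+1 (fun XB =>
    psum r.+1 (F z c A B E Xc XA XB)))))))))).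
  apply: ler_sum => z _; rewrite -psum_sum; apply: ler_psum => c sc.
  rewrite -psum_sum; apply: ler_psum => A sA; rewrite -psum_sum.
  apply: ler_psum => B sB; rewrite -psum_sum; apply: ler_psum => E sE.
  have sN : size (c ++ A ++ B ++ E) = N by rewrite !size_cat sc sA sB sE /N !addnA.
  have rhs0 : 0 <= K * psum al (fun Xc => psum d.+1 (fun XA => psum d.+1 (fun XB =>
      psum r.+1 (F z c A B E Xc XA XB)))).
    rewrite mulr_ge0 //; do 4 (apply: psum_ge0 => ? _); exact: F0.
  have [hAB|] := boolP (head z0 A != head z0 B); last first.
    by rewrite big1 // => s _; rewrite mul0r.
  have [U|] := boolP (uniq (c ++ A ++ B ++ E)); last first.
    by rewrite big1 // => s _; rewrite mul0r.
  have := sum_perm_le_iid4 Ln (_ : (size (c ++ A ++ B ++ E) <= L)%N) U (F0 z c A B E).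
  rewrite sN sc sA sB sE => /(_ sL) H; apply: le_trans (le_trans H _); last first.
    rewrite ler_wpM2l //; do 4 (apply: ler_psum => ? _).
    by case: uniq; rewrite ?mul1r ?mul0r.
  apply: ler_sum => s _; rewrite mul1r /F hAB mul1r /merge_wt !wt_cat -!wt_wtl.
  have lastE D : size D = d.+1 -> last z0 (map s D) = endpoint s (endpoint s z c) D.
    by case: D.
  rewrite (lastE A) // (lastE B) // -/(endpoint s z c).
  have -> : endpoint s (endpoint s z c) A != endpoint s (endpoint s z c) B.
    rewrite -!lastE // !(last_nth z0) !size_map sA sB /=.
    rewrite !(nth_map z0) ?sA ?sB // (inj_eq perm_inj).
    move: U; rewrite catA cat_uniq => /and3P[_ + _]; apply: contraNneq => AB.
    apply/hasP; exists (nth z0 A d); last first.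
      by rewrite /= mem_cat mem_nth ?orbT // sA.
    by rewrite AB mem_cat mem_nth // sB.
  rewrite mul1r le_eqVlt; apply/orP; left; apply/eqP; ring.
have -> : \sum_z psum al (fun c => psum d.+1 (fun A => psum d.+1 (fun B =>
    psum r.+1 (fun E => K *
   psum al (fun Xc => psum d.+1 (fun XA => psum d.+1 (fun XB =>
    psum r.+1 (F z c A B E Xc XA XB)))))))) =
  K * \sum_z psum al (fun c => psum al (fun Xc => wtl z c Xc ^+ 2 *
    ((1 - \sum_u P (last z Xc) u ^+ 2) * (n%:R ^+ d * (n%:R ^+ d *
      (\sum_X \sum_Y f X Y * ((n%:R * q) ^+ r * n%:R))))))).
  rewrite mulr_sumr; apply: eq_bigr => z _; rewrite -psumZl.
  apply: eq_psum => c _.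
  have -> : psum d.+1 (fun A => psum d.+1 (fun B => psum r.+1 (fun E =>
      K * psum al (fun Xc => psum d.+1 (fun XA => psum d.+1 (fun XB =>
      psum r.+1 (F z c A B E Xc XA XB))))))) =
    psum d.+1 (fun A => psum d.+1 (fun B => psum r.+1 (fun E =>
      psum al (fun Xc => K * psum d.+1 (fun XA => psum d.+1 (fun XB =>
      psum r.+1 (F z c A B E Xc XA XB))))))).
    by do 3 (apply: eq_psum => ? _); rewrite psumZl.
  rewrite psum_exchange3 -psumZl; apply: eq_psum => Xc _.
  transitivity (K * (wtl z c Xc ^+ 2 * psum d.+1 (fun A => psum d.+1 (fun B =>
      psum d.+1 (fun XA => psum d.+1 (fun XB => (head z0 A != head z0 B)%:R *
      (wtl (last z Xc) A XA * wtl (last z Xc) B XB *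
        (f (last z0 XA) (last z0 XB) * ((n%:R * q) ^+ r * n%:R))))))))).
    rewrite -!psumZl; apply: eq_psum => A _; rewrite -!psumZl; apply: eq_psum => B _.
    rewrite psumZl psum_exchange2 -!psumZl; apply: eq_psum => XA _.
    rewrite -!psumZl; apply: eq_psum => XB _.
    rewrite /f -(mulrA _ (overlap _ _)) -common_sum -!psumZl; apply: eq_psum => E _.
    by rewrite -!psumZl; apply: eq_psum => XE _.
  rewrite (branch_sum d z0 _ (fun X Y => f X Y * ((n%:R * q) ^+ r * n%:R))).
  by [].
rewrite (squares_sum al (fun x => (1 - \sum_u P x u ^+ 2) * (n%:R ^+ d * (n%:R ^+ d *
      (\sum_X \sum_Y f X Y * ((n%:R * q) ^+ r * n%:R)))))).
rewrite -mulr_suml sumrB sumr_const card_ord -n_collision_prob.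
have -> : \sum_X \sum_Y f X Y * ((n%:R * q) ^+ r * n%:R) =
    (n%:R - n%:R * q) * ((n%:R * q) ^+ r * n%:R).
  under eq_bigr do rewrite -mulr_suml.
  rewrite -mulr_suml; congr (_ * _); rewrite n_collision_prob.
  have -> : n%:R = \sum_X \sum_Y overlap X Y.
    transitivity (\sum_X \sum_u P X u * (1 : R)); first by rewrite sum_row_const mulr1.
    apply: eq_bigr => X _; rewrite /overlap exchange_big; apply: eq_bigr => u _.
    by rewrite -mulr_sumr col_sum.
  rewrite -sumrB; apply: eq_bigr => X _.
  rewrite /f (bigD1 X) //= eqxx mul0r add0r [in RHS](bigD1 X) //= /overlap.
  rewrite [X in X + _ - _](eq_bigr (fun u => P X u ^+ 2)) => [|u _]; last first.
    by rewrite expr2.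
  rewrite addrAC subrr add0r; apply: eq_bigr => Y YX.
  by rewrite eq_sym YX mul1r.
rewrite (_ : 1 *+ n = n%:R :> R) // le_eqVlt; apply/orP; left; apply/eqP.
have NE : n%:R ^+ N = n%:R ^+ al * (n%:R * n%:R ^+ d) * (n%:R * n%:R ^+ d) *
    (n%:R * n%:R ^+ r) :> R by rewrite /N !exprD !(exprS n%:R).
rewrite /K expr_div_n NE !exprMn.
move: (n%:R ^+ al) (q ^+ al) (n%:R ^+ d) (n%:R ^+ r) (q ^+ r) => x1 x2 x3 x4 x5.
by move: ((n - L)%:R ^+ N)^-1 q => x6 x7; ring.
Qed.

End Averages.

(** * Second moment of the transition probabilities *)

Section Decomposition.
Variables (R : realType) (T : finType) (z : T).
Implicit Types (a b c A B E : seq T).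

Lemma split_prefix a b : size a = size b -> a != b ->
  exists c A B, [/\ a = c ++ A, b = c ++ B, size A = size B, A != [::] &
    head z A != head z B].
Proof.
elim: a b => [|u a IH] [|v b] //= [sab].
have [<-|uv] := eqVneq u v; last first.
  by exists [::], (u :: a), (v :: b); rewrite /= sab.
rewrite eqseq_cons eqxx /= => /(IH _ sab)[c [A [B [-> -> ? ? ?]]]].
by exists (u :: c), A, B.
Qed.

Lemma split_suffix a b : size a = size b -> a != b ->
  exists A B E, [/\ a = A ++ E, b = B ++ E, size A = size B &
    last z A != last z B].
Proof.
elim/last_ind: a b => [|a u IH] b; first by case: b.
elim/last_ind: b => [|b v _]; first by rewrite size_rcons.
rewrite !size_rcons eqseq_rcons => -[sab].
have [<-|uv] := eqVneq u v; last first.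
  by exists (rcons a u), (rcons b v), [::]; rewrite !cats0 !size_rcons !last_rcons sab.
rewrite andbT => /(IH _ sab)[A [B [E [-> -> ? ?]]]].
by exists A, B, (rcons E u); rewrite -!rcons_cat.
Qed.

Lemma split_both a b : size a = size b -> a != b -> last z a = last z b ->
  exists c A B E, [/\ a = c ++ A ++ E /\ b = c ++ B ++ E,
    size A = size B, head z A != head z B, last z A != last z B & E != [::]].
Proof.
move=> sab ab lab; have [c [A' [B' [Ea Eb sAB A0 hAB]]]] := split_prefix sab ab.
rewrite {}Ea {}Eb in lab *.
have AB : A' != B' by apply: contra_neq hAB => ->.
have [A [B [E [EA EB sAB' lAB]]]] := split_suffix sAB AB.
have A1 : A != [::].
  apply: contra_neq lAB => A1; rewrite A1; move: sAB'; rewrite A1 /=.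
  by move/esym/size0nil ->.
have B1 : B != [::] by rewrite -size_eq0 -sAB' size_eq0.
exists c, A, B, E; split => //; first by rewrite EA EB.
  move: hAB; rewrite EA EB; case: (A) A1 => // ? ? _; by case: (B) B1.
apply: contra_neq lAB => E0; move: lab; rewrite EA EB E0 !cats0 !last_cat.
by case: (A) A1 => // ? ? _; case: (B) B1.
Qed.

Lemma merge_split al d r (F : seq T -> seq T -> seq T -> seq T -> R) :
  psum (al + (d + r)) (fun a => psum (al + (d + r)) (fun b =>
    (take al b == take al a)%:R * ((drop (al + d) b == drop (al + d) a)%:R *
    F (take al a) (take d (drop al a)) (take d (drop al b)) (drop (al + d) a)))) =
  psum al (fun c => psum d (fun A => psum d (fun B => psum r (fun E => F c A B E)))).
Proof.
rewrite psum_cat; apply: eq_psum => c sc; rewrite psum_cat; apply: eq_psum => A sA.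
rewrite [RHS]psum_exchange; apply: eq_psum => E sE.
rewrite psum_cat -[RHS](psum_pred1 (fun _ => psum d (fun B => F c A B E)) sc).
apply: eq_psum => c' sc'.
rewrite psum_cat -psumZl; apply: eq_psum => B sB.
rewrite -[RHS](psum_pred1 (fun _ => (c' == c)%:R * F c A B E) sE).
apply: eq_psum => E' sE'.
have dr (x y w : seq T) : size x = al -> size y = d -> drop (al + d) (x ++ y ++ w) = w.
  by move=> sx sy; rewrite addnC -drop_drop !drop_size_cat.
by rewrite !dr // !drop_size_cat // !take_size_cat // mulrCA.
Qed.

End Decomposition.

Lemma segment_bounds c a e t : (0 < a)%N -> (0 < e)%N -> (c + (a + e))%N = t ->
  [/\ (c < t)%N, (e.-1 < t)%N, (c + e.-1 + 2 <= t)%N & (t - c - e.-1 - 2).+1 = a].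
Proof. by split; lia. Qed.

Lemma segment_total t i r : (i + r + 2 <= t)%N ->
  t = (i + ((t - i - r - 2).+1 + r.+1))%N /\
  (i + (t - i - r - 2).+1 + (t - i - r - 2).+1 + r.+1 <= t + t)%N.
Proof. by split; lia. Qed.

Section SecondMoment.
Variables (R : realType) (n : nat) (P : 'M[R]_n).
Hypothesis P_bis : bistochastic P.
Implicit Types (s : 'S_n) (x y z u v : 'I_n) (a b c A B E : seq 'I_n).

Local Notation q := (collision_prob P).
Local Notation coll z a b s :=
  (collisions (danger P z) (catrev (graph s b) (catrev (graph s a) [::]))).

Definition nice tau s z a := clean P z (map s a) && (wt P s z a <= tau).

Definition nice_mass tau s t z :=
  psum t (fun a => wt P s z a * (nice tau s z a)%:R).

Definition nice_pairs tau s t z :=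
  psum t (fun a => psum t (fun b => wt P s z a * (nice tau s z a)%:R *
    (wt P s z b * (nice tau s z b)%:R) *
    (endpoint s z b == endpoint s z a)%:R)).

(* AM-GM at scale [beta] replaces Cauchy-Schwarz, which would need square roots. *)
Lemma dist_second_moment tau beta s t z : 0 < beta ->
  dist P s t z <= beta / 2 +
    (1 - 2 * nice_mass tau s t z + n%:R * nice_pairs tau s t z) / (2 * beta).
Proof.
move=> b0; have n0 : 0 < n%:R :> R by rewrite ltr0n (leq_ltn_trans _ (ltn_ord z)).
pose q0 y := psum t (fun a => wt P s z a * (nice tau s z a)%:R *
  (endpoint s z a == y)%:R).
have q0E : \sum_y q0 y = nice_mass tau s t z.
  rewrite -psum_sum; apply: eq_psum => a _.
  rewrite (bigD1 (endpoint s z a)) //= eqxx mulr1 big1 ?addr0 // => y ya.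
  by rewrite eq_sym (negPf ya) mulr0.
have q0q y : q0 y <= qpow P s t z y.
  rewrite qpow_psum; apply: ler_psum => a _; rewrite ler_wpM2r //.
  by rewrite ler_piMr ?wt_ge0 //; case: nice.
have q0S : \sum_y q0 y ^+ 2 = nice_pairs tau s t z.
  under eq_bigr do rewrite expr2 -psumZr.
  rewrite -psum_sum; apply: eq_psum => a _.
  under eq_bigr do rewrite -psumZl.
  rewrite -psum_sum; apply: eq_psum => b _.
  rewrite (bigD1 (endpoint s z a)) //= eqxx mulr1 big1 ?addr0 ?mulrA // => y ya.
  by rewrite [endpoint _ _ a == _]eq_sym (negPf ya) mulr0 mul0r.
have point y : pos_part (n%:R^-1 - qpow P s t z y) <=
    n%:R^-1 * (beta / 2) + (n%:R * (n%:R^-1 - q0 y) ^+ 2) / (2 * beta).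
  set w := n%:R^-1 - q0 y.
  have AMGM : w <= n%:R^-1 * (beta / 2) + (n%:R * w ^+ 2) / (2 * beta).
    rewrite -subr_ge0.
    have -> : n%:R^-1 * (beta / 2) + n%:R * w ^+ 2 / (2 * beta) - w =
        n%:R / (2 * beta) * (w - beta / n%:R) ^+ 2.
      by field; rewrite !gt_eqF.
    by rewrite mulr_ge0 ?sqr_ge0 // divr_ge0 ?ltW // mulr_gt0.
  apply: pos_part_le; last first.
    have b1 := ltW b0; have n1 := ltW n0; move: (w ^+ 2) (sqr_ge0 w) => w' w2.
    by rewrite addr_ge0 // !mulr_ge0 ?invr_ge0 ?mulr_ge0.
  by apply: le_trans AMGM; rewrite lerD2l lerN2.
rewrite distE; apply: le_trans (ler_sum _ (fun y _ => point y)) _.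
rewrite big_split /= -!mulr_suml (sum_inv_n R z) mul1r lerD2l.
rewrite ler_wpM2r ?invr_ge0 ?mulr_ge0 ?(ltW b0) //.
rewrite le_eqVlt; apply/orP; left; apply/eqP.
rewrite -mulr_sumr -q0E -q0S.
have -> : \sum_y (n%:R^-1 - q0 y) ^+ 2 =
    n%:R^-1 - 2 * n%:R^-1 * \sum_y q0 y + \sum_y q0 y ^+ 2.
  rewrite -{2}[n%:R^-1]mulr1 -[X in _ * X - _](sum_inv_n R z) !mulr_sumr -sumrB -big_split.
  by apply: eq_bigr => y _ /=; ring.
by field; rewrite gt_eqF.
Qed.

(** Here [i] is the time of parting and [r.+1] the number of common choices at the end; the branches
    take the remaining length, at least 1. *)
Definition merges t s z := \sum_(i < t) \sum_(r < t | (i + r + 2 <= t)%N)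
  psum i (fun c => psum (t - i - r - 2).+1 (fun A =>
  psum (t - i - r - 2).+1 (fun B => psum r.+1 (fun E =>
    ((head z A != head z B) && uniq (c ++ A ++ B ++ E))%:R *
    merge_wt P s z c A B E)))).

Lemma nice_pairs_le tau s t z : 0 <= tau -> nice_pairs tau s t z <= tau +
  psum t (fun a => psum t (fun b => wt P s z a * wt P s z b *
    (1 < coll z a b s)%N%:R)) + merges t s z.
Proof.
move=> tau0.
pose D i d a b : R :=
  ((head z (take d (drop i a)) != head z (take d (drop i b))) &&
    uniq (take i a ++ take d (drop i a) ++ take d (drop i b) ++ drop (i + d) a))%:R *
  merge_wt P s z (take i a) (take d (drop i a)) (take d (drop i b)) (drop (i + d) a).
have D0 i d a b : 0 <= D i d a b by rewrite /D !mulr_ge0 ?wt_ge0.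
pose M i d a b : R := (take i b == take i a)%:R *
  ((drop (i + d) b == drop (i + d) a)%:R * D i d a b).
have M0 i d a b : 0 <= M i d a b by rewrite /M mulr_ge0 // mulr_ge0.
have -> : merges t s z = psum t (fun a => psum t (fun b =>
    \sum_(i < t) \sum_(r < t | (i + r + 2 <= t)%N) M i (t - i - r - 2).+1 a b)).
  rewrite /merges.
  under [RHS]eq_psum => a _ do rewrite psum_sum.
  rewrite psum_sum; apply: eq_bigr => i _.
  under [RHS]eq_psum => a _ do rewrite psum_sum.
  rewrite psum_sum; apply: eq_bigr => r irt.
  have -> : psum t (fun a => psum t (M i (t - i - r - 2).+1 a)) =
      psum (i + ((t - i - r - 2).+1 + r.+1)) (fun a =>
      psum (i + ((t - i - r - 2).+1 + r.+1)) (M i (t - i - r - 2).+1 a)).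
    by have [<- _] := segment_total irt.
  rewrite (merge_split i (t - i - r - 2).+1 r.+1 (fun c A B E =>
    ((head z A != head z B) && uniq (c ++ A ++ B ++ E))%:R *
    merge_wt P s z c A B E)) //.
have tauE : tau = psum t (fun a => psum t (fun b => (b == a)%:R * (wt P s z a * tau))).
  by rewrite psum_diag psumZr psum_wt // mul1r.
rewrite [X in _ <= X + _ + _]tauE.
rewrite -!psumD; apply: ler_psum => a sa; rewrite -!psumD; apply: ler_psum => b sb.
have S0 : 0 <= \sum_(i < t) \sum_(r < t | (i + r + 2 <= t)%N) M i (t - i - r - 2).+1 a b.
  by do 2 (apply: sumr_ge0 => ? _).
have C0 : 0 <= wt P s z a * wt P s z b * (1 < coll z a b s)%N%:R.
  by rewrite !mulr_ge0 ?wt_ge0.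
have T0 : 0 <= (b == a)%:R * (wt P s z a * tau).
  by rewrite mulr_ge0 // mulr_ge0 ?wt_ge0.
have [wa0|wa] := eqVneq (wt P s z a) 0.
  by rewrite [leLHS](_ : _ = 0) ?addr_ge0 // ?addr_ge0 // wa0 !mul0r.
have [wb0|wb] := eqVneq (wt P s z b) 0.
  by rewrite [leLHS](_ : _ = 0) ?addr_ge0 // ?addr_ge0 // wb0 mul0r mulr0 mul0r.
have wa' : 0 < wt P s z a by rewrite lt0r wa wt_ge0.
have wb' : 0 < wt P s z b by rewrite lt0r wb wt_ge0.
have [ca|ca] := boolP (nice tau s z a); last first.
  by rewrite mulr0 !mul0r addr_ge0 // addr_ge0.
have [cb|cb] := boolP (nice tau s z b); last first.
  by rewrite mulr0 mulr0 mul0r addr_ge0 // addr_ge0.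
have [eab|_] := eqVneq (endpoint s z b) (endpoint s z a); last first.
  by rewrite mulr0 addr_ge0 // addr_ge0.
rewrite !mulr1; have [E|ab] := eqVneq b a.
  have /andP[_ tau_a] := ca.
  by rewrite mul1r -addrA ler_wpDr ?addr_ge0 // E ler_wpM2l ?wt_ge0.
rewrite mul0r add0r; case: (ltnP 1 (coll z a b s)) => [_|c1].
  by rewrite mulr1 lerDl.
rewrite mulr0 add0r.
have agr : agrees s (catrev (graph s b) (catrev (graph s a) [::])).
  by do 2 apply: agrees_catrev.
have [W [sep1 sep2]] := one_collision P_bis agr c1.
have memV y : (y \in unzip2 (catrev (graph s b) (catrev (graph s a) [::]))) =
    (y \in map s a ++ map s b).
  by rewrite !unzip2_catrev /= !(mem_catrev, mem_cat) orbF orbC.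
have sep : separated P z (map s a ++ map s b) W.
  split=> [Y|Y Y']; rewrite -memV; first exact: sep1.
  by move=> YV; rewrite -memV; exact: sep2.
have sab : size a = size b by rewrite sa sb.
(* Equal endpoints mean equal last choices, so the common suffix [E] is nonempty. *)
have lab : last z a = last z b.
  move: eab; rewrite /endpoint; case: (a) (b) sab => [|u a'] [|v b'] //= _.
  by rewrite !last_map => /perm_inj.
rewrite eq_sym in ab.
have [c [A [B [E [[Ea Eb] sAB hAB lAB E0]]]]] := split_both sab ab lab.
have /andP[cla _] := ca; have /andP[clb _] := cb.
have U : uniq (c ++ A ++ B ++ E).
  by apply: (@merge_uniq _ _ _ P_bis s z c A B E W) => //; rewrite -?Ea -?Eb.
have A0 : (0 < size A)%N.
  by rewrite lt0n size_eq0; apply: contra_neq hAB => A0; move: sAB; rewrite A0;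
    move/esym/size0nil => ->.
have E1 : (0 < size E)%N by rewrite lt0n size_eq0.
have st : (size c + (size A + size E) = t)%N by rewrite -sa Ea !size_cat.
have [it rt irt dE] := segment_bounds A0 E1 st.
apply: le_trans (_ : _ <= \sum_(r < t | (size c + r + 2 <= t)%N)
    M (size c) (t - size c - r - 2).+1 a b) _; last first.
  rewrite [leRHS](bigD1 (Ordinal it)) //= lerDl.
  by do 2 (apply: sumr_ge0 => ? _).
rewrite (bigD1 (Ordinal rt)) //=.
rewrite dE.
rewrite ler_wpDr //; first by apply: sumr_ge0.
have dr (x y w : seq 'I_n) : drop (size x + size y) (x ++ y ++ w) = w.
  by rewrite addnC -drop_drop !drop_size_cat.
have ta : take (size c) a = c by rewrite Ea take_size_cat.
have tb : take (size c) b = c by rewrite Eb take_size_cat.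
have ma : take (size A) (drop (size c) a) = A.
  by rewrite Ea drop_size_cat // take_size_cat.
have mb : take (size A) (drop (size c) b) = B.
  by rewrite Eb drop_size_cat // sAB take_size_cat.
have da : drop (size c + size A) a = E by rewrite Ea dr.
have db : drop (size c + size A) b = E by rewrite Eb sAB dr.
by rewrite /M /D ta tb ma mb da db !eqxx !mul1r hAB U mul1r /merge_wt -Ea -Eb.
Qed.

(** The lengths of prefix and suffix carry independent weights [q ^+ i * (1 - q)] and
    [q ^+ r * (1 - q)], whose sums telescope to at most 1. *)
Lemma merges_mass L t : (L < n)%N -> (t + t <= L)%N ->
  \sum_z \sum_s merges t s z <= (n`!)%:R * (n%:R / (n - L)%:R) ^+ (t + t).
Proof.
move=> Ln tL; have nL : 0 < (n - L)%:R :> R by rewrite ltr0n subn_gt0.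
have rho1 : 1 <= n%:R / (n - L)%:R :> R.
  by rewrite ler_pdivlMr // mul1r ler_nat leq_subr.
set K : R := (n`!)%:R * _.
have K0 : 0 <= K by rewrite mulr_ge0 // exprn_ge0 // divr_ge0 // ltW.
have q0 := collision_prob_ge0 P; have q1 := collision_prob_le1 P_bis.
have geo : \sum_(i < t) q ^+ i * (1 - q) <= 1.
  rewrite -mulr_suml mulrC -opprB mulNr -subrX1 opprB.
  by rewrite gerBl exprn_ge0.
apply: (@le_trans _ _ (\sum_(i < t) \sum_(r < t) K *
    ((q ^+ i * (1 - q)) * (q ^+ r * (1 - q))))); last first.
  under eq_bigr do rewrite -mulr_sumr -mulr_sumr.
  rewrite -mulr_sumr -mulr_suml ler_piMr // mulr_ile1 //;
    by apply: sumr_ge0 => i _; rewrite mulr_ge0 ?exprn_ge0 ?subr_ge0.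
have -> : \sum_z \sum_s merges t s z = \sum_(i < t) \sum_(r < t | (i + r + 2 <= t)%N)
    \sum_z \sum_s psum i (fun c => psum (t - i - r - 2).+1 (fun A =>
  psum (t - i - r - 2).+1 (fun B => psum r.+1 (fun E =>
    ((head z A != head z B) && uniq (c ++ A ++ B ++ E))%:R *
    merge_wt P s z c A B E)))).
  rewrite /merges; under eq_bigr do rewrite exchange_big /=.
  rewrite exchange_big /=; apply: eq_bigr => i _.
  under eq_bigr do rewrite exchange_big /=.
  by rewrite exchange_big.
apply: ler_sum => i _; rewrite [leRHS](bigID (fun r : 'I_t => (i + r + 2 <= t)%N)) /=.
rewrite ler_wpDr //.
  by apply: sumr_ge0 => r _; rewrite !mulr_ge0 ?exprn_ge0 ?subr_ge0.
apply: ler_sum => r irt.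
case: (posnP n) => [n0|n0].
  rewrite big1 ?mulr_ge0 ?exprn_ge0 ?subr_ge0 // => z.
  by have := ltn_ord z; rewrite {2}n0.
have z0 : 'I_n := Ordinal n0.
set d := (t - i - r - 2)%N.
have [_ dE] := segment_total irt.
have := @merge_sum R n P P_bis L i d r z0 Ln (leq_trans dE tL).
move=> H; apply: le_trans (le_trans H _).
  rewrite le_eqVlt; apply/orP; left; apply/eqP; apply: eq_bigr => z _.
  by apply: eq_bigr => s _; apply: eq_psum => c _.
rewrite ler_wpM2r ?mulr_ge0 ?exprn_ge0 ?subr_ge0 // /K ler_wpM2l //.
by apply: ler_weXn2l.
Qed.

End SecondMoment.

(** * The entropic time *)

Section EntropicTime.
Variables (R : realType) (n : nat) (P : 'M[R]_n).
Hypothesis P_bis : bistochastic P.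
Variables (L : nat) (al ld : R).
Hypotheses (L_lt_n : (L < n)%N) (al_ge0 : 0 <= al).
Hypothesis danger_small : forall x h, (size h < L)%N ->
  #|danger P x h|%:R <= al * (n - size h)%:R.
Hypothesis ln_le : forall x u, 0 < P x u -> - ln (P x u) <= ld.
Implicit Types (s : 'S_n) (x y z u v : 'I_n) (a b : seq 'I_n).

Local Notation h := (entropy_rate P).
Local Notation rho := (n%:R / (n - L)%:R : R).

Let n_gt0 : 0 < n%:R :> R. Proof. by rewrite ltr0n (leq_ltn_trans _ L_lt_n). Qed.

Let e x u := - ln (P x u) - h.

Lemma entropyE : n%:R * h = \sum_x \sum_u P x u * - ln (P x u).
Proof.
rewrite mulrA divff ?gt_eqF // mul1r; apply: eq_bigr => x _; apply: eq_bigr => u _.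
have := P_ge0 P_bis x u; rewrite le_eqVlt => /orP[/eqP<-|Pu]; first by rewrite !mul0r.
by rewrite lnV // posrE.
Qed.

Lemma neg_ln_ge0 x u : 0 <= - ln (P x u).
Proof. by rewrite oppr_ge0 ln_le0 // P_le1. Qed.

Lemma entropy_ge0 : 0 <= h.
Proof.
rewrite -(pmulr_rge0 _ n_gt0) entropyE.
do 2 (apply: sumr_ge0 => ? _); by rewrite mulr_ge0 ?P_ge0 ?neg_ln_ge0.
Qed.

Let e_mean : \sum_x \sum_u P x u * e x u = 0.
Proof.
under eq_bigr do under eq_bigr do rewrite mulrBr.
under eq_bigr do rewrite sumrB.
by rewrite sumrB -entropyE sum_row_const // subrr.
Qed.

Let v := n%:R^-1 * \sum_x \sum_u P x u * e x u ^+ 2.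

Let e_var : \sum_x \sum_u P x u * e x u ^+ 2 = n%:R * v.
Proof. by rewrite mulrA divff ?gt_eqF // mul1r. Qed.

(** A variance is at most the second moment, and [(- ln P)^2] is at most [ld] times [- ln P]. Thus
    [t * v] is of order [ld * log n] at the entropic time. *)
Let v_le : v <= ld * h.
Proof.
rewrite -(ler_pM2l n_gt0) -e_var mulrCA entropyE mulr_sumr.
apply: (@le_trans _ _ (\sum_x \sum_u (P x u * (ln (P x u)) ^+ 2 +
   (2 * h * (P x u * ln (P x u)) + P x u * h ^+ 2)))).
  apply: ler_sum => x _; apply: ler_sum => u _; rewrite /e le_eqVlt.
  by apply/orP; left; apply/eqP; ring.
under eq_bigr do rewrite !big_split /= -mulr_sumr.
rewrite !big_split /= -mulr_sumr sum_row_const //.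
have -> : \sum_x \sum_u P x u * ln (P x u) = - (n%:R * h).
  rewrite entropyE -sumrN; apply: eq_bigr => x _; rewrite -sumrN.
  by apply: eq_bigr => u _; rewrite mulrN opprK.
have n_h2 : 0 <= n%:R * h ^+ 2 by rewrite mulr_ge0 ?sqr_ge0 ?ltW.
apply: (@le_trans _ _ (\sum_x \sum_u P x u * ln (P x u) ^+ 2)).
  rewrite gerDl; lra.
apply: ler_sum => x _; rewrite mulr_sumr; apply: ler_sum => u _.
have := P_ge0 P_bis x u; rewrite le_eqVlt => /orP[/eqP<-|Pu].
  by rewrite !mul0r mulr0.
rewrite [leRHS]mulrCA ler_wpM2l ?P_ge0 // -sqrrN expr2 ler_wpM2r ?neg_ln_ge0 //.
exact: ln_le.
Qed.

Lemma cost_ln s z a : 0 < wt P s z a ->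
  cost e s z a = - ln (wt P s z a) - (size a)%:R * h.
Proof.
elim: a z => [|u a IH] z /= wa; first by rewrite ln1 mul0r oppr0 addr0.
have Pu : 0 < P z u.
  by rewrite lt0r P_ge0 // andbT; apply: contraTneq wa => ->; rewrite mul0r ltxx.
have wa' : 0 < wt P s (s u) a.
  by rewrite lt0r wt_ge0 // andbT; apply: contraTneq wa => ->; rewrite mulr0 ltxx.
rewrite IH // lnM ?posrE // /e -natr1; ring.
Qed.

Definition atypical t lam s z a :=
  lam ^+ 2 <= (- ln (wt P s z a) - t%:R * h) ^+ 2.

(** Unclean walks, plus Chebyshev's bound for walks with distinct choices; [rho ^+ t] is the price
    of treating their images as independent. *)
Definition bad_mass t lam : R :=
  t%:R * al + rho ^+ t * (t%:R * (ld * h)) / lam ^+ 2.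

Lemma atypical_mass t lam : 0 < lam -> (t <= L)%N ->
  \sum_z \sum_s psum t (fun a => wt P s z a * (atypical t lam s z a)%:R) <=
  (n`!)%:R * n%:R * bad_mass t lam.
Proof.
move=> l0 tL; have nL : 0 < (n - L)%:R :> R by rewrite ltr0n subn_gt0.
apply: (@le_trans _ _ (\sum_z \sum_s (psum t (fun a =>
    wt P s z a * (~~ clean P z (map s a))%:R) +
  psum t (fun a => wt P s z a * (uniq a)%:R * cost e s z a ^+ 2) / lam ^+ 2))).
  apply: ler_sum => z _; apply: ler_sum => s _; rewrite -psumZr -psumD.
  apply: ler_psum => a sa.
  have r0 : 0 <= wt P s z a * (uniq a)%:R * cost e s z a ^+ 2 / lam ^+ 2.
    by rewrite divr_ge0 ?sqr_ge0 // mulr_ge0 ?sqr_ge0 // mulr_ge0 ?wt_ge0.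
  have := wt_ge0 P_bis s z a; rewrite le_eqVlt => /orP[/eqP<-|wa].
    by rewrite !mul0r addr0.
  case: (boolP (clean P z (map s a))) => cl /=; last first.
    rewrite mulr1 ler_wpDr // ler_piMr ?wt_ge0 //.
    by case: atypical.
  rewrite mulr0 add0r (clean_uniq P_bis wa cl) mulr1 -mulrA ler_wpM2l ?wt_ge0 //.
  rewrite cost_ln // sa /atypical; case: (leP (lam ^+ 2) _) => H; last exact: divr_ge0 (sqr_ge0 _) (sqr_ge0 _).
  by rewrite ler_pdivlMr ?exprn_gt0 // mul1r.
under eq_bigr do rewrite big_split /= -mulr_suml.
rewrite big_split /= -mulr_suml /bad_mass mulrDr lerD //.
  apply: le_trans (ler_sum _ (fun z _ =>
    not_clean_mass P_bis (ltnW L_lt_n) al_ge0 danger_small z tL)) _.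
  rewrite sumr_const card_ord.
  by rewrite -[leLHS]mulr_natl [leLHS]mulrA [X in X * _ <= _]mulrC.
rewrite [leRHS]mulrA ler_wpM2r ?invr_ge0 ?sqr_ge0 //.
apply: le_trans (walk_variance P_bis e_mean e_var L_lt_n tL) _.
apply: ler_wpM2l; first by rewrite mulr_ge0.
apply: ler_wpM2l; first by rewrite exprn_ge0 ?divr_ge0.
exact: ler_wpM2l.
Qed.

(** A point reached by a walk of weight at least [tau] contributes at most [1/n] more than its light
    walks, and there are at most [tau^-1] such walks. All other points are reached by light walks
    only. *)
Lemma dist_lower (tau : R) t s z : 0 < tau ->
  1 - dist P s t z <= (n%:R * tau)^-1 +
    psum t (fun a => wt P s z a * (wt P s z a < tau)%R%:R).
Proof.
move=> t0.
pose light y := psum t (fun a => wt P s z a * (wt P s z a < tau)%R%:R *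
  (endpoint s z a == y)%:R).
pose heavy y : R := psum t (fun a => (tau <= wt P s z a)%R%:R * (endpoint s z a == y)%:R).
have light0 y : 0 <= light y by apply: psum_ge0 => a _; rewrite !mulr_ge0 ?wt_ge0.
have heavy0 y : 0 <= heavy y by apply: psum_ge0 => a _; rewrite mulr_ge0.
have sum_end (f : seq 'I_n -> R) :
    \sum_y psum t (fun a => f a * (endpoint s z a == y)%:R) = psum t f.
  rewrite -psum_sum; apply: eq_psum => a _.
  rewrite (bigD1 (endpoint s z a)) //= eqxx mulr1 big1 ?addr0 // => y ya.
  by rewrite eq_sym (negPf ya) mulr0.
rewrite -[X in X - _](sum_inv_n R z) distE -sumrB.
apply: (@le_trans _ _ (\sum_y (n%:R^-1 * heavy y + light y))).
  apply: ler_sum => y _; rewrite lerBlDr.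
  have [[a [sa [ta ea]]]|none] :=
      pselect (exists a, size a = t /\ (tau <= wt P s z a /\ endpoint s z a == y)).
    rewrite ler_wpDr ?pos_part_ge0 // ler_wpDr // ler_peMr ?invr_ge0 ?(ltW n_gt0) //.
    have := @psum_ler_term R _ t (fun a => (tau <= wt P s z a)%R%:R *
      (endpoint s z a == y)%:R) a sa (fun b _ => mulr_ge0 (ler0n _ _) (ler0n _ _)).
    by rewrite ta ea mulr1.
  have -> : light y = qpow P s t z y.
    rewrite qpow_psum; apply: eq_psum => a sa; case: (ltP _ tau) => [|ta].
      by rewrite mulr1.
    case: eqP => [ea|]; last by rewrite !mulr0.
    by case: none; exists a; split => //; split => //; apply/eqP.
  rewrite -addrA ler_wpDl ?mulr_ge0 ?invr_ge0 ?(ltW n_gt0) //.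
  by rewrite -lerBlDl le_pos_part.
rewrite big_split /= -mulr_sumr !sum_end invfM lerD2r ler_wpM2l ?invr_ge0 ?(ltW n_gt0) //.
rewrite -[leRHS]mul1r ler_pdivlMr // -[leRHS](psum_wt P_bis s t z) -psumZr.
apply: ler_psum => a _; case: (leP tau) => H; first by rewrite mul1r.
by rewrite mul0r wt_ge0.
Qed.

Lemma avg_dist_lower t tau lam : 0 < tau -> 0 < lam -> (t <= L)%N ->
  lam <= - ln tau - t%:R * h ->
  \sum_z \sum_s (1 - dist P s t z) <=
  (n`!)%:R * n%:R * ((n%:R * tau)^-1 + bad_mass t lam).
Proof.
move=> t0 l0 tL lt.
apply: (@le_trans _ _ (\sum_z \sum_s ((n%:R * tau)^-1 +
    psum t (fun a => wt P s z a * (atypical t lam s z a)%:R)))).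
  apply: ler_sum => z _; apply: ler_sum => s _.
  apply: le_trans (dist_lower t s z t0) _; rewrite lerD2l.
  apply: ler_psum => a _; have := wt_ge0 P_bis s z a.
  rewrite le_eqVlt => /orP[/eqP<-|wa]; first by rewrite !mul0r.
  rewrite ler_wpM2l ?(ltW wa) //; case: (ltP (wt P s z a) tau) => // wt_tau; rewrite /atypical.
  have : ln (wt P s z a) < ln tau by rewrite ltr_ln ?posrE.
  move=> ln_lt; have H : lam <= - ln (wt P s z a) - t%:R * h by lra.
  by rewrite ler_pXn2r ?nnegrE ?(ltW l0) ?H // (le_trans (ltW l0)).
under eq_bigr do rewrite big_split sumr_const /=.
rewrite big_split /= mulrDr lerD ?atypical_mass //.
rewrite sumr_const (card_Sn n) card_ord -[leLHS]mulr_natl -[_ *+ n`!]mulr_natl.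
by rewrite mulrCA mulrA.
Qed.

(** After multiplication by [n], the merging pairs contribute [rho ^+ (t + t)], which is close to 1
    and cancels the [- 1] left by the centred second moment. *)
Lemma avg_dist_upper t tau lam beta : 0 < tau -> 0 < lam -> 0 < beta ->
  (t + t <= L)%N -> lam <= t%:R * h + ln tau ->
  \sum_z \sum_s dist P s t z <= (n`!)%:R * n%:R * (beta / 2 +
    (2 * (t%:R * al + bad_mass t lam) - 1 + n%:R * tau +
     n%:R * ((t + t)%:R * al) ^+ 2 + rho ^+ (t + t)) / (2 * beta)).
Proof.
move=> t0 l0 b0 tL lt.
have tL' : (t <= L)%N by apply: leq_trans tL; rewrite leq_addr.
set C2 := n%:R * ((t + t)%:R * al) ^+ 2; set rt := rho ^+ (t + t).
pose loss s z := psum t (fun a => wt P s z a * (~~ clean P z (map s a))%:R) +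
   psum t (fun a => wt P s z a * (atypical t lam s z a)%:R).
pose coll2 s z := psum t (fun a => psum t (fun b => wt P s z a * wt P s z b *
  (1 < collisions (danger P z) (catrev (graph s b) (catrev (graph s a) [::])))%N%:R)).
have b20 : 0 <= (2 * beta)^-1 by rewrite invr_ge0 mulr_ge0 // ltW.
have massE s z : 1 - nice_mass P tau s t z <= loss s z.
  rewrite -[X in X - _](psum_wt P_bis s t z) -psumB /loss -psumD.
  apply: ler_psum => a _; have := wt_ge0 P_bis s z a.
  rewrite le_eqVlt => /orP[/eqP<-|wa]; first by rewrite !mul0r subrr addr0.
  rewrite -mulrDr -[X in X - _]mulr1 -mulrBr ler_wpM2l ?(ltW wa) // /nice.
  case: clean => /=; last by rewrite subr0 lerDl.
  case: (leP (wt P s z a) tau) => wt_tau; first by rewrite subrr add0r.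
  have : ln tau < ln (wt P s z a) by rewrite ltr_ln ?posrE.
  move=> ln_lt; rewrite subr0 add0r /atypical.
  have -> : (- ln (wt P s z a) - t%:R * h) ^+ 2 = (ln (wt P s z a) + t%:R * h) ^+ 2.
    by ring.
  have H : lam <= ln (wt P s z a) + t%:R * h by lra.
  by rewrite ler_pXn2r ?nnegrE ?(ltW l0) ?H // (le_trans (ltW l0)).
have point s z : dist P s t z <= beta / 2 +
    (2 * loss s z - 1 + n%:R * (tau + coll2 s z + merges P t s z)) / (2 * beta).
  apply: le_trans (dist_second_moment P_bis tau s t z b0) _.
  rewrite lerD2l ler_wpM2r // lerD //; first by have := massE s z; lra.
  by rewrite ler_wpM2l ?(ltW n_gt0) // nice_pairs_le // ltW.
have [K1 K1E] : exists K1, K1 = beta / 2 + (n%:R * tau - 1) / (2 * beta) by eexists.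
apply: (@le_trans _ _ (\sum_z \sum_s (K1 +
   ((2 * loss s z) / (2 * beta) + ((n%:R * coll2 s z) / (2 * beta) +
    (n%:R * merges P t s z) / (2 * beta)))))).
  apply: ler_sum => z _; apply: ler_sum => s _; apply: le_trans (point s z) _.
  by rewrite K1E le_eqVlt; apply/orP; left; apply/eqP; ring.
under eq_bigr do rewrite !big_split sumr_const /= -!mulr_suml -!mulr_sumr.
rewrite !big_split /= -!mulr_suml -!mulr_sumr.
have lossS : \sum_z \sum_s loss s z <=
    (n`!)%:R * n%:R * (t%:R * al + bad_mass t lam).
  rewrite /loss; under eq_bigr do rewrite big_split /=.
  rewrite big_split /= mulrDr lerD ?atypical_mass //.
  apply: le_trans (ler_sum _ (fun z _ =>
    not_clean_mass P_bis (ltnW L_lt_n) al_ge0 danger_small z tL')) _.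
  rewrite sumr_const card_ord.
  by rewrite -[leLHS]mulr_natl [leLHS]mulrA [X in X * _ <= _]mulrC.
have collS : \sum_z \sum_s coll2 s z <= (n`!)%:R * C2.
  apply: le_trans (ler_sum _ (fun z _ =>
    two_collisions_mass P_bis (ltnW L_lt_n) al_ge0 danger_small z tL)) _.
  rewrite sumr_const card_ord.
  by rewrite -[leLHS]mulr_natl /C2 mulrCA.
have mergeS := merges_mass P_bis L_lt_n tL.
have constS : \sum_(z < n) K1 *+ #|{perm 'I_n}| = (n`!)%:R * n%:R * K1.
  by rewrite sumr_const card_ord (card_Sn n) -mulrnA -[LHS]mulr_natl natrM.
rewrite constS.
have Hloss : 2 * (\sum_z \sum_s loss s z) / (2 * beta) <=
    2 * ((n`!)%:R * n%:R * (t%:R * al + bad_mass t lam)) / (2 * beta).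
  by rewrite ler_wpM2r // ler_wpM2l.
have Hcoll : n%:R * (\sum_z \sum_s coll2 s z) / (2 * beta) <=
    n%:R * ((n`!)%:R * C2) / (2 * beta).
  by rewrite ler_wpM2r // ler_wpM2l // ltW.
have Hmerge : n%:R * (\sum_z \sum_s merges P t s z) / (2 * beta) <=
    n%:R * ((n`!)%:R * rt) / (2 * beta).
  by rewrite ler_wpM2r // ler_wpM2l // ltW.
apply: le_trans (lerD (lexx _) (lerD Hloss (lerD Hcoll Hmerge))) _.
by rewrite K1E le_eqVlt; apply/orP; left; apply/eqP; ring.
Qed.

End EntropicTime.

(** * Worst starting points *)

Section FixedSize.
Variables (R : realType) (n : nat) (P : 'M[R]_n).
Hypothesis P_bis : bistochastic P.
Implicit Types (s : 'S_n) (x y z u v : 'I_n).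

Lemma perm_prob_le (A : pred 'S_n) (f : 'S_n -> R) :
  (forall s, (A s)%:R <= f s) ->
  uniform_perm_prob R A <= (n`!)%:R^-1 * \sum_s f s.
Proof.
move=> Af; rewrite /uniform_perm_prob card_Sn mulrC ler_wpM2l ?invr_ge0 //.
apply: le_trans (ler_sum _ (fun s _ => Af s)).
by rewrite -sum1_card natr_sum big_mkcond; apply: ler_sum => s _; case: ifP => [|/idP/negP]; rewrite /in_mem /= => H; rewrite ?H ?(negPf H).
Qed.

Lemma le_tv_worst s t x : dist P s t x <= tv_worst (permuted_chain P s) t.
Proof. exact: le_bigmax. Qed.

Lemma tv_worst_le s t e : 0 <= e -> (forall x, dist P s t x <= e) ->
  tv_worst (permuted_chain P s) t <= e.
Proof. by move=> e0 H; apply: bigmax_le => // x _; exact: H. Qed.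

Lemma tv_worst_nonincr s t j :
  tv_worst (permuted_chain P s) (t + j) <= tv_worst (permuted_chain P s) t.
Proof.
apply: bigmax_le => [|x _]; first by rewrite bigmax_ge_id.
exact: le_trans (dist_nonincr P_bis s t j x) (le_tv_worst s t x).
Qed.

(* Of the possible successors of a point at most one is bad, so the chain stays
   bad for [j] steps with probability at most [D ^+ j]. *)
Lemma leave_bad s (bad : pred 'I_n) (D e : R) t j x :
  (forall x u, P x u <= D) -> D <= 1 -> 0 <= e ->
  (forall z, ~~ bad z -> dist P s t z <= e) ->
  (forall x u u', 0 < P x u -> 0 < P x u' -> u != u' ->
     ~~ (bad (s u) && bad (s u'))) ->
  dist P s (t + j) x <= D ^+ j + e.
Proof.
move=> PD D1 e0 good one; have D0 : 0 <= D := le_trans (P_ge0 P_bis x x) (PD x x).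
elim: j x => [|j IH] x.
  rewrite addn0 expr0; apply: le_trans (dist_le1 P_bis s t x) _.
  by rewrite lerDl.
rewrite addnS; apply: le_trans (dist_step P_bis _ _ _) _.
have goodj u : ~~ bad (s u) -> dist P s (t + j) (s u) <= e.
  by move=> /good; apply: le_trans; exact: dist_nonincr.
case: (pickP (fun u => (0 < P x u) && bad (s u))) => [u /andP[xu bu]|nobad].
  rewrite (bigD1 u) //=.
  apply: (@le_trans _ _ (P x u * (D ^+ j + e) + \sum_(v | v != u) P x v * e)).
    rewrite lerD ?ler_wpM2l ?P_ge0 // ler_sum // => v vu.
    have := P_ge0 P_bis x v; rewrite le_eqVlt => /orP[/eqP<-|xv].
      by rewrite !mul0r.
    rewrite ler_wpM2l ?(ltW xv) // goodj //.
    by have := one x u v xu xv; rewrite eq_sym vu bu => /(_ isT).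
  rewrite mulrDr -addrA; apply: lerD; first by rewrite exprS ler_wpM2r ?exprn_ge0.
  have rs : P x u + \sum_(v | v != u) P x v = 1.
    by rewrite -[RHS](row_sum P_bis x) [RHS](bigD1 u).
  by rewrite -mulr_suml -mulrDl rs mul1r.
apply: (@le_trans _ _ (\sum_u P x u * e)).
  apply: ler_sum => u _; have := P_ge0 P_bis x u.
  rewrite le_eqVlt => /orP[/eqP<-|xu]; first by rewrite !mul0r.
  rewrite ler_wpM2l ?(ltW xu) // goodj //.
  by have := nobad u; rewrite xu /= => ->.
by rewrite -mulr_suml row_sum // mul1r lerDr exprn_ge0.
Qed.

Section Upper.
Variables (L : nat) (al d D : R).
Hypotheses (L_lt_n : (L < n)%N) (al_ge0 : 0 <= al).
Hypothesis danger_small : forall x h, (size h < L)%N ->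
  #|danger P x h|%:R <= al * (n - size h)%:R.
Hypotheses (d_gt0 : 0 < d) (P_ge : forall x u, 0 < P x u -> d <= P x u).
Hypotheses (P_le : forall x u, P x u <= D) (D_ge0 : 0 <= D) (D_le1 : D <= 1).
Variables (m t k M j : nat) (th rho1 rho2 c kap ka kb eps : R).
Hypotheses (mL : (4 * m + 2 <= L)%N) (tL : (t <= L)%N).
Hypotheses (th_gt0 : 0 < th) (th_le1 : th <= 1).
Hypotheses (M_gt0 : (0 < M)%N) (Mkm : (M + k + k * m <= n)%N).
Hypothesis th_big :
  n%:R * (rho1 + rho2) + 6 * k%:R * t%:R ^+ 2 <= n%:R * th ^+ 2.
Hypotheses (rho1_gt0 : 0 < rho1) (rho2_gt0 : 0 < rho2).
Hypotheses (c_gt0 : 0 < c) (kap_gt0 : 0 < kap) (kb_gt0 : 0 < kb) (ka_ge0 : 0 <= ka).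
Hypothesis atom_le : kap + D ^+ m.+1 <= ka ^+ 2.
Hypothesis eps_ge : D ^+ j + (c + loss m kap ka kb k) <= eps.

Let n_gt0 : 0 < n%:R :> R. Proof. by rewrite ltr0n (leq_ltn_trans _ L_lt_n). Qed.

Let F s z := ksum m k (fun l => (fresh l)%:R *
   \prod_(q <- l) (walker_wt P s z q * dist P s t (s q.2))) [::].

Let F_ge0 s z : 0 <= F s z.
Proof.
rewrite /F; elim: (k) [::] => [|i IH] acc /=.
  rewrite mulr_ge0 // prodr_ge0 // => q _.
  by rewrite mulr_ge0 ?walker_wt_ge0 ?dist_ge0.
by apply: wsum_ge0 => q _; exact: IH.
Qed.

Let chi_ge0 s z : 0 <= chi P m s z.
Proof. by do 2 (apply: psum_ge0 => ? _); rewrite !mulr_ge0 ?wt_ge0. Qed.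

Let reach_diag_ge0 s : 0 <= \sum_z reach P s t z z.
Proof. by apply: sumr_ge0 => z _; exact: reach_ge0. Qed.

Let dist_sum_ge0 s : 0 <= \sum_z dist P s t z.
Proof. by apply: sumr_ge0 => z _; exact: dist_ge0. Qed.

Let loss_ge0 : 0 <= loss m kap ka kb k.
Proof.
have kap0 := ltW kap_gt0; have kb0 := ltW kb_gt0; apply: addr_ge0.
  by apply: addr_ge0 => //; apply: divr_ge0 => //; rewrite mulr_ge0.
by rewrite mulr_ge0 // addr_ge0 // mulr_ge0.
Qed.

Let eps_ge0 : 0 <= eps.
Proof.
by apply: le_trans eps_ge; rewrite addr_ge0 ?exprn_ge0 // addr_ge0 // ltW.
Qed.

(** Each of the four terms reaches 1 when its bad event occurs: large mean distance, many returns,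
    successful fresh walkers from some [z], two bad children of some [x]. A single expectation then
    replaces the union bound. *)
Let failure s : R := (\sum_z dist P s t z) / (n%:R * rho1) +
  (\sum_z reach P s t z z) / (n%:R * rho2) +
  (\sum_z (balanced P t rho1 rho2 s)%:R * F s z / c ^+ k +
   \sum_x \sum_u \sum_u' ([&& (0 < P x u)%R, (0 < P x u')%R & u != u'])%:R *
     (chi P m s (s u) * chi P m s (s u') / kap ^+ 2)).

Let failure_ge1 s : eps < tv_worst (permuted_chain P s) (m.+1 + t + j) ->
  1 <= failure s.
Proof.
move=> eps_lt.
have A1 : 0 <= (\sum_z dist P s t z) / (n%:R * rho1).
  by rewrite divr_ge0 // mulr_ge0 // ltW.
have A2 : 0 <= (\sum_z reach P s t z z) / (n%:R * rho2).
  by rewrite divr_ge0 // mulr_ge0 // ltW.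
have t3 z : 0 <= (balanced P t rho1 rho2 s)%:R * F s z / c ^+ k.
  by rewrite divr_ge0 ?mulr_ge0 // exprn_ge0 // ltW.
have A3 : 0 <= \sum_z (balanced P t rho1 rho2 s)%:R * F s z / c ^+ k.
  by apply: sumr_ge0.
have t4 x u u' : 0 <= ([&& (0 < P x u)%R, (0 < P x u')%R & u != u'])%:R *
     (chi P m s (s u) * chi P m s (s u') / kap ^+ 2).
  rewrite mulr_ge0 // divr_ge0 ?sqr_ge0 // mulr_ge0 //.
have A4 : 0 <= \sum_x \sum_u \sum_u' ([&& (0 < P x u)%R, (0 < P x u')%R & u != u'])%:R *
     (chi P m s (s u) * chi P m s (s u') / kap ^+ 2).
  by do 3 (apply: sumr_ge0 => ? _).
rewrite leNgt; apply/negP => small.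
have bal : balanced P t rho1 rho2 s.
  rewrite /balanced; apply/andP; split; apply/ltW.
    rewrite -[ltRHS]mul1r -ltr_pdivrMr ?mulr_gt0 //.
    by apply: le_lt_trans small; rewrite /failure; lra.
  rewrite -[ltRHS]mul1r -ltr_pdivrMr ?mulr_gt0 //.
  by apply: le_lt_trans small; rewrite /failure; lra.
have good z : chi P m s z <= kap ->
    dist P s (m.+1 + t) z <= c + loss m kap ka kb k.
  move=> chi_z; rewrite leNgt; apply/negP => big.
  have cG := le_trans (ltW big) (dist_wsum m P_bis s t z).
  have phi01 y : 0 <= dist P s t y <= 1 by rewrite dist_ge0 dist_le1.
  have := greedy P_bis P_le D_ge0 chi_z kb_gt0 ka_ge0 atom_le (ltW c_gt0) phi01 cG.
  rewrite -/(F s z) => cF.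
  have : 1 <= (balanced P t rho1 rho2 s)%:R * F s z / c ^+ k.
    by rewrite bal mul1r ler_pdivlMr ?exprn_gt0 // mul1r.
  move=> one; move: small; rewrite ltNge /failure => /negP; apply.
  apply: le_trans one _.
  have le3 : (balanced P t rho1 rho2 s)%:R * F s z / c ^+ k <=
      \sum_z (balanced P t rho1 rho2 s)%:R * F s z / c ^+ k.
    by rewrite [leRHS](bigD1 z) //= lerDl sumr_ge0.
  lra.
have one x u u' : 0 < P x u -> 0 < P x u' -> u != u' ->
    ~~ ((kap < chi P m s (s u)) && (kap < chi P m s (s u'))).
  move=> xu xu' uu'; apply/negP => /andP[cu cu'].
  move: small; rewrite ltNge /failure => /negP; apply.
  apply: (@le_trans _ _ (([&& (0 < P x u)%R, (0 < P x u')%R & u != u'])%:R *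
     (chi P m s (s u) * chi P m s (s u') / kap ^+ 2))).
    rewrite xu xu' uu' mul1r ler_pdivlMr ?exprn_gt0 // mul1r expr2.
    by rewrite ler_pM // ltW.
  have le4 : ([&& (0 < P x u)%R, (0 < P x u')%R & u != u'])%:R *
      (chi P m s (s u) * chi P m s (s u') / kap ^+ 2) <=
    \sum_x \sum_u \sum_u' ([&& (0 < P x u)%R, (0 < P x u')%R & u != u'])%:R *
     (chi P m s (s u) * chi P m s (s u') / kap ^+ 2).
    rewrite (bigD1 x) //= (bigD1 u) //= (bigD1 u') //= -!addrA lerDl.
    by rewrite !addr_ge0 // sumr_ge0 // => *; rewrite ?sumr_ge0 // => *; rewrite ?sumr_ge0.
  lra.
move: eps_lt; rewrite ltNge => /negP; apply; apply: tv_worst_le => // x.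
have el0 : 0 <= c + loss m kap ka kb k by rewrite addr_ge0 // ltW.
apply: le_trans eps_ge.
apply: (@leave_bad s (fun z => kap < chi P m s z)) => // z.
by rewrite -leNgt; exact: good.
Qed.

(** The time consists of [j] steps to leave the bad points, [m.+1] for the walkers and [t] for
    mixing on average. The last two terms carry the factor [n] of the union over starting points,
    and a point has at most [d^-2] pairs of possible choices. *)
Lemma upper_failure :
  uniform_perm_prob R [pred s | eps < tv_worst (permuted_chain P s) (m.+1 + t + j)]
  <= (n`!)%:R^-1 * (\sum_z \sum_s dist P s t z) / (n%:R * rho1) +
     t%:R ^+ 2 * al / rho2 + n%:R * ((4 * n%:R * th) / (M%:R * c)) ^+ k +
     n%:R * ((4 * m + 2)%:R * al / (d * kap)) ^+ 2.
Proof.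
have nf0 : 0 < (n`!)%:R :> R by rewrite ltr0n fact_gt0.
have fail s : ([pred s | eps < tv_worst (permuted_chain P s) (m.+1 + t + j)] s)%:R
    <= failure s.
  rewrite /=; case: ltP => [/failure_ge1//|_].
  rewrite /failure !addr_ge0 ?divr_ge0 ?mulr_ge0 ?(ltW n_gt0) ?(ltW rho1_gt0) ?(ltW rho2_gt0) //.
    apply: sumr_ge0 => z _; by rewrite divr_ge0 ?mulr_ge0 // exprn_ge0 // ltW.
  do 3 (apply: sumr_ge0 => ? _); rewrite mulr_ge0 // divr_ge0 ?sqr_ge0 // mulr_ge0 //.
apply: le_trans (perm_prob_le fail) _; rewrite /failure.
rewrite !big_split /= -!mulr_suml !mulrDr -!addrA lerD //.
  by rewrite mulrA exchange_big.
apply: lerD; last apply: lerD.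
- rewrite mulrA -ler_pdivlMr; last by rewrite invr_gt0 mulr_gt0.
  rewrite invrK ler_pdivrMl // exchange_big /=.
  apply: le_trans (ler_sum _ (fun z _ =>
    reach_self_mass P_bis (ltnW L_lt_n) al_ge0 danger_small z tL)) _.
  rewrite sumr_const card_ord -[leLHS]mulr_natl le_eqVlt; apply/orP; left; apply/eqP.
  by field; rewrite gt_eqF.
- rewrite exchange_big /= mulr_sumr.
  apply: (@le_trans _ _ (\sum_(z < n) ((4 * n%:R * th) / (M%:R * c)) ^+ k)); last first.
    by rewrite sumr_const card_ord [leRHS]mulr_natl.
  apply: ler_sum => z _; rewrite -mulr_suml.
  have M0 : 0 < M%:R :> R by rewrite ltr0n.
  have := fresh_walkers P_bis th_gt0 th_le1 Mkm th_big z.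
  rewrite -ler_pdivlMl ?exprn_gt0 // => H.
  rewrite mulrA ler_pdivrMr ?exprn_gt0 // ler_pdivrMl //.
  apply: le_trans H _; rewrite expr_div_n [(M%:R * c) ^+ k]exprMn.
  rewrite le_eqVlt; apply/orP; left; apply/eqP.
  move: ((4 * n%:R * th) ^+ k) => w; field.
  by rewrite !expf_eq0 !gt_eqF // !andbF.
rewrite exchange_big /= mulr_sumr.
apply: (@le_trans _ _ (\sum_(x < n) ((4 * m + 2)%:R * al / (d * kap)) ^+ 2)); last first.
  by rewrite sumr_const card_ord [leRHS]mulr_natl.
apply: ler_sum => x _.
set B := ((4 * m + 2)%:R * al) ^+ 2 / kap ^+ 2.
have B0 : 0 <= B by rewrite divr_ge0 ?sqr_ge0.
have rowS : \sum_u (0 < P x u)%R%:R <= d^-1.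
  rewrite -[leRHS]mul1r ler_pdivlMr // -[leRHS](row_sum P_bis x) mulr_suml.
  apply: ler_sum => u _; case: (ltP 0 (P x u)) => [Pu|_]; first by rewrite mul1r P_ge.
  by rewrite mul0r P_ge0.
apply: (@le_trans _ _ (\sum_u \sum_u' (0 < P x u)%R%:R * (0 < P x u')%R%:R * B)).
  rewrite exchange_big /= mulr_sumr; apply: ler_sum => u _.
  rewrite exchange_big /= mulr_sumr; apply: ler_sum => u' _.
  rewrite -mulr_sumr.
  case: (ltP 0 (P x u)) => [xu|_]; last by rewrite !mul0r mulr0.
  case: (ltP 0 (P x u')) => [xu'|_]; last by rewrite !(mul0r, mulr0).
  have [uu'|uu'] := boolP (u != u'); last by rewrite !mul1r mul0r mulr0.
  rewrite !mul1r ler_pdivrMl // -mulr_suml /B mulrA ler_wpM2r ?invr_ge0 ?sqr_ge0 //.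
  by have := two_children_mass P_bis (ltnW L_lt_n) al_ge0 danger_small mL xu xu' uu'.
under eq_bigr => u _ do rewrite -mulr_suml -mulr_sumr.
rewrite -mulr_suml -mulr_suml.
apply: (@le_trans _ _ (d^-1 * d^-1 * B)).
  by rewrite ler_wpM2r // ler_pM // sumr_ge0.
rewrite /B le_eqVlt; apply/orP; left; apply/eqP; field.
by rewrite !gt_eqF.
Qed.

End Upper.

Lemma lower_failure t eps : (0 < n)%N -> eps < 1 ->
  uniform_perm_prob R [pred s | tv_worst (permuted_chain P s) t <= eps] <=
  (n`!)%:R^-1 * (\sum_z \sum_s (1 - dist P s t z)) / (n%:R * (1 - eps)).
Proof.
move=> n0 e1; have e1' : 0 < 1 - eps by rewrite subr_gt0.
have n0' : 0 < n%:R :> R by rewrite ltr0n.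
have H s : ([pred s | tv_worst (permuted_chain P s) t <= eps] s)%:R <=
    (\sum_z (1 - dist P s t z)) / (n%:R * (1 - eps)).
  rewrite /=; case: (leP (tv_worst _ _) eps) => [le_eps|_]; last first.
    apply: divr_ge0; last by rewrite mulr_ge0 // ltW.
    by apply: sumr_ge0 => z _; rewrite subr_ge0 dist_le1.
  rewrite ler_pdivlMr ?mulr_gt0 // mul1r.
  apply: (@le_trans _ _ (\sum_(z < n) (1 - eps))).
    by rewrite sumr_const card_ord [leLHS]mulr_natl.
  by apply: ler_sum => z _; rewrite lerD2l lerN2 (le_trans (le_tv_worst s t z)).
apply: le_trans (perm_prob_le H) _.
by rewrite -mulr_suml mulrA exchange_big.
Qed.

End FixedSize.

(** * Error terms for a fixed size *)

Section SizeArithmetic.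
Variables (K N : nat).
Hypothesis N_gt0 : (0 < N)%N.
Local Notation L := ((6 * K + 2) * N)%N.
Local Notation B := (20 * K.+1 * N)%N.

(** [N] will be about log n, and times are at most [K * N]. [L] bounds the queries of every
    exploration, [t + t] or [4 * m + 2], and [B] absorbs all polynomial factors. *)
Lemma sizes_bound : [/\ (0 < L)%N, (2 * L <= B)%N, (L <= B)%N & (6 * N <= B)%N].
Proof. by split; nia. Qed.

Lemma sizes_time t : (t <= K * N)%N -> (t + t <= L)%N /\ (t <= L)%N.
Proof. by split; nia. Qed.

Lemma sizes_prefix m : (m <= K * N)%N ->
  [/\ (4 * m + 2 <= L)%N, (m.+1 <= K.+1 * N)%N & (N + N * m <= B ^ 2)%N].
Proof.
move=> mK; have m1 : (m.+1 <= K.+1 * N)%N by nia.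
split => //; first nia.
have -> : (N + N * m = N * m.+1)%N by rewrite mulnS.
have NB : (N <= B)%N by nia.
have mB : (m.+1 <= B)%N by nia.
exact: leq_mul.
Qed.

End SizeArithmetic.

Lemma double_lt L n : (0 < L)%N -> (2 * L <= n)%N -> (L < n)%N.
Proof. lia. Qed.

Lemma subnK3 n a b : (a + b <= n)%N -> (n - (a + b) + a + b <= n)%N.
Proof. lia. Qed.

Lemma average_le (F : realFieldType) (f n d S b : F) : 0 < f -> 0 < n -> 0 < d ->
  S <= f * n * b -> f^-1 * S / (n * d) <= b / d.
Proof.
move=> f0 n0 d0 Sb; rewrite ler_pdivrMr ?mulr_gt0 // ler_pdivrMl //.
apply: le_trans Sb _; rewrite le_eqVlt; apply/orP; left; apply/eqP; field.
exact: lt0r_neq0.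
Qed.

Section Sizes.
Variables (R : realType) (n : nat) (P : 'M[R]_n).
Hypothesis P_bis : bistochastic P.
Variables (K N m t : nat) (l g sg D eta : R).
Local Notation h := (entropy_rate P).
Hypotheses (l_gt0 : 0 < l) (nE : n%:R = expR l).
Hypotheses (N_gt0 : (0 < N)%N) (g_ge0 : 0 <= g) (g_le : g <= 12^-1).
Hypothesis P_ge : forall x u, 0 < P x u -> expR (- g * l) <= P x u.
Hypotheses (tK : (t <= K * N)%N) (mK : (m <= K * N)%N).
Let B : R := (20 * K.+1 * N)%:R.
Hypotheses (sg_le : sg <= 2^-1) (B_small : B ^+ 22 * expR (- (l / 2)) <= sg).
Hypotheses (eta_gt0 : 0 < eta) (eta_le1 : eta <= 1).
Hypothesis eta_small : expR (- (eta / 4) * l) <= sg.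

Let L := ((6 * K + 2) * N)%N.
Let al : R := 2 * L%:R / (expR (- g * l) ^+ 2 * n%:R).
Let lam : R := eta / 4 * l.

Let B_ge1 : 1 <= B. Proof.
have [L0 _ LB _] := sizes_bound K N_gt0.
by rewrite ler1n; exact: leq_trans LB.
Qed.
Let B_gt0 : 0 < B. Proof. exact: lt_le_trans B_ge1. Qed.
Let n_gt0 : 0 < n%:R :> R. Proof. by rewrite nE expR_gt0. Qed.

(** The collision errors are a power of [B] times a power of [n]. The worst is [B ^+ 20] with
    [n^(6g - 1)] in [child_small]; the bound [g <= 12^-1] makes its exponent at most [-1/2]. *)
Let small_power a (y : R) : (a <= 22)%N -> y <= - (l / 2) -> B ^+ a * expR y <= sg.
Proof.
move=> a22 yl; apply: le_trans B_small; apply: ler_pM; rewrite ?exprn_ge0 ?expR_ge0 //.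
  exact: ler_weXn2l.
by rewrite ler_expR.
Qed.

Let L2_le : 2 * L%:R <= B.
Proof. by rewrite -natrM ler_nat; have [] := sizes_bound K N_gt0. Qed.

Let B2_le_n : B ^+ 3 <= sg * n%:R.
Proof.
have := @small_power 3 (- l) isT; rewrite expRN -nE ler_pdivrMr //.
by apply; have := l_gt0; lra.
Qed.

Let B_le_n : B <= sg * n%:R.
Proof.
apply: le_trans B2_le_n; rewrite -[leLHS]expr1; exact: ler_weXn2l.
Qed.

Let Bsq_le_n : B ^+ 2 <= sg * n%:R.
Proof. by apply: le_trans B2_le_n; exact: ler_weXn2l. Qed.

Let sg_ge0 : 0 <= sg.
Proof. by apply: le_trans B_small; rewrite mulr_ge0 ?expR_ge0 // exprn_ge0 // ltW. Qed.

Let L_half : 2 * L%:R <= n%:R :> R.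
Proof.
apply: le_trans L2_le _; apply: le_trans B_le_n _; rewrite ler_piMl //.
by apply: le_trans sg_le _; rewrite invf_le1 // ler1n.
Qed.

Let L_lt_n : (L < n)%N.
Proof.
have [L0 _ _ _] := sizes_bound K N_gt0; apply: double_lt => //.
by have := L_half; rewrite -natrM ler_nat.
Qed.

Let alE : al = 2 * L%:R * expR (2 * g * l - l).
Proof.
rewrite /al nE -expRM_natl -expRD -expRN; congr (_ * expR _); ring.
Qed.

Let al_ge0 : 0 <= al.
Proof. by rewrite alE !mulr_ge0 // expR_ge0. Qed.

Let al_le : al <= B * expR (2 * g * l - l).
Proof. by rewrite alE ler_wpM2r // expR_ge0. Qed.

Let gl_le : g * l <= l / 12.
Proof. by rewrite mulrC ler_wpM2l // ltW. Qed.

Let gl_ge0 : 0 <= g * l. Proof. by rewrite mulr_ge0 // ltW. Qed.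

Let danger_small x hist : (size hist < L)%N ->
  #|danger P x hist|%:R <= al * (n - size hist)%:R.
Proof.
move=> hL; have d0 := expR_gt0 (- g * l).
apply: le_trans (card_danger P_bis x hist d0 P_ge) _.
have nh : n%:R / 2 <= (n - size hist)%:R :> R.
  rewrite natrB; last by apply/ltnW/(ltn_trans hL).
  have : (size hist)%:R <= L%:R :> R by rewrite ler_nat ltnW.
  have := L_half; lra.
apply: (@le_trans _ _ (al * (n%:R / 2))); last by rewrite ler_wpM2l.
have -> : al * (n%:R / 2) = L%:R / expR (- g * l) ^+ 2.
  by rewrite /al; field; rewrite !gt_eqF.
by rewrite ler_wpM2r ?invr_ge0 ?sqr_ge0 // ler_nat.
Qed.

Let ln_le x u : 0 < P x u -> - ln (P x u) <= g * l.
Proof.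
move=> Pu; rewrite lerNl -mulNr -[leLHS]expRK ler_ln ?posrE ?expR_gt0 //.
exact: P_ge.
Qed.

Let t2_le_L : (t + t <= L)%N. Proof. by have [] := sizes_time N_gt0 tK. Qed.
Let t_le_L : (t <= L)%N. Proof. by have [] := sizes_time N_gt0 tK. Qed.
Let m_le_L : (4 * m + 2 <= L)%N. Proof. by have [] := sizes_prefix N_gt0 mK. Qed.
Let L_le_B : L%:R <= B.
Proof. by rewrite ler_nat; have [] := sizes_bound K N_gt0. Qed.
Let N_le_B : N%:R <= B.
Proof.
have [_ _ _ NB] := sizes_bound K N_gt0.
by rewrite ler_nat; apply: leq_trans NB; rewrite leq_pmull.
Qed.

Let nat_le_B i : (i <= L)%N -> i%:R <= B.
Proof. by move=> iL; apply: le_trans L_le_B; rewrite ler_nat. Qed.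

Let t_al : t%:R * al <= sg.
Proof.
apply: (@le_trans _ _ (B ^+ 2 * expR (2 * g * l - l))).
  by rewrite expr2 -mulrA ler_pM ?nat_le_B.
apply: small_power => //; have := gl_le; have := l_gt0; lra.
Qed.

Let t2_al : t%:R ^+ 2 * al <= sg.
Proof.
apply: (@le_trans _ _ (B ^+ 3 * expR (2 * g * l - l))).
  rewrite [B ^+ 3]exprSr -mulrA ler_pM ?exprn_ge0 // lerXn2r ?nnegrE ?nat_le_B ?(ltW B_gt0) //.
apply: small_power => //; have := gl_le; have := l_gt0; lra.
Qed.

Let coll2_small : n%:R * ((t + t)%:R * al) ^+ 2 <= sg.
Proof.
apply: (@le_trans _ _ (n%:R * (B * (B * expR (2 * g * l - l))) ^+ 2)).
  rewrite ler_wpM2l ?(ltW n_gt0) // lerXn2r ?nnegrE ?mulr_ge0 ?expR_ge0 ?(ltW B_gt0) //.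
  by rewrite ler_pM ?nat_le_B.
have -> : n%:R * (B * (B * expR (2 * g * l - l))) ^+ 2 =
    B ^+ 4 * expR (4 * g * l - l).
  rewrite mulrA exprMn -expRM_natl nE mulrCA -expRD; congr (_ * expR _); ring.
apply: small_power => //; have := gl_le; have := l_gt0; lra.
Qed.

(** Bernoulli's inequality with [y = L / n]: the total loss is of order [L^2 / n]. *)
Let rho_le : (n%:R / (n - L)%:R) ^+ (t + t) <= 1 + sg.
Proof.
have nL : 0 < (n - L)%:R :> R by rewrite ltr0n subn_gt0.
set y := L%:R / n%:R : R.
have y0 : 0 <= y by rewrite divr_ge0 // ltW.
have y1 : y <= 1 by rewrite ler_pdivrMr // mul1r ler_nat ltnW.
have yE : n%:R / (n - L)%:R = (1 - y)^-1.
  rewrite natrB ?(ltnW L_lt_n) // /y; field.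
  by rewrite gt_eqF //= -natrB ?gt_eqF // ltnW.
have y_lt1 : 0 < 1 - y by rewrite -invr_gt0 -yE divr_gt0.
have bern i : 1 - i%:R * y <= (1 - y) ^+ i.
  elim: i => [|i IH]; first by rewrite mul0r subr0.
  rewrite exprS; apply: (@le_trans _ _ ((1 - y) * (1 - i%:R * y))).
    have : 0 <= y * (i%:R * y) by rewrite !mulr_ge0.
    by rewrite -natr1; nra.
  by rewrite ler_wpM2l // ltW.
have ty : (t + t)%:R * y <= sg / 2.
  rewrite mulrA ler_pdivrMr //.
  have : (t + t)%:R * L%:R <= L%:R * L%:R :> R by rewrite ler_wpM2r // ler_nat.
  have : (2 * L%:R) * (2 * L%:R) <= B * B by rewrite ler_pM // mulr_ge0.
  have : 0 <= sg * n%:R by rewrite mulr_ge0.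
  have := Bsq_le_n; rewrite expr2; nra.
rewrite yE exprVn -[leRHS]invrK lef_pV2 ?posrE ?exprn_gt0 ?invr_gt0 //; last first.
  by rewrite ltr_wpDr.
apply: le_trans (bern _).
apply: (@le_trans _ _ (1 - sg / 2)); last by lra.
rewrite -div1r ler_pdivrMr ?ltr_wpDr //.
by have := sg_ge0; have := sg_le; nra.
Qed.

Let rho_t_le : (n%:R / (n - L)%:R) ^+ t <= 2 :> R.
Proof.
apply: (@le_trans _ _ (1 + sg)); last by have := sg_le; lra.
apply: le_trans rho_le; apply: ler_weXn2l; last exact: leq_addr.
by rewrite ler_pdivlMr ?ltr0n ?subn_gt0 // mul1r ler_nat leq_subr.
Qed.

Let lam_gt0 : 0 < lam. Proof. by rewrite mulr_gt0 // divr_gt0. Qed.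

(** The 96 is 2 for [rho ^+ t], 3 for the bound on [t * h], and 16 from [lam = eta / 4 * l]. *)
Let bad_mass_le : t%:R * h <= 3 * l ->
  bad_mass P L al (g * l) t lam <= sg + 96 * g / eta ^+ 2.
Proof.
move=> th; rewrite /bad_mass lerD //.
have h0 : 0 <= h := entropy_ge0 P_bis L_lt_n.
rewrite ler_pdivrMr ?exprn_gt0 //.
apply: (@le_trans _ _ (2 * (g * l * (3 * l)))).
  apply: le_trans (_ : 2 * (t%:R * (g * l * h)) <= _).
    by rewrite ler_wpM2r // mulr_ge0 // mulr_ge0.
  by rewrite ler_wpM2l // mulrCA ler_wpM2l.
rewrite le_eqVlt; apply/orP; left; apply/eqP; rewrite /lam; field.
by rewrite gt_eqF.
Qed.

Lemma lower_time_failure eps : eps < 1 -> t%:R * h <= (1 - eta / 2) * l ->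
  uniform_perm_prob R [pred s | tv_worst (permuted_chain P s) t <= eps] <=
  (2 * sg + 96 * g / eta ^+ 2) / (1 - eps).
Proof.
move=> e1 th; have e1' : 0 < 1 - eps by rewrite subr_gt0.
have n0 : (0 < n)%N by rewrite -(ltr0n R).
have f0 : 0 < (n`!)%:R :> R by rewrite ltr0n fact_gt0.
apply: le_trans (lower_failure P_bis t n0 e1) _.
(* Midway between the weight scale [n^-(1 - eta/2)] and [n^-1]: both the typical deviation [lam] and
   the exponent of [1 / (n tau)] get a margin [eta / 4]. *)
pose tau := expR (- (1 - eta / 4) * l).
have ltau : lam <= - ln tau - t%:R * h by rewrite /tau expRK /lam; lra.
have := avg_dist_lower P_bis L_lt_n al_ge0 danger_small ln_le (expR_gt0 _) lam_gt0
  t_le_L ltau.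
move/(average_le f0 n_gt0 e1')/le_trans; apply.
rewrite ler_wpM2r ?invr_ge0 ?(ltW e1') //.
have -> : 2 * sg + 96 * g / eta ^+ 2 = sg + (sg + 96 * g / eta ^+ 2) by ring.
apply: lerD.
  rewrite nE /tau -expRD -expRN; apply: le_trans eta_small.
  by rewrite ler_expR; lra.
apply: bad_mass_le; have := eta_gt0; have := l_gt0; nra.
Qed.

Section Upper.
Variables (j : nat) (eps e : R).
Hypotheses (P_le : forall x u, P x u <= D) (D_ge0 : 0 <= D) (D_le1 : D <= 1).
Hypothesis D_m : D ^+ m.+1 <= N%:R ^- 8.
Hypothesis N_large : (20 * K.+1)%:R / N%:R <= sg.
Hypothesis l_le_N : l <= N%:R.
Hypotheses (eps_gt0 : 0 < eps) (eps_le1 : eps <= 1).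
Hypothesis D_j : D ^+ j <= eps / 4.
Hypothesis sg_eps : sg <= eps / 4.
(** With [M >= n / 2], the choice of [th] gives [4 n th / (M c) <= expR (- 2)]. Two copies of [rho0]
    use half of [th^2], leaving the rest to the perturbation error, and [beta] turns [beta / 2] into
    [e / 2] after division by [rho0]. *)
Let c := eps / 4.
Let th := c * expR (- 2) / 8.
Let rho0 := th ^+ 2 / 4.
Let beta := rho0 * e.
Hypothesis e_gt0 : 0 < e.
Hypothesis sg_th : sg <= th ^+ 2 / 2.
Hypotheses (th_lower : (1 + eta / 2) * l <= t%:R * h) (th_upper : t%:R * h <= 3 * l).

Let c_gt0 : 0 < c. Proof. by rewrite divr_gt0. Qed.
Let th_gt0 : 0 < th. Proof. by rewrite divr_gt0 // mulr_gt0 // expR_gt0. Qed.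
Let rho0_gt0 : 0 < rho0. Proof. by rewrite divr_gt0 // exprn_gt0. Qed.
Let beta_gt0 : 0 < beta. Proof. by rewrite mulr_gt0. Qed.
Let N_gt0' : 0 < N%:R :> R. Proof. by rewrite ltr0n. Qed.
Let N_ge1 : 1 <= N%:R :> R. Proof. by rewrite ler1n. Qed.

Let th_le1 : th <= 1.
Proof.
have e2 : expR (- 2) <= 1 :> R by rewrite -expR0 ler_expR oppr_le0.
have c1 : c <= 1 by rewrite /c; have := eps_le1; lra.
rewrite /th ler_pdivrMr // mul1r; apply: le_trans (_ : 1 * 1 <= 8); last by lra.
by rewrite ler_pM ?expR_ge0 // ltW.
Qed.

Let km : (N + N * m)%:R <= n%:R / 2 :> R.
Proof.
apply: (@le_trans _ _ (B ^+ 2)).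
  by rewrite -natrX ler_nat; have [] := sizes_prefix N_gt0 mK.
apply: le_trans Bsq_le_n _; rewrite mulrC ler_wpM2l ?(ltW n_gt0) //.
Qed.

Let M := (n - (N + N * m))%N.

Let M_ge : n%:R / 2 <= M%:R :> R.
Proof.
have := km; rewrite /M natrB; first lra.
by rewrite -(ler_nat R) (le_trans km) // ler_pdivrMr // ler_peMr ?(ltW n_gt0) // ler1n.
Qed.

(** With [kap = N^-8], atoms are at most [ka = 2 N^-4]; with [kb = N^-2], [N] walkers of length
    [O(K N)] then lose a mass [O(K / N)] in total. *)
Let loss_le : loss m (N%:R ^- 8) (2 * N%:R ^- 4) (N%:R ^- 2) N <= sg.
Proof.
apply: le_trans N_large; rewrite /loss.
have mN : m.+1%:R <= K.+1%:R * N%:R :> R by rewrite -natrM ler_nat; have [] := sizes_prefix N_gt0 mK.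
set w := N%:R^-1 : R.
have w0 : 0 <= w by rewrite invr_ge0.
have w1 : w <= 1 by rewrite invf_le1.
have wN : w * N%:R = 1 by rewrite mulVf // gt_eqF.
have -> : N%:R ^- 8 = w ^+ 8 by rewrite exprVn.
have -> : N%:R ^- 4 = w ^+ 4 by rewrite exprVn.
have -> : N%:R ^- 2 = w ^+ 2 by rewrite exprVn.
have w2N : (w ^+ 2)^-1 = N%:R ^+ 2 by rewrite exprVn invrK.
rewrite w2N.
have p8 : w ^+ 8 <= w by rewrite -[leRHS]expr1 ler_wiXn2l.
have A1 : 2 * w ^+ 4 * m.+1%:R * N%:R ^+ 2 <= 2 * K.+1%:R * w.
  apply: (@le_trans _ _ (2 * w ^+ 4 * (K.+1%:R * N%:R) * N%:R ^+ 2)).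
    by rewrite ler_wpM2r ?sqr_ge0 // ler_wpM2l // mulr_ge0 // exprn_ge0.
  have -> : 2 * w ^+ 4 * (K.+1%:R * N%:R) * N%:R ^+ 2 =
     2 * K.+1%:R * w * (w * N%:R) ^+ 3 by ring.
  by rewrite wN expr1n mulr1.
have A2 : N%:R * (m.+1%:R * (2 * w ^+ 4) + w ^+ 2) <= 2 * K.+1%:R * w + w.
  rewrite mulrDr; apply: lerD.
    apply: (@le_trans _ _ (N%:R * (K.+1%:R * N%:R * (2 * w ^+ 4)))).
      by rewrite ler_wpM2l // ler_wpM2r // mulr_ge0 // exprn_ge0.
    have -> : N%:R * (K.+1%:R * N%:R * (2 * w ^+ 4)) =
       2 * K.+1%:R * w * (w * N%:R) ^+ 2 * w by ring.
    by rewrite wN expr1n mulr1 ler_piMr // mulr_ge0.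
  by rewrite expr2 mulrA [N%:R * w]mulrC wN mul1r.
rewrite natrM; apply: le_trans (lerD (lerD p8 A1) A2) _.
have : w <= K.+1%:R * w by rewrite ler_peMl // ler1n.
have : 0 <= K.+1%:R * w by rewrite mulr_ge0.
by rewrite -/w; lra.
Qed.

(** Since [N >= log n], the [N]-th power of [expR (- 2)] is at most [n^-2], which beats the union
    over [n] starting points. *)
Let th_power : n%:R * ((4 * n%:R * th) / (M%:R * c)) ^+ N <= expR (- l).
Proof.
have M0 : 0 < M%:R :> R by apply: lt_le_trans M_ge; rewrite divr_gt0.
have base : (4 * n%:R * th) / (M%:R * c) <= expR (- 2).
  rewrite ler_pdivrMr; last by rewrite mulr_gt0.
  have -> : 4 * n%:R * th = (n%:R / 2) * (c * expR (- 2)) by rewrite /th; field.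
  by rewrite [leRHS]mulrC -[leRHS]mulrA ler_wpM2r // mulr_ge0 ?expR_ge0 ?(ltW c_gt0).
apply: (@le_trans _ _ (n%:R * expR (- 2) ^+ N)).
  rewrite ler_wpM2l ?(ltW n_gt0) // lerXn2r ?nnegrE ?expR_ge0 //.
  apply: divr_ge0; first by rewrite mulr_ge0 ?(ltW th_gt0) // mulr_ge0 ?(ltW n_gt0).
  by rewrite mulr_ge0 // ltW.
rewrite nE -expRM_natl -expRD ler_expR; have := l_le_N; lra.
Qed.

Let child_small :
  n%:R * ((4 * m + 2)%:R * al / (expR (- g * l) * N%:R ^- 8)) ^+ 2 <= sg.
Proof.
have N8 : N%:R ^+ 8 <= B ^+ 8.
  by rewrite lerXn2r ?nnegrE ?(ltW B_gt0).
apply: (@le_trans _ _ (n%:R * (B * (B * expR (2 * g * l - l)) *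
    (expR (g * l) * B ^+ 8)) ^+ 2)).
  rewrite invfM invrK mulNr expRN invrK.
  rewrite ler_wpM2l ?(ltW n_gt0) //.
  have h1 : 0 <= (4 * m + 2)%:R * al * (expR (g * l) * N%:R ^+ 8).
    by rewrite !mulr_ge0 ?expR_ge0 // exprn_ge0.
  rewrite lerXn2r ?nnegrE //.
    by rewrite !mulr_ge0 ?expR_ge0 ?exprn_ge0 ?(ltW B_gt0).
  apply: ler_pM; rewrite ?mulr_ge0 ?expR_ge0 ?exprn_ge0 //.
    by rewrite ler_pM ?nat_le_B.
  by rewrite ler_wpM2l ?expR_ge0.
have -> : n%:R * (B * (B * expR (2 * g * l - l)) * (expR (g * l) * B ^+ 8)) ^+ 2 =
    B ^+ 20 * expR (6 * g * l - l).
  have -> : B * (B * expR (2 * g * l - l)) * (expR (g * l) * B ^+ 8) =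
      B ^+ 10 * expR (3 * g * l - l).
    have -> : expR (3 * g * l - l) = expR (2 * g * l - l) * expR (g * l).
      by rewrite -expRD; congr expR; ring.
    ring.
  rewrite exprMn -expRM_natl nE mulrCA -expRD -exprM; congr (_ * expR _); ring.
apply: small_power => //; have := gl_le; have := l_gt0; lra.
Qed.

Lemma upper_time_failure :
  uniform_perm_prob R [pred s | eps < tv_worst (permuted_chain P s) (m.+1 + t + j)]
  <= e / 2 + (8 * sg + 192 * g / eta ^+ 2) / (2 * beta * rho0) + sg / rho0 +
     expR (- l) + sg.
Proof.
have f0 : 0 < (n`!)%:R :> R by rewrite ltr0n fact_gt0.
pose tau := expR (- (1 + eta / 4) * l).
have ltau : lam <= t%:R * h + ln tau.
  by rewrite /tau expRK /lam; have := th_lower; lra.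
have := avg_dist_upper P_bis L_lt_n al_ge0 danger_small ln_le (expR_gt0 _) lam_gt0
  beta_gt0 t2_le_L ltau => HS.
have ka0 : 0 <= 2 * N%:R ^- 4 :> R by rewrite mulr_ge0 // invr_ge0 exprn_ge0.
have kap0 : 0 < N%:R ^- 8 :> R by rewrite invr_gt0 exprn_gt0.
have kb0 : 0 < N%:R ^- 2 :> R by rewrite invr_gt0 exprn_gt0.
have atom : N%:R ^- 8 + D ^+ m.+1 <= (2 * N%:R ^- 4) ^+ 2.
  rewrite exprMn exprVn -exprM -[(4 * 2)%N]/8%N; have := D_m.
  by have := ltW kap0; lra.
have eps_ge : D ^+ j + (c + loss m (N%:R ^- 8) (2 * N%:R ^- 4) (N%:R ^- 2) N) <= eps.
  have := loss_le; have := D_j; have := sg_eps; have := eps_gt0; rewrite /c.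
  move: (D ^+ j) (loss _ _ _ _ _) => dj lo; lra.
have M0 : (0 < M)%N.
  by rewrite -(ltr0n R); apply: lt_le_trans M_ge; rewrite divr_gt0.
have Mkm : (M + N + N * m <= n)%N.
  have : (N + N * m <= n)%N.
    by rewrite -(ler_nat R) (le_trans km) // ler_pdivrMr // ler_peMr ?(ltW n_gt0) // ler1n.
  exact: subnK3.
have th_big : n%:R * (rho0 + rho0) + 6 * N%:R * t%:R ^+ 2 <= n%:R * th ^+ 2.
  have : 6 * N%:R * t%:R ^+ 2 <= B ^+ 3.
    rewrite [B ^+ 3]exprS ler_pM ?mulr_ge0 ?sqr_ge0 //.
      by rewrite -natrM ler_nat; have [] := sizes_bound K N_gt0.
    by rewrite lerXn2r ?nnegrE ?nat_le_B ?(ltW B_gt0).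
  have : sg * n%:R <= th ^+ 2 / 2 * n%:R by rewrite ler_wpM2r // ltW.
  by have := B2_le_n; rewrite /rho0; lra.
apply: le_trans (upper_failure P_bis L_lt_n al_ge0 danger_small (expR_gt0 _) P_ge
  P_le D_ge0 D_le1 m_le_L t_le_L th_gt0 th_le1 M0 Mkm th_big rho0_gt0 rho0_gt0
  c_gt0 kap0 kb0 ka0 atom eps_ge) _.
rewrite lerD ?child_small // lerD // lerD //; last first.
  by rewrite ler_wpM2r // invr_ge0 ltW.
move/(average_le f0 n_gt0 rho0_gt0)/le_trans: HS; apply.
rewrite ler_pdivrMr //.
have -> : (e / 2 + (8 * sg + 192 * g / eta ^+ 2) / (2 * beta * rho0)) * rho0 =
    beta / 2 + (8 * sg + 2 * (96 * g / eta ^+ 2)) / (2 * beta).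
  by rewrite /beta; field; rewrite !gt_eqF.
rewrite lerD2l ler_wpM2r ?invr_ge0 ?mulr_ge0 ?(ltW beta_gt0) ?(ltW eps_gt0) ?(ltW e_gt0) //.
have n_tau : n%:R * tau <= sg.
  by rewrite nE /tau -expRD; apply: le_trans eta_small; rewrite ler_expR; lra.
have := bad_mass_le th_upper; have := t_al; have := coll2_small; have := rho_le.
move: n_tau sg_ge0; rewrite -/tau; move: (bad_mass _ _ _ _ _ _) (n%:R * tau) (_ ^+ (t + t)).
move: (96 * g / _) (n%:R * _ ^+ 2) (t%:R * al) => X C A bm nt r; lra.
Qed.

End Upper.

End Sizes.

(** * Polynomials in log n against powers of n *)

Section Growth.
Variable R : realType.

(* [l + 1] is at most [b^-1 * expR (b * (l + 1))], so its [k+1]-st power grows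
   slower than [expR (a * l)] when [b = a / (k+1)]. *)
Lemma poly_exp_small (k : nat) (C a sg : R) : 0 <= C -> 0 < a -> 0 < sg ->
  exists l0, forall l, l0 <= l -> (C * (l + 1)) ^+ k * expR (- (a * l)) <= sg.
Proof.
move=> C0 a0 sg0; pose b := a / k.+1%:R.
have k0 : 0 < k.+1%:R :> R by rewrite ltr0n.
have b0 : 0 < b by rewrite divr_gt0.
pose W := C ^+ k * (b ^- k.+1 * expR a).
have W0 : 0 <= W by rewrite !mulr_ge0 ?exprn_ge0 ?expR_ge0 // invr_ge0 exprn_ge0 // ltW.
exists (W / sg) => l; rewrite ler_pdivrMr // => lW.
have l0 : 0 <= l by rewrite -(pmulr_lge0 _ sg0); exact: le_trans lW.
have l1 : 0 < l + 1 by rewrite ltr_wpDl.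
have H : b * (l + 1) <= expR (b * (l + 1)).
  by apply: le_trans (expR_ge1Dx _); rewrite lerDr.
have pw : (l + 1) ^+ k.+1 <= b ^- k.+1 * (expR a * expR (a * l)).
  rewrite -expRD ler_pdivlMl ?exprn_gt0 // -exprMn.
  have -> : a + a * l = k.+1%:R * (b * (l + 1)) by rewrite /b; field; rewrite gt_eqF.
  by rewrite expRM_natl lerXn2r ?nnegrE ?expR_ge0 // mulr_ge0 // ltW.
rewrite -(ler_pM2r l1); apply: (@le_trans _ _ W); last first.
  by apply: le_trans lW _; rewrite mulrC ler_wpM2l ?lerDl // ltW.
have -> : (C * (l + 1)) ^+ k * expR (- (a * l)) * (l + 1) =
    C ^+ k * ((l + 1) ^+ k.+1 * expR (- (a * l))).
  rewrite exprMn exprSr; ring.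
rewrite /W ler_wpM2l ?exprn_ge0 // expRN ler_pdivrMr ?expR_gt0 //.
by rewrite -mulrA.
Qed.

Lemma ln_nat_ge (A : R) : \forall n \near \oo, A <= ln n%:R.
Proof.
near=> n; have An : expR A <= n%:R by near: n; exact: nbhs_infty_ger.
by rewrite -[leLHS]expRK ler_ln ?posrE ?expR_gt0 // (lt_le_trans _ An) // expR_gt0.
Unshelve. all: by end_near. Qed.

End Growth.

(** * From failure probabilities to the mixing time *)

Section MixingWindow.
Variables (R : realType) (n : nat) (P : 'M[R]_n).
Hypothesis P_bis : bistochastic P.
Local Notation h := (entropy_rate P).
Local Notation mix s eps := (mixing_time (permuted_chain P s) eps).

Lemma mixing_time_le s eps T : tv_worst (permuted_chain P s) T <= eps ->
  (mix s eps <= T%:R%:E)%E.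
Proof. by move=> H; apply: ereal_inf_lbound; exists T. Qed.

Lemma mixing_time_gt s eps t : eps < tv_worst (permuted_chain P s) t ->
  (t.+1%:R%:E <= mix s eps)%E.
Proof.
move=> H; apply: le_ereal_inf_tmp => _ [u /= ue <-]; rewrite lee_fin ler_nat.
rewrite ltnNge; apply/negP => ut; move: ue; rewrite leNgt => /negP; apply.
apply: lt_le_trans H _; rewrite -(subnKC ut); exact: tv_worst_nonincr.
Qed.

(** Not being mixed at [t] puts the mixing time at [t.+1] or later, which absorbs the rounding of
    the lower time. Being mixed at [T] rules out the value [+oo]. *)
Lemma mixing_deviation s (eps eta l : R) t T : 0 < l -> 0 <= h ->
  (1 - eta) * l <= t.+1%:R * h -> T%:R * h <= (1 + eta) * l ->
  (eta%:E < `|h%:E * mix s eps * (l^-1)%:E - 1%:E|)%E ->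
  (eps < tv_worst (permuted_chain P s) T) || (tv_worst (permuted_chain P s) t <= eps).
Proof.
move=> l0 h0 tl Tl; apply: contraTT.
rewrite negb_or -leNgt -ltNge => /andP[/mixing_time_le le_mix /mixing_time_gt mix_le].
rewrite -leNgt; move: le_mix mix_le; case: (mix s eps) => [r||] //.
rewrite !lee_fin => rT tr; rewrite ler_norml.
have tr' : t.+1%:R * h <= h * r by rewrite mulrC ler_wpM2l.
have rT' : h * r <= T%:R * h by rewrite mulrC ler_wpM2r.
by rewrite lerBrDr lerBlDr ler_pdivlMr // ler_pdivrMr //; apply/andP; split; lra.
Qed.

Lemma perm_prob_union (A B C : pred 'S_n) : (forall s, A s -> B s || C s) ->
  uniform_perm_prob R A <= uniform_perm_prob R B + uniform_perm_prob R C.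
Proof.
move=> ABC; rewrite /uniform_perm_prob -mulrDl ler_wpM2r ?invr_ge0 //.
rewrite -natrD ler_nat -cardUI; apply: (@leq_trans #|[predU B & C]|).
  by apply/subset_leq_card/fintype.subsetP => s /ABC.
exact: leq_addr.
Qed.

End MixingWindow.

(** Coefficient of the small parameter in the sum of the upper and lower failure bounds. It depends
    on [eps], [eta] and [e] only, so the parameter can be chosen after it. *)
Definition failure_const (R : realType) (eps eta e : R) : R :=
  let rho := (eps / 4 * expR (- 2) / 8) ^+ 2 / 4 in
  (8 + 192 / eta ^+ 2) / (2 * (rho * e) * rho) + rho^-1 + 2 +
  (2 + 96 / eta ^+ 2) / (1 - eps).

Section Window.
Variables (R : realType) (n : nat) (P : 'M[R]_n).
Hypothesis P_bis : bistochastic P.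
Variables (D eps eta e v g : R) (K j : nat).
Local Notation h := (entropy_rate P).
Let l : R := ln n%:R.
Let h0 := - ln D.
Hypotheses (P_le : forall x u, P x u <= D) (D_gt0 : 0 < D) (D_lt1 : D < 1).
Hypotheses (eps_gt0 : 0 < eps) (eps_lt1 : eps < 1) (e_gt0 : 0 < e).
Hypotheses (eta_gt0 : 0 < eta) (eta_le1 : eta <= 1).
Hypotheses (K_ge : 10 / h0 + 1 <= K%:R) (D_j : D ^+ j <= eps / 4).
Hypotheses (v_gt0 : 0 < v) (v_le : v <= 12^-1) (v_eps : v <= eps / 4).
Hypothesis v_th : v <= (eps / 4 * expR (-2) / 8) ^+ 2 / 2.
Hypotheses (g_gt0 : 0 < g) (g_le : g * (16 / h0 + j%:R + 2) <= eta / 2).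
Hypotheses (l_ge2 : 2 <= l) (lnl_ge1 : 1 <= ln l).
Hypothesis P_ge : forall x u, 0 < P x u -> expR (- v * l) <= P x u.
Hypotheses (h_ge : h0 <= h) (h_small : h * ln l <= g * l).
Hypothesis poly_small : ((20 * K.+1)%:R * (l + 1)) ^+ 22 * expR (- (2^-1 * l)) <= v.
Hypothesis l_large : (20 * K.+1)%:R / v <= l.
Hypothesis exp_small : - ln v <= eta / 4 * l.

Let N := (Num.truncn l).+1.
Let l_gt0 : 0 < l. Proof. by apply: lt_le_trans l_ge2. Qed.
Let h0_gt0 : 0 < h0. Proof. by rewrite oppr_gt0 ln_lt0 // D_gt0. Qed.
Let h_gt0 : 0 < h. Proof. exact: lt_le_trans h_ge. Qed.
Let l_le_N : l <= N%:R. Proof. exact/ltW/truncnS_gt. Qed.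
Let N_le : N%:R <= l + 1.
Proof. by rewrite /N -natr1 lerD2r truncn_le ltW. Qed.
Let N_gt0 : 0 < N%:R :> R. Proof. by rewrite ltr0n. Qed.

Let nE : n%:R = expR l.
Proof.
rewrite lnK // posrE ltr0n lt0n; apply/eqP => n0.
by move: l_gt0; rewrite /l n0 ln0 ?ltxx.
Qed.

Let B_small : (20 * K.+1 * N)%:R ^+ 22 * expR (- (l / 2)) <= v.
Proof.
apply: le_trans poly_small; rewrite [2^-1 * l]mulrC ler_wpM2r ?expR_ge0 //.
rewrite lerXn2r ?nnegrE //; first by rewrite mulr_ge0 // ltW // ltr_wpDr.
by rewrite natrM ler_wpM2l.
Qed.

Let N_large : (20 * K.+1)%:R / N%:R <= v.
Proof.
rewrite ler_pdivrMr //; apply: le_trans (ler_wpM2l (ltW v_gt0) l_le_N).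
by rewrite mulrC -ler_pdivrMr.
Qed.

Let eta_small : expR (- (eta / 4) * l) <= v.
Proof. by rewrite -[leRHS]lnK ?posrE // ler_expR mulNr lerNl. Qed.

Let lnN_le : ln N%:R <= N%:R :> R.
Proof.
rewrite -ler_expR lnK ?posrE //; apply: le_trans (expR_ge1Dx _).
by rewrite lerDr.
Qed.

Let lnN_ge0 : 0 <= ln N%:R :> R. Proof. by rewrite ln_ge0 // ler1n. Qed.

Let lnN_le2 : ln N%:R <= 2 * ln l.
Proof.
rewrite mulr_natl -lnXn // ler_ln ?posrE ?exprn_gt0 //.
by apply: le_trans N_le _; have := l_ge2; nra.
Qed.

(** Just long enough for [D ^+ m.+1 <= N^-8], hence of order log log n. *)
Let m := Num.truncn (8 * ln N%:R / h0 : R).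

Let m_le : m%:R <= 8 * ln N%:R / h0.
Proof. by rewrite truncn_le divr_ge0 // ?mulr_ge0 // ltW. Qed.

Let D_m : D ^+ m.+1 <= N%:R ^- 8.
Proof.
have H : 8 * ln N%:R <= m.+1%:R * h0 by rewrite -ler_pdivrMr // ltW // truncnS_gt.
rewrite -[D]lnK ?posrE // -[in leRHS](@lnK R N%:R) ?posrE //.
rewrite -!expRM_natl -expRN ler_expR; move: H; rewrite /h0 mulrN; lra.
Qed.

Let div_h0_le (x : R) (i : nat) : 0 <= x -> i%:R <= x / h0 + 1 -> x <= 10 * N%:R ->
  (i <= K * N)%N.
Proof.
move=> x0 ix xN; rewrite -(ler_nat R) natrM; apply: le_trans ix _.
apply: (@le_trans _ _ ((10 / h0 + 1) * N%:R)); last by rewrite ler_wpM2r.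
rewrite mulrDl lerD // ?mul1r ?ler1n // mulrAC ler_wpM2r // invr_ge0; exact: ltW.
Qed.

Let mK : (m <= K * N)%N.
Proof.
apply: (@div_h0_le (8 * ln N%:R)); rewrite ?mulr_ge0 //.
  by apply: le_trans m_le _; rewrite lerDl.
by have := lnN_le; have := N_gt0; lra.
Qed.

Let upper_time := (Num.truncn ((1 + eta / 2) * l / h)).+1.
Let lower_time := Num.truncn ((1 - eta / 2) * l / h).

Let h_le_gl : h <= g * l.
Proof. by apply: le_trans h_small; rewrite ler_peMr // ltW. Qed.

Let g_le4 : g <= 4^-1.
Proof.
have : 0 <= 16 / h0 + j%:R by rewrite addr_ge0 // divr_ge0 // ltW.
by have := g_le; have := g_gt0; have := eta_le1; nra.
Qed.

Let upper_time_ge : (1 + eta / 2) * l <= upper_time%:R * h.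
Proof. by rewrite -ler_pdivrMr // ltW // truncnS_gt. Qed.

Let upper_time_le : upper_time%:R * h <= (1 + eta / 2) * l + h.
Proof.
rewrite /upper_time -natr1 mulrDl mul1r lerD2r -ler_pdivlMr // truncn_le divr_ge0 //.
  by rewrite mulr_ge0 ?ltW // ltr_wpDr // divr_ge0 // ltW.
exact: ltW.
Qed.

Let lower_time_le : lower_time%:R * h <= (1 - eta / 2) * l.
Proof.
rewrite -ler_pdivlMr // truncn_le divr_ge0 //; last exact: ltW.
by rewrite mulr_ge0 ?ltW //; have := eta_le1; lra.
Qed.

Let lower_time_ge : (1 - eta) * l <= lower_time.+1%:R * h.
Proof.
apply: (@le_trans _ _ ((1 - eta / 2) * l)).
  by rewrite ler_wpM2r //; have := eta_gt0; have := l_gt0; lra.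
by rewrite -ler_pdivrMr // ltW // truncnS_gt.
Qed.

(** Here the growth condition on [h] is spent: [ln N <= 2 ln l] turns the walkers' time into
    [16 / h0 * (h * ln l)], of order [g * l]. The 2 in the bound on [g] pays the extra step in
    [m.+1] and the rounding of [upper_time]. *)
Let total_time_le : (m.+1 + upper_time + j)%:R * h <= (1 + eta) * l.
Proof.
have mh : m%:R * h <= 16 / h0 * (g * l).
  apply: (@le_trans _ _ (16 / h0 * (h * ln l))).
    have -> : 16 / h0 * (h * ln l) = (8 * (2 * ln l) / h0) * h by ring.
    rewrite ler_wpM2r ?(ltW h_gt0) //; apply: le_trans m_le _.
    by rewrite ler_wpM2r ?invr_ge0 ?(ltW h0_gt0) // ler_wpM2l.
  by rewrite ler_wpM2l // divr_ge0 // ltW.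
have jh : j%:R * h <= j%:R * (g * l) by rewrite ler_wpM2l.
have gl : g * (16 / h0 + j%:R + 2) * l <= eta / 2 * l by rewrite ler_wpM2r // ltW.
rewrite !natrD -natr1 [leLHS]mulrDl [X in X + _]mulrDl [X in X + _ + _]mulrDl mul1r.
have := upper_time_le; have := h_le_gl.
have glE : g * (16 / h0 + j%:R + 2) * l =
  16 / h0 * (g * l) + j%:R * (g * l) + 2 * (g * l) by ring.
rewrite glE in gl.
move: mh jh gl.
move: (m%:R * h) (j%:R * h) (upper_time%:R * h) => p q r.
move: (16 / h0 * (g * l)) (j%:R * (g * l)) => a b.
move: (g * l) => c; lra.
Qed.

Let time_le (x : R) (i : nat) : 0 <= x -> x <= 2 * l -> i%:R <= x / h + 1 ->
  (i <= K * N)%N.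
Proof.
move=> x0 xl ix; apply: (@div_h0_le x) => //.
  apply: le_trans ix _; rewrite lerD2r ler_wpM2l // lef_pV2 ?posrE //.
by have := l_le_N; have := N_gt0; lra.
Qed.

Let upperK : (upper_time <= K * N)%N.
Proof.
have x0 : 0 <= (1 + eta / 2) * l.
  by rewrite mulr_ge0 ?ltW // ltr_wpDr // divr_ge0 // ltW.
apply: (time_le x0); last first.
  by rewrite /upper_time -natr1 lerD2r truncn_le divr_ge0 // ltW.
by rewrite ler_wpM2r ?ltW //; have := eta_le1; lra.
Qed.

Let lowerK : (lower_time <= K * N)%N.
Proof.
have x0 : 0 <= (1 - eta / 2) * l.
  by rewrite mulr_ge0 ?ltW //; have := eta_le1; lra.
apply: (time_le x0); last first.
  apply: (@le_trans _ _ ((1 - eta / 2) * l / h)); last by rewrite lerDl.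
  by rewrite truncn_le divr_ge0 // ltW.
by rewrite ler_wpM2r ?ltW //; have := eta_gt0; lra.
Qed.

Lemma window_failure :
  uniform_perm_prob R [pred s | (eta%:E <
    `|h%:E * mixing_time (permuted_chain P s) eps * (l^-1)%:E - 1%:E|)%E] <=
  e / 2 + v * failure_const eps eta e.
Proof.
have v2 : v <= 2^-1 by have := v_le; lra.
have th3 : upper_time%:R * h <= 3 * l.
  have gl : g * l <= 4^-1 * l by rewrite ler_wpM2r // ltW.
  have el : eta * l <= 1 * l by rewrite ler_wpM2r // ltW.
  by have := upper_time_le; have := h_le_gl; have := l_gt0; lra.
(* The parameter [v] serves twice: as the exponent in the lower bound [n^-v] on positive entries and
   as the bound on the error terms. The parameter [g] of this section only measures [h * ln l]
   against [l]. *)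
have Up := upper_time_failure P_bis l_gt0 nE (ltn0Sn _) (ltW v_gt0) v_le P_ge upperK
  mK v2 B_small eta_gt0 eta_small P_le (ltW D_gt0) (ltW D_lt1) D_m N_large
  l_le_N eps_gt0 (ltW eps_lt1) D_j v_eps e_gt0 v_th upper_time_ge th3.
have Lo := lower_time_failure P_bis l_gt0 nE (ltn0Sn _) (ltW v_gt0) v_le P_ge lowerK
  v2 B_small eta_gt0 eta_small eps_lt1 lower_time_le.
apply: le_trans (@perm_prob_union _ _ _
  [pred s | eps < tv_worst (permuted_chain P s) (m.+1 + upper_time + j)]
  [pred s | tv_worst (permuted_chain P s) lower_time <= eps] _) _.
  by move=> s; apply: mixing_deviation => //; exact: ltW.
apply: le_trans (lerD Up Lo) _.
have el : expR (- l) <= v.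
  apply: le_trans eta_small; rewrite ler_expR.
  by have := l_gt0; have := eta_le1; nra.
rewrite /failure_const; set rho := _ ^+ 2 / 4.
have rho_gt0 : 0 < rho.
  by rewrite divr_gt0 // exprn_gt0 // divr_gt0 // mulr_gt0 ?expR_gt0 // divr_gt0.
have -> : (8 * v + 192 * v / eta ^+ 2) / (2 * (rho * e) * rho) =
   v * ((8 + 192 / eta ^+ 2) / (2 * (rho * e) * rho)) by ring.
have -> : (2 * v + 96 * v / eta ^+ 2) / (1 - eps) =
   v * ((2 + 96 / eta ^+ 2) / (1 - eps)) by ring.
rewrite !mulrDr; lra.
Qed.

End Window.

(** * Asymptotics *)

Section Entries.
Variables (R : realType) (n : nat) (P : 'M[R]_n).
Hypothesis P_bis : bistochastic P.

(** Every positive entry satisfies [- ln P x u >= - ln D]. A positive lower bound on the entropy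
    keeps the entropic time [O(log n)]. *)
Lemma entropy_ge_of_max (D : R) : (0 < n)%N -> 0 < D -> (forall x u, P x u <= D) ->
  - ln D <= entropy_rate P.
Proof.
move=> n0 D0 PD; rewrite ler_pdivlMl ?ltr0n //.
rewrite mulr_natl -[n in leLHS]card_ord -sumr_const.
apply: ler_sum => x _; rewrite -[leLHS]mul1r -(row_sum P_bis x) mulr_suml.
apply: ler_sum => u _; have := P_ge0 P_bis x u.
rewrite le_eqVlt => /orP[/eqP <-|P0]; first by rewrite !mul0r.
by rewrite ler_wpM2l ?(ltW P0) // lnV ?posrE // lerN2 ler_ln ?posrE.
Qed.

Lemma min_pos_entry_gt0 : 0 < min_pos_entry P.
Proof. by apply/bigmin_gtP; split. Qed.

Lemma min_pos_entry_le x u : 0 < P x u -> min_pos_entry P <= P x u.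
Proof. by move=> P0; apply: (@bigmin_le_cond _ _ _ _ (x, u)). Qed.

Lemma le_max_entry x u : P x u <= max_entry P.
Proof. exact: (@le_bigmax _ _ _ _ (fun xy => P xy.1 xy.2) (x, u)). Qed.

Lemma max_entry_le1 : max_entry P <= 1.
Proof. by apply: bigmax_le => // xy _; apply: P_le1. Qed.

End Entries.

Lemma perm_prob_ge0 (R : realType) n (A : pred 'S_n) : 0 <= uniform_perm_prob R A.
Proof. by rewrite divr_ge0. Qed.

Theorem theorem1 (R : realType) (P : forall n : nat, 'M[R]_n)
  (P_bistochastic : forall n : nat, (2 <= n)%N -> bistochastic (P n))
  (P_min : (fun n : nat => ln (min_pos_entry (P n)) / ln (n%:R : R))
             @ \oo --> (0 : R))
  (P_max : sup [set max_entry (P n) | n in [set n : nat | (2 <= n)%N]] < 1)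
  (P_entropy : (fun n : nat => entropy_rate (P n) : R^o)
                 =o_\oo (fun n : nat => ln (n%:R : R) / ln (ln (n%:R : R)) : R^o))
  (eps : R) (eps_gt0 : 0 < eps) (eps_lt1 : eps < 1) :
  cvg_in_perm_prob
    (fun (n : nat) (s : 'S_n) =>
       (entropy_rate (P n))%:E * mixing_time (permuted_chain (P n) s) eps
         * ((ln (n%:R : R))^-1)%:E)%E
    1.
Proof.
move=> eta0 eta0_gt0; apply/cvgrPdist_le => e e_gt0.
pose eta := Num.min eta0 1.
have eta_gt0 : 0 < eta by rewrite lt_min eta0_gt0 ltr01.
have eta_le1 : eta <= 1 by rewrite ge_min lexx orbT.
pose S := sup [set max_entry (P n) | n in [set n : nat | (2 <= n)%N]].
(* The floor 1/2 secures [0 < D], so that [- ln D] is meaningful. *)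
pose D := Num.max S 2^-1.
have D_gt0 : 0 < D by rewrite lt_max invr_gt0 ltr0n orbT.
have D_lt1 : D < 1 by rewrite gt_max P_max invf_lt1 // ltr1n.
have P_le n : (2 <= n)%N -> forall x u, P n x u <= D.
  move=> n2 x u; apply: le_trans (le_max_entry _ x u) _; rewrite le_max; apply/orP; left.
  apply: ub_le_sup; last by exists n.
  exists 1 => _ [k /= k2 <-]; exact: max_entry_le1 (P_bistochastic k k2).
have h0_gt0 : 0 < - ln D by rewrite oppr_gt0 ln_lt0 // D_gt0.
have [j D_j] : exists j, D ^+ j <= eps / 4.
  exists (Num.truncn (- ln (eps / 4) / - ln D)).+1.
  have := truncnS_gt (- ln (eps / 4) / - ln D).
  rewrite ltr_pdivrMr // => H.
  rewrite -[D in D ^+ _]lnK ?posrE // -expRM_natl -[leRHS]lnK ?posrE ?divr_gt0 //.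
  by rewrite ler_expR; move: H; rewrite mulrN; lra.
pose K := (Num.truncn (10 / - ln D + 1)).+1.
have K_ge : 10 / - ln D + 1 <= K%:R by apply/ltW/truncnS_gt.
(* Coefficient of [g * l] in the extra time: the walkers, the escape from bad points and two single
   steps. *)
pose w := 16 / - ln D + j%:R + 2.
have w_gt0 : 0 < w by rewrite ltr_wpDl // addr_ge0 // divr_ge0 // ltW.
pose g := eta / 2 / w.
have g_gt0 : 0 < g by rewrite !divr_gt0.
have g_le : g * w <= eta / 2 by rewrite divfK // gt_eqF.
pose W := failure_const eps eta e.
pose th := eps / 4 * expR (- 2) / 8.
have th_gt0 : 0 < th by rewrite divr_gt0 // mulr_gt0 ?expR_gt0 // divr_gt0.
have W_gt0 : 0 < W.
  have rho_gt0 : 0 < th ^+ 2 / 4 by rewrite divr_gt0 // exprn_gt0.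
  have eta2 (a : R) : 0 <= a -> 0 <= a / eta ^+ 2 by move=> a0; rewrite divr_ge0 // sqr_ge0.
  rewrite /W /failure_const -/th; apply: ltr_wpDr.
    by apply: divr_ge0; [rewrite addr_ge0 ?eta2 | rewrite subr_ge0 ltW].
  by rewrite ltr_wpDl // addr_ge0 ?invr_ge0 ?(ltW rho_gt0) // divr_ge0 ?addr_ge0 ?eta2 // !mulr_ge0 // ltW.
(* The last bound, by [e / 2 / W], leaves half of [e] to the term [e / 2] of the window estimate. *)
pose v := Num.min (Num.min 12^-1 (eps / 4)) (Num.min (th ^+ 2 / 2) (e / 2 / W)).
have v_gt0 : 0 < v.
  by rewrite !lt_min invr_gt0 ltr0n !divr_gt0 // exprn_gt0.
have v_le : v <= 12^-1 by rewrite !ge_min lexx.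
have v_eps : v <= eps / 4 by rewrite !ge_min lexx !orbT.
have v_th : v <= th ^+ 2 / 2 by rewrite !ge_min lexx !orbT.
have v_W : v * W <= e / 2 by rewrite -ler_pdivlMr // !ge_min lexx !orbT.
have half_gt0 : 0 < 2^-1 :> R by rewrite invr_gt0.
have [l0 poly_small] :=
  poly_exp_small 22 (ler0n R (20 * K.+1)) half_gt0 v_gt0.
move/eqoP: P_entropy => P_entropy.
near=> n.
have n2 : (2 <= n)%N by near: n; exact: nbhs_infty_ge.
have l_ge2 : 2 <= ln n%:R :> R by near: n; exact: ln_nat_ge.
have l_gt0 : 0 < ln n%:R :> R by apply: lt_le_trans l_ge2.
have lnl_ge1 : 1 <= ln (ln n%:R) :> R.
  rewrite -[leLHS]expRK ler_ln ?posrE ?expR_gt0 //.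
  by near: n; exact: ln_nat_ge.
have l_large : (20 * K.+1)%:R / v <= ln n%:R by near: n; exact: ln_nat_ge.
have l_exp : - ln v <= eta / 4 * ln n%:R.
  rewrite mulrC -ler_pdivrMr ?divr_gt0 //; near: n; exact: ln_nat_ge.
have l_poly : l0 <= ln n%:R by near: n; exact: ln_nat_ge.
have h_small : entropy_rate (P n) * ln (ln n%:R) <= g * ln n%:R.
  have : `|entropy_rate (P n)| <= g * `|ln n%:R / ln (ln n%:R)|.
    by near: n; exact: P_entropy.
  have lnl_gt0 : 0 < ln (ln n%:R) :> R by apply: lt_le_trans lnl_ge1.
  rewrite [X in _ * X]ger0_norm ?divr_ge0 ?(ltW l_gt0) ?(ltW lnl_gt0) //.
  rewrite mulrA ler_pdivlMr //.
  by apply: le_trans; rewrite ler_wpM2r ?ler_norm // ltW.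
have P_ge x u : 0 < P n x u -> expR (- v * ln n%:R) <= P n x u.
  have dP : `|0 - ln (min_pos_entry (P n)) / ln (n%:R : R)| <= v.
    by near: n; move/cvgrPdist_le: P_min; exact.
  move=> /min_pos_entry_le; apply: le_trans.
  rewrite -[leRHS]lnK ?posrE ?min_pos_entry_gt0 // ler_expR mulNr lerNl.
  rewrite -ler_pdivrMr // mulNr; apply: le_trans dP.
  by rewrite sub0r ler_norm.
have P_bis := P_bistochastic n n2.
have h_ge := entropy_ge_of_max P_bis (ltnW n2) D_gt0 (P_le n n2).
rewrite sub0r normrN ger0_norm ?perm_prob_ge0 //.
have := window_failure P_bis (P_le n n2) D_gt0 D_lt1 eps_gt0 eps_lt1 e_gt0 eta_gt0
  eta_le1 K_ge D_j v_gt0 v_le v_eps v_th g_gt0 g_le l_ge2 lnl_ge1 P_ge h_ge h_small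
  (poly_small _ l_poly) l_large l_exp.
rewrite -/W => failure; apply: (@le_trans _ _ (e / 2 + v * W)); last by lra.
apply: le_trans failure; rewrite ler_wpM2r ?invr_ge0 // ler_nat.
apply/subset_leq_card/fintype.subsetP => s; rewrite !inE.
by apply: le_lt_trans; rewrite lee_fin ge_min lexx.
Unshelve. all: by end_near. Qed.
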